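(* Let $\widehat{\boldsymbol v}_i,\boldsymbol v_i\in\mathbb R^p$ be the half-vectorized empirical and true covariance matrices, and $\widehat{\boldsymbol r}_i,\boldsymbol r_i\in\mathbb R^{p_u}$ the upper-half-vectorized empirical and true correlation matrices, of group $i\in\{1,\dots,a\}$. Then, as $n_i\to\infty$, $$\sqrt{n_i}(\widehat{\boldsymbol r}_i-\boldsymbol r_i)=\boldsymbol M(\boldsymbol v_i,\boldsymbol r_i)\sqrt{n_i}(\widehat{\boldsymbol v}_i-\boldsymbol v_i)+o_P(1),$$ where $$\boldsymbol M(\boldsymbol v_i,\boldsymbol r_i):=\left[\boldsymbol L_p^u-\tfrac12\operatorname{diag}(\boldsymbol r_i)\boldsymbol M_1\right]\operatorname{diag}\Big(\operatorname{vech}\big((V_{i11},\dots,V_{idd})^\top(V_{i11},\dots,V_{idd})\big)\Big)^{-1/2}.$$ Thus, as $n_i\to\infty$, $$\sqrt{n_i}(\widehat{\boldsymbol r}_i-\boldsymbol r_i)\xrightarrow{\ \mathcal D\ }\mathcal N_{p_u}\big(\boldsymbol 0_{p_u},\boldsymbol\Upsilon_i\big),\qquad \boldsymbol\Upsilon_i:=\boldsymbol M(\boldsymbol v_i,\boldsymbol r_i)\boldsymbol\Sigma_i\boldsymbol M(\boldsymbol v_i,\boldsymbol r_i)^\top .$$ Moreover, if $n_i/N\to\kappa_i\in(0,1]$ for $i=1,\dots,a$ as $\min(n_1,\dots,n_a)\to\infty$, where $N=\sum_{i=1}^a n_i$, then for the pooled vectors $\widehat{\boldsymbol r}=(\widehat{\boldsymbol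 r}_1^\top,\dots,\widehat{\boldsymbol r}_a^\top)^\top$ and $\boldsymbol r=(\boldsymbol r_1^\top,\dots,\boldsymbol r_a^\top)^\top$ it also holds that $$\sqrt N(\widehat{\boldsymbol r}-\boldsymbol r)\xrightarrow{\ \mathcal D\ }\mathcal N_{ap_u}\big(\boldsymbol 0_{ap_u},\boldsymbol\Upsilon\big),\qquad \boldsymbol\Upsilon:=\bigoplus_{i=1}^a\kappa_i^{-1}\boldsymbol\Upsilon_i .$$
   Context: Model: $d\ge2$, $a\ge1$; $\boldsymbol X_{ik}=\boldsymbol\mu_i+\boldsymbol\epsilon_{ik}$, $i=1,\dots,a$, $k=1,\dots,n_i$, are independent $d$-dimensional random vectors. Within each group $i$ the residuals $\boldsymbol\epsilon_{i1},\dots,\boldsymbol\epsilon_{in_i}$ are i.i.d. with $\mathbb E(\boldsymbol\epsilon_{i1})=\boldsymbol 0_d$ and $\mathbb E(\|\boldsymbol\epsilon_{i1}\|^4)<\infty$; across groups they are only independent (distributions may differ). $\operatorname{Cov}(\boldsymbol\epsilon_{i1})=\boldsymbol V_i=(V_{ijk})_{j,k\le d}$ has positive diagonal $V_{i11},\dots,V_{idd}>0$. $\boldsymbol R_i$ is the correlation matrix of group $i$. Vectorizations: $p=d(d+1)/2$, $p_u=d(d-1)/2$. For a $d\times d$ matrix $\boldsymbol A=(A_{jk})$, $\operatorname{vech}(\boldsymbol A)=(A_{11},A_{12},\dots,A_{1d},A_{22},\dots,A_{2d},\dots,A_{dd})^\top\in\mathbb R^p$ (upper triangular entries including the diagonal,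 row by row) and $\operatorname{vech}^-(\boldsymbol A)=(A_{12},\dots,A_{1d},A_{23},\dots,A_{2d},\dots,A_{(d-1)d})^\top\in\mathbb R^{p_u}$ (strictly upper triangular entries, row by row). $\boldsymbol v_i=\operatorname{vech}(\boldsymbol V_i)$, $\boldsymbol r_i=\operatorname{vech}^-(\boldsymbol R_i)$, $\boldsymbol\Sigma_i=\operatorname{Cov}(\operatorname{vech}(\boldsymbol\epsilon_{i1}\boldsymbol\epsilon_{i1}^\top))$. Estimators: $\widehat{\boldsymbol V}_i=\frac1{n_i-1}\sum_{k=1}^{n_i}(\boldsymbol X_{ik}-\overline{\boldsymbol X}_i)(\boldsymbol X_{ik}-\overline{\boldsymbol X}_i)^\top$ is the empirical covariance matrix, with $\overline{\boldsymbol X}_i$ the group mean; $\widehat{\boldsymbol R}_i=\widehat{\boldsymbol V}_{i,0}^{-1/2}\widehat{\boldsymbol V}_i\widehat{\boldsymbol V}_{i,0}^{-1/2}$ is the empirical correlation matrix, $\widehat{\boldsymbol V}_{i,0}$ being the diagonal matrix with the diagonal of $\widehat{\boldsymbol V}_i$ (defined arbitrarily on the asymptotically negligible event that a diagonal entry vanishes); $\widehat{\boldsymbol v}_i=\operatorname{vech}(\widehat{\boldsymbol V}_i)$, $\widehat{\boldsymbol r}_i=\operatorname{vech}^-(\widehat{\boldsymbol R}_i)$. Auxiliary matrices: $\boldsymbol e_{k,p}$ is the $k$-th standard basis vector of $\mathbb R^p$. $\boldsymbol a=(a_1,\dots,a_d)$ is the row vector with $a_k=1+\sum_{j=1}^{k-1}(d+1-j)$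 (positions in $\operatorname{vech}$ of the diagonal elements). $\boldsymbol b\in\mathbb R^{p_u}$ contains the numbers $1,\dots,p$ in ascending order without the elements of $\boldsymbol a$. $\boldsymbol H=\boldsymbol 1_d\boldsymbol a$ is the $d\times d$ matrix all of whose rows equal $\boldsymbol a$; $\boldsymbol h_1=\operatorname{vech}^-(\boldsymbol H)$, $\boldsymbol h_2=\operatorname{vech}^-(\boldsymbol H^\top)$, with $\ell$-th components $h_{1,\ell},h_{2,\ell}$. Then $$\boldsymbol M_1=\sum_{\ell=1}^{p_u}\boldsymbol e_{\ell,p_u}(\boldsymbol e_{h_{1,\ell},p}+\boldsymbol e_{h_{2,\ell},p})^\top,\qquad \boldsymbol L_p^u=\sum_{\ell=1}^{p_u}\boldsymbol e_{\ell,p_u}\boldsymbol e_{b_\ell,p}^\top .$$ For a vector $\boldsymbol x$, $\operatorname{diag}(\boldsymbol x)$ is the diagonal matrix with diagonal $\boldsymbol x$; $\bigoplus$ is the direct sum (block diagonal matrix). $\xrightarrow{\mathcal D}$ denotes convergence in distribution. *)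

(* Defs.v *)
From HB Require Import structures.
From mathcomp Require Import all_boot all_order all_algebra.
From mathcomp Require Import all_classical all_reals all_analysis.

Set Implicit Arguments.
Unset Strict Implicit.
Unset Printing Implicit Defensive.

Import Order.TTheory GRing.Theory Num.Theory.
Import numFieldNormedType.Exports.

Local Open Scope classical_set_scope.
Local Open Scope ring_scope.

(* R^q with its Borel sigma-algebra; vectors are columns. *)
Notation borelV R q := (g_sigma_algebraType (@open 'cV[R]_q)).

Section half_vectorization.

Definition dimp (d : nat) : nat := ((d * (d + 1)) %/ 2)%N.
Definition dimpu (d : nat) : nat := ((d * (d - 1)) %/ 2)%N.

Context {U : nmodType}.

(* Stated for an nmodType so that they also apply to matrices of (1-based)
   positions, with U := nat. The lists have sizes dimp d and dimpu d, so the
   default value of nth is never used. *)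
Definition vech d (A : 'M[U]_d) : 'cV[U]_(dimp d) :=
  \col_(l < dimp d) (flatten
    [seq [seq A j k | k : 'I_d <- enum 'I_d & (j <= k)%N]
    | j : 'I_d <- enum 'I_d])`_l.

Definition vechm d (A : 'M[U]_d) : 'cV[U]_(dimpu d) :=
  \col_(l < dimpu d) (flatten
    [seq [seq A j k | k : 'I_d <- enum 'I_d & (j < k)%N]
    | j : 'I_d <- enum 'I_d])`_l.

End half_vectorization.

Section auxiliary_matrices.

(* The entries of avec, bvec, h1 and h2 are 1-based positions in R^p, while
   row and column indices are 0-based: avec d 0 k is a_{k+1}, with
   a_k = 1 + sum_{j=1}^{k-1} (d + 1 - j), the position of A_{kk} in vech A. *)
Definition avec (d : nat) : 'rV[nat]_d :=
  \row_(k < d) (1 + \sum_(1 <= j < k.+1) (d + 1 - j))%N.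

Definition bvec (d : nat) : 'cV[nat]_(dimpu d) :=
  \col_(l < dimpu d)
    [seq k <- iota 1 (dimp d) | k \notin [seq avec d 0 j | j : 'I_d]]`_l.

Definition Hmx (d : nat) : 'M[nat]_d := (const_mx 1 : 'cV[nat]_d) *m avec d.
Definition h1 (d : nat) : 'cV[nat]_(dimpu d) := vechm (Hmx d).
Definition h2 (d : nat) : 'cV[nat]_(dimpu d) := vechm (Hmx d)^T.

Context {R : realType}.

(* e_{k,q}, with k = 1, ..., q. *)
Definition stdb (q k : nat) : 'cV[R]_q := \col_(j < q) (j.+1 == k)%:R.

Definition M1 (d : nat) : 'M[R]_(dimpu d, dimp d) :=
  \sum_(l < dimpu d) stdb (dimpu d) l.+1 *m
    (stdb (dimp d) (h1 d l 0) + stdb (dimp d) (h2 d l 0))^T.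

Definition Lpu (d : nat) : 'M[R]_(dimpu d, dimp d) :=
  \sum_(l < dimpu d) stdb (dimpu d) l.+1 *m (stdb (dimp d) (bvec d l 0))^T.

(* diag(x)^(-1/2); since 0^-1 = 0 here, null entries are mapped to 0. *)
Definition diag_invsqrt q (x : 'cV[R]_q) : 'M[R]_q :=
  diag_mx (\row_(j < q) (Num.sqrt (x j 0))^-1).

(* The matrix M(v, r), where v = vech V enters only through the diagonal of V. *)
Definition Mmx d (V : 'M[R]_d) (r : 'cV[R]_(dimpu d)) :
    'M[R]_(dimpu d, dimp d) :=
  let dV : 'rV[R]_d := \row_(j < d) V j j in
  (Lpu d - 2^-1 *: (diag_mx r^T *m M1 d)) *m diag_invsqrt (vech (dV^T *m dV)).

(* V_0^(-1/2) V V_0^(-1/2), with the convention of diag_invsqrt when some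
   diagonal entry of V vanishes. *)
Definition corr_mx d (V : 'M[R]_d) : 'M[R]_d :=
  let V0 := \col_(j < d) V j j in diag_invsqrt V0 *m V *m diag_invsqrt V0.

Definition sample_mean d (x : nat -> 'cV[R]_d) (n : nat) : 'cV[R]_d :=
  n%:R^-1 *: \sum_(k < n) x k.

Definition sample_cov d (x : nat -> 'cV[R]_d) (n : nat) : 'M[R]_d :=
  (n%:R - 1)^-1 *: \sum_(k < n)
    (x k - sample_mean x n) *m (x k - sample_mean x n)^T.

Definition enorm q (x : 'cV[R]_q) : R := Num.sqrt (\sum_(j < q) x j 0 ^+ 2).

End auxiliary_matrices.

Section probability.
Context {dT : measure_display} {T : measurableType dT} {R : realType}.
Variable P : probability T R.

Definition cov_mx q (Y : T -> 'cV[R]_q) : 'M[R]_q :=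
  \matrix_(j < q, k < q)
    fine (covariance P (fun w => Y w j 0) (fun w => Y w k 0)).

Definition mutually_independent (I : eqType) q
    (Y : I -> {RV P >-> borelV R q}) : Prop :=
  forall (s : seq I) (B : I -> set (borelV R q)),
    uniq s -> (forall i, measurable (B i)) ->
    P (\bigcap_(i in [set` s]) (Y i @^-1` B i)) =
    (\prod_(i <- s) P (Y i @^-1` B i))%E.

Definition identically_distributed q
    (Y Z : {RV P >-> borelV R q}) : Prop :=
  forall B, measurable B -> distribution P Y B = distribution P Z B.

Definition is_oP1 q (Y : nat -> T -> 'cV[R]_q) : Prop :=
  forall e : R, 0 < e ->
    P [set w | e < enorm (Y n w)] @[n --> \oo] --> 0%E.

Definition cvg_in_distribution q (Y : nat -> T -> 'cV[R]_q)
    (nu : probability (borelV R q) R) : Prop :=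
  forall f : 'cV[R]_q -> R, continuous f ->
    (exists C : R, forall x, `|f x| <= C) ->
    'E_P[fun w => f (Y n w)]%E @[n --> \oo] --> 'E_nu[f]%E.

End probability.

Section normal.
Context {R : realType}.

(* N(m, s2) with the degenerate case s2 = 0: the library's normal_prob takes
   the standard deviation, and is not a Dirac mass when it is 0. *)
Definition normal_law (m s2 : R) (B : set R) : \bar R :=
  if s2 == 0 then \d_m B else normal_prob m (Num.sqrt s2) B.

(* nu = N_q(m, S), with S possibly singular: under nu, every t^T x has law
   N(t^T m, t^T S t). *)
Definition is_mvnormal q (nu : probability (borelV R q) R)
    (m : 'cV[R]_q) (S : 'M[R]_q) : Prop :=
  forall (t : 'cV[R]_q) (B : set R), measurable B ->
    nu [set x : 'cV[R]_q | B ((t^T *m x) 0 0)] =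
    normal_law ((t^T *m m) 0 0) ((t^T *m S *m t) 0 0) B.

End normal.

(* Main.v *)
Require Import Defs.
From HB Require Import structures.
From mathcomp Require Import all_boot all_order all_algebra.
From mathcomp Require Import all_classical all_reals all_analysis.
From mathcomp Require Import ring lra measurable_realfun.

Set Implicit Arguments.
Unset Strict Implicit.
Unset Printing Implicit Defensive.

Import Order.TTheory GRing.Theory Num.Theory.
Import numFieldNormedType.Exports.

Local Open Scope classical_set_scope.
Local Open Scope ring_scope.

(* With [W i] the centred empirical second moments of the residuals of group
   [i], the empirical covariances satisfy [sqrt n (Vhat - V) = sqrt n W + o_P(1)],
   and the delta method applied to [V_jk / sqrt (V_jj V_kk)] turns this into
   [sqrt n (rhat - r) = M sqrt n W + o_P(1)]. Hence each statistic of the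
   theorem is, up to [o_P(1)], a sum over the groups of normalised sums of
   independent centred square integrable variables. Replacing the summands one
   at a time gives the limit of [E cos (c + t . Z)], which determines the limit
   law: a function on a cube is approximated, with positive trigonometric
   weights summing to 1, by trigonometric polynomials (a Fejer kernel), and
   tightness takes care of the complement of the cube.
   The characteristic function [psi] of N(0, 1) is obtained without complex
   analysis from [psi s = psi (s / sqrt 2) ^ 2] and the expansion of [psi] at 0,
   and N(0, S) is built from [t^T S t = \sum_u (u . t) ^ 2] by adding to a random
   vector an independent Gaussian multiple of [u]. *)

(** * Trigonometric inequalities *)

(** Real cosines with a free phase carry the whole argument: [cos (c + x)] covers sines through a
    shift of [c] by [pi / 2], so the addition formula stands in for the multiplicativity of complex
    exponentials, and the inductions have to be stated for all [c]. With second moments alone there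
    is no rate of convergence; what is used is that a summand at scale [1 / sqrt n] has a cosine
    transform within [o(1 / n)] of [expR (- s2 / (2 n))] and a sine transform of size [o(1 / n)], so
    that [n] replacements cost [o(1)] altogether. The fourth moment of the residuals makes their
    products square integrable, which is what this scheme requires. The group sizes may differ, but
    all pairs (group, observation) form one independent family, and a single limit statement with
    one coefficient matrix per group gives both limit laws: one nonzero matrix for a single group,
    block columns for the pooled vector. The means [mu] drop out because empirical covariances are
    translation invariant; the divisor [n - 1] and the empirical means contribute terms of order
    [1 / sqrt n] in probability. *)

Section trigonometric_inequalities.
Context {R : realType}.
Implicit Types x y : R.

(** The engine of the Taylor bounds below: each error term vanishes at 0 and has the preceding error
    term as its derivative, so the successive bounds follow from one another. *)
Lemma ge0_of_derive_ge0 (f f' : R -> R) :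
  (forall x, is_derive x 1 f (f' x)) -> f 0 = 0 ->
  (forall x, 0 <= x -> 0 <= f' x) -> forall x, 0 <= x -> 0 <= f x.
Proof.
move=> df f0 f'0 x x0; rewrite -f0.
apply: (@ger0_derive1_ndecry _ f 0) => //.
- move=> z; rewrite in_itv/= andbT => z0.
  by rewrite derive1E; case: (df z) => _ ->; rewrite f'0// ltW.
- by apply: derivable_within_continuous => z _; case: (df z).
Qed.

Lemma sin_le_id x : 0 <= x -> sin x <= x.
Proof.
move=> x0; rewrite -subr_ge0.
apply: (@ge0_of_derive_ge0 (fun x => x - sin x) (fun x => 1 - cos x)) => //.
by rewrite sin0 subrr.
Qed.

Lemma cos_ge_taylor2 x : 0 <= x -> 1 - x ^+ 2 / 2 <= cos x.
Proof.
move=> x0; rewrite -subr_ge0.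
apply: (@ge0_of_derive_ge0 (fun x => cos x - (1 - x ^+ 2 / 2))
  (fun x => x - sin x)) => //.
- move=> z; apply: is_derive_eq.
  by rewrite /GRing.scale/=; field.
- by rewrite cos0 expr0n/= mul0r subr0 subrr.
- by move=> z z0; rewrite subr_ge0 sin_le_id.
Qed.

Lemma sin_ge_taylor3 x : 0 <= x -> x - x ^+ 3 / 6 <= sin x.
Proof.
move=> x0; rewrite -subr_ge0.
apply: (@ge0_of_derive_ge0 (fun x => sin x - (x - x ^+ 3 / 6))
  (fun x => cos x - (1 - x ^+ 2 / 2))) => //.
- move=> z; apply: is_derive_eq.
  by rewrite /GRing.scale/=; field.
- by rewrite sin0 expr0n/= mul0r !subr0.
- by move=> z z0; rewrite subr_ge0 cos_ge_taylor2.
Qed.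

Lemma cos_le_taylor4 x : 0 <= x -> cos x <= 1 - x ^+ 2 / 2 + x ^+ 4 / 24.
Proof.
move=> x0; rewrite -subr_ge0.
apply: (@ge0_of_derive_ge0 (fun x => (1 - x ^+ 2 / 2 + x ^+ 4 / 24) - cos x)
  (fun x => sin x - (x - x ^+ 3 / 6))) => //.
- move=> z; apply: is_derive_eq.
  by rewrite /GRing.scale/=; field.
- by rewrite cos0 !expr0n/= !mul0r subr0 addr0 subrr.
- by move=> z z0; rewrite subr_ge0 sin_ge_taylor3.
Qed.

Lemma norm_sin_sub_id x : `|sin x - x| <= `|x| ^+ 3 / 6.
Proof.
wlog x0 : x / 0 <= x => [wlg|].
  have [/wlg//|x0] := leP 0 x.
  have := wlg (- x); rewrite oppr_ge0 ltW// => /(_ erefl).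
  by rewrite sinN -opprD normrN normrN.
rewrite (ger0_norm x0) distrC ger0_norm ?subr_ge0 ?sin_le_id//.
have := sin_ge_taylor3 x0; lra.
Qed.

(** Weaker near 0 than the cubic bound, but integrable as soon as there is a second moment: it
    serves as the envelope in dominated convergence, the cubic bound giving the pointwise limit.
    Beyond 2, [x - sin x <= x + 1 <= x ^+ 2]. *)
Lemma norm_sin_sub_id_sqr x : `|sin x - x| <= x ^+ 2.
Proof.
wlog x0 : x / 0 <= x => [wlg|].
  have [/wlg//|x0] := leP 0 x.
  have := wlg (- x); rewrite oppr_ge0 ltW// => /(_ erefl).
  by rewrite sinN -opprD normrN sqrrN.
have [x2|x2] := leP x 2.
  apply: (le_trans (norm_sin_sub_id x)); rewrite (ger0_norm x0).
  have : 0 <= x ^+ 2 * (2 - x) by rewrite mulr_ge0 ?sqr_ge0 ?subr_ge0.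
  have := sqr_ge0 x; rewrite !exprS expr0; nra.
have := sin_max x; rewrite ler_norml => /andP[? ?].
rewrite distrC ger0_norm; nra.
Qed.

Lemma norm_cos_sub1 x : `|cos x - 1| <= x ^+ 2 / 2.
Proof.
rewrite distrC ger0_norm ?subr_ge0 ?cos_le1//.
have := cos_ge_taylor2 (normr_ge0 x).
by rewrite cos_norm real_normK ?num_real//; lra.
Qed.

Lemma norm_cos_sub_taylor2 x : `|cos x - 1 + x ^+ 2 / 2| <= x ^+ 4 / 24.
Proof.
rewrite -cos_norm -(real_normK (num_real x)).
have -> : x ^+ 4 = `|x| ^+ 4.
  by rewrite (exprM _ 2 2) -(real_normK (num_real x)) -exprM.
have := cos_ge_taylor2 (normr_ge0 x); have := cos_le_taylor4 (normr_ge0 x).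
by rewrite ler_norml => ? ?; apply/andP; split; nra.
Qed.

Lemma norm_sin_le x : `|sin x| <= `|x|.
Proof.
wlog x0 : x / 0 <= x => [wlg|].
  have [/wlg//|x0] := leP 0 x.
  have := wlg (- x); rewrite oppr_ge0 ltW// => /(_ erefl).
  by rewrite sinN !normrN.
have [x2|x2] := leP x 2; last first.
  by rewrite (le_trans (sin_max x))// (ger0_norm x0); lra.
rewrite (ger0_norm x0) ger0_norm ?sin_le_id//.
have := sin_ge_taylor3 x0; have : 0 <= x * (4 - x * x) by nra.
by rewrite !exprS expr0; nra.
Qed.

(** By the product form [- 2 * (sin ((x + y) / 2) * sin ((x - y) / 2))]. It lets an [o_P(1)]
    perturbation pass through the cosine. *)
Lemma norm_cos_sub_le x y : `|cos x - cos y| <= `|x - y|.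
Proof.
have -> : cos x - cos y = - 2 * (sin ((x + y) / 2) * sin ((x - y) / 2)).
  have ex : x = (x + y) / 2 + (x - y) / 2 by field.
  have ey : y = (x + y) / 2 - (x - y) / 2 by field.
  have -> : cos x = cos ((x + y) / 2 + (x - y) / 2) by rewrite -ex.
  have -> : cos y = cos ((x + y) / 2 - (x - y) / 2) by rewrite -ey.
  by rewrite cosD cosB; ring.
rewrite mulNr normrN !normrM normr_nat.
have := norm_sin_le ((x - y) / 2).
rewrite normrM normfV normr_nat.
have := sin_max ((x + y) / 2); have := normr_ge0 (sin ((x - y) / 2)).
by have := normr_ge0 (sin ((x + y) / 2)); nra.
Qed.

(** The cubic Taylor bound leaves the slope [1 - (81 / 16) / 6 = 5 / 32 > 1 / 7]. The endpoint is
    dictated by the range [|v| <= pi + 1 / 2] of the Fejer tail bound: half of it is at most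
    [2 + 1 / 4]. *)
Lemma sin_ge_seventh x : 0 <= x <= 9 / 4 -> x / 7 <= sin x.
Proof.
move=> /andP[x0 x1]; apply: le_trans (sin_ge_taylor3 x0).
have : 0 <= x * (81 / 16 - x * x) by nra.
by rewrite !exprS expr0; nra.
Qed.

Lemma sqr_sin_ge x : `|x| <= 9 / 4 -> x ^+ 2 / 49 <= sin x ^+ 2.
Proof.
wlog x0 : x / 0 <= x => [wlg|].
  have [/wlg//|x0] := leP 0 x.
  have := wlg (- x); rewrite oppr_ge0 ltW// => /(_ erefl).
  by rewrite sinN !sqrrN normrN.
rewrite ger0_norm// => x1.
have /sin_ge_seventh : 0 <= x <= 9 / 4 by apply/andP.
by nra.
Qed.

End trigonometric_inequalities.

(** * Expectations and measurability in R^q *)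

Section borel_vectors.
Context {R : realType} {q : nat}.
Implicit Types x y t : 'cV[R]_q.

Lemma dotE t x : (t^T *m x) 0 0 = \sum_(j < q) t j 0 * x j 0.
Proof. by rewrite mxE; apply: eq_bigr => j _; rewrite mxE. Qed.

Lemma near_cV (U : set 'cV[R]_q) x : open U -> U x ->
  exists2 e : R, 0 < e & forall y, (forall j, `|y j 0 - x j 0| < e) -> U y.
Proof.
rewrite openE => /(_ x) + Ux => /(_ Ux) /nbhs_ballP[e /= e0 xeU].
exists e => // y yx; apply: xeU; split => // i j.
by rewrite (ord1 j); rewrite /ball/= distrC.
Qed.

(** Half-open cubes of side [1 / (kc.1 + 1)] on the matching lattice. The index type is countable,
    and membership is a condition on the floor of each coordinate, hence measurable. *)
Definition dyadic_box (kc : nat * {ffun 'I_q -> int}) : set 'cV[R]_q :=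
  [set x | forall j, kc.2 j = Num.floor (x j 0 * kc.1.+1%:R)].

Lemma open_bigcup_dyadic_box (U : set 'cV[R]_q) : open U ->
  U = \bigcup_(kc in [set kc | dyadic_box kc `<=` U]) dyadic_box kc.
Proof.
move=> oU; apply/seteqP; split => [x Ux|x [kc /= +]]; last exact.
have [e e0 xeU] := near_cV oU Ux.
pose k := Num.truncn e^-1.
have ke : k.+1%:R^-1 < e.
  by rewrite -[ltRHS]invrK ltf_pV2 ?posrE ?invr_gt0 ?ltr0n// truncnS_gt.
exists (k, [ffun j => Num.floor (x j 0 * k.+1%:R)]) => [|j]/=; last by rewrite ffunE.
move=> y yx; apply: xeU => j; apply: le_lt_trans ke.
have := yx j; rewrite /= ffunE => xy.
have /andP[x1 x2] := floor_itv (x j 0 * k.+1%:R).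
have /andP[y1 y2] := floor_itv (y j 0 * k.+1%:R).
rewrite xy in x1 x2; rewrite -(ler_pM2r (ltr0Sn R k)) mulVf ?pnatr_eq0//.
rewrite -[X in `|_| * X]gtr0_norm// -normrM mulrBl ler_norml.
by rewrite intrD in x2 y2; apply/andP; split; lra.
Qed.

(** The sigma-algebra is generated by open sets, not by coordinates. An open set is a countable
    union of cubes, and the preimage of a cube is a finite intersection of coordinate events. *)
Lemma measurable_fun_cV d (T : measurableType d) (f : T -> 'cV[R]_q) :
  (forall j, measurable_fun setT (fun w => f w j 0)) ->
  measurable_fun setT (f : T -> borelV R q).
Proof.
move=> mf.
apply: (@measurability _ _ T (borelV R q) setT f (@open 'cV[R]_q)) => //.
move=> _ [U oU <-]; rewrite setTI (open_bigcup_dyadic_box oU) preimage_bigcup.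
rewrite bigcup_mkcond; apply: countable_bigcupT_measurable => // kc.
case: ifPn => // _.
rewrite (_ : _ @^-1` _ = \bigcap_(j in [set: 'I_q])
  ((fun w => f w j 0 * kc.1.+1%:R) @^-1` [set x | kc.2 j = Num.floor x])).
  apply: fin_bigcap_measurable => // j _.
  rewrite -[X in measurable X]setTI.
  apply: (measurable_funM (mf j) (measurable_cst _)) => //.
  rewrite (_ : [set x | _] = `[(kc.2 j)%:~R, (kc.2 j + 1)%:~R[%classic)//.
  apply/seteqP; split => [x /= ->|x /=]; rewrite in_itv/=.
    exact: floor_itv.
  by move=> /floor_def ->.
by apply/seteqP; split => w /= H j => [_|]; exact: H.
Qed.

Lemma measurable_coord j : measurable_fun setT (fun x : borelV R q => (x : 'cV[R]_q) j 0).
Proof.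
apply: (measurability _ (RGenOInfty.measurableE R)) => _ [U [x ->] <-].
rewrite setTI; apply: sub_sigma_algebra; have oU := @rray_open _ R x.
by apply: open_comp => // y _; exact: coord_continuous.
Qed.

Lemma continuous_measurable_cV (f : 'cV[R]_q -> R) : continuous f ->
  measurable_fun setT (f : borelV R q -> R).
Proof.
move=> cf; apply: (measurability _ (RGenOInfty.measurableE R)) => _ [U [x ->] <-].
rewrite setTI; apply: sub_sigma_algebra; have oU := @rray_open _ R x.
by apply: open_comp => // y _; exact: cf.
Qed.

Lemma measurable_dot t : measurable_fun setT
  (fun x : borelV R q => (t^T *m (x : 'cV[R]_q)) 0 0).
Proof.
under eq_fun do rewrite dotE.
apply: measurable_sum => j; apply: measurable_funM => //; exact: measurable_coord.
Qed.

End borel_vectors.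

Section expectation.
Context d (T : measurableType d) (R : realType) (P : probability T R).
Implicit Types f g : T -> R.

Definition Ex f : R := \int[P]_w f w.
Definition Lint f := P.-integrable setT (EFin \o f).
(** Refers to no probability on purpose: such functions are integrable under every one, so the same
    certificate serves for [P], for the limit law and for product laws. *)
Definition bmeas f := measurable_fun setT f /\ exists C : R, forall x, `|f x| <= C.

Lemma bmeas_Lint f : bmeas f -> Lint f.
Proof.
move=> [mf [C fC]]; apply: measurable_bounded_integrable => //.
  by rewrite (le_lt_trans (probability_le1 P _))// ltry.
exists C; split; first exact: num_real.
by move=> y Cy x _ /=; exact: le_trans (fC x) (ltW Cy).
Qed.

Lemma bmeas_cst a : bmeas (cst a).
Proof. by split => //; exists `|a|. Qed.

Lemma bmeasD f g : bmeas f -> bmeas g -> bmeas (fun x => f x + g x).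
Proof.
move=> [mf [C fC]] [mg [D gD]]; split; first exact: measurable_funD.
by exists (C + D) => x; rewrite (le_trans (ler_normD _ _))// lerD.
Qed.

Lemma bmeasM f g : bmeas f -> bmeas g -> bmeas (fun x => f x * g x).
Proof.
move=> [mf [C fC]] [mg [D gD]]; split; first exact: measurable_funM.
by exists (C * D) => x; rewrite normrM ler_pM.
Qed.

Lemma bmeasZ a f : bmeas f -> bmeas (fun x => a * f x).
Proof. by move=> ?; apply: bmeasM => //; exact: bmeas_cst. Qed.

Lemma bmeasN f : bmeas f -> bmeas (fun x => - f x).
Proof. by move=> /(bmeasZ (-1)); under eq_fun do rewrite mulN1r. Qed.

Lemma bmeasB f g : bmeas f -> bmeas g -> bmeas (fun x => f x - g x).
Proof. by move=> ? /bmeasN; exact: bmeasD. Qed.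

Lemma bmeas_indic (A : set T) : measurable A -> bmeas (\1_A).
Proof.
move=> mA; split; first exact: measurable_indic.
exists 1 => x; rewrite indicE ger0_norm//; by case: (_ \in _).
Qed.

Lemma bmeas_cos f : measurable_fun setT f -> bmeas (fun x => cos (f x)).
Proof.
move=> mf; split; last by exists 1 => x; exact: cos_max.
apply: measurableT_comp => //; apply: continuous_measurable_fun.
exact: continuous_cos.
Qed.

Lemma bmeas_sin f : measurable_fun setT f -> bmeas (fun x => sin (f x)).
Proof.
move=> mf; split; last by exists 1 => x; exact: sin_max.
apply: measurableT_comp => //; apply: continuous_measurable_fun.
exact: continuous_sin.
Qed.

Lemma Ex_cst a : Ex (cst a) = a.
Proof.
rewrite /Ex Rintegral_cst//.
set p := (X in fine X).
have -> : p = 1%E by exact: probability_setT.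
by rewrite mulr1.
Qed.

Lemma ExD f g : Lint f -> Lint g -> Ex (fun x => f x + g x) = Ex f + Ex g.
Proof. exact: RintegralD. Qed.

Lemma ExB f g : Lint f -> Lint g -> Ex (fun x => f x - g x) = Ex f - Ex g.
Proof. exact: RintegralB. Qed.

Lemma ExZ a f : Lint f -> Ex (fun x => a * f x) = a * Ex f.
Proof. exact: RintegralZl. Qed.

Lemma le_Ex f g : Lint f -> Lint g -> (forall x, f x <= g x) -> Ex f <= Ex g.
Proof. by move=> *; exact: le_Rintegral. Qed.

Lemma Ex_ge0 f : (forall x, 0 <= f x) -> 0 <= Ex f.
Proof. by move=> f0; exact: Rintegral_ge0. Qed.

Lemma le_norm_Ex f : Lint f -> `|Ex f| <= Ex (fun x => `|f x|).
Proof. exact: le_normr_Rintegral. Qed.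

Lemma Lint_measurable f : Lint f -> measurable_fun setT f.
Proof. by move=> /measurable_int/measurable_EFinP. Qed.

Lemma le_Lint f g : measurable_fun setT f -> Lint g ->
  (forall x, `|f x| <= g x) -> Lint f.
Proof.
move=> mf ig fg; apply: le_integrable ig => //; first exact/measurable_EFinP.
by move=> x _; rewrite lee_fin (le_trans (fg x))// ler_norm.
Qed.

Lemma LintD f g : Lint f -> Lint g -> Lint (fun x => f x + g x).
Proof. by move=> fi gi; exact: (integrableD _ fi gi). Qed.

Lemma LintZ a f : Lint f -> Lint (fun x => a * f x).
Proof. by move=> fi; exact: (integrableZl _ _ fi). Qed.

Lemma Lint_sum (I : Type) (s : seq I) (F : I -> T -> R) :
  (forall i, Lint (F i)) -> Lint (fun x => \sum_(i <- s) F i x).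
Proof.
move=> FL; elim: s => [|i s ih].
  by under eq_fun do rewrite big_nil; exact/bmeas_Lint/bmeas_cst.
by under eq_fun do rewrite big_cons; exact: LintD.
Qed.

Lemma Ex_sum (I : Type) (s : seq I) (F : I -> T -> R) :
  (forall i, Lint (F i)) ->
  Ex (fun x => \sum_(i <- s) F i x) = \sum_(i <- s) Ex (F i).
Proof.
move=> FL; elim: s => [|i s ih].
  by under eq_fun do rewrite big_nil; rewrite big_nil Ex_cst.
under eq_fun do rewrite big_cons.
by rewrite big_cons ExD ?ih//; exact: Lint_sum.
Qed.

Lemma Ex_indic (A : set T) : measurable A -> Ex (\1_A) = fine (P A).
Proof. by move=> mA; rewrite /Ex /Rintegral integral_indic// setIT. Qed.

Lemma expectationE f : Lint f -> ('E_P[f] = (Ex f)%:E)%E.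
Proof.
by move=> fi; rewrite unlock /Ex /Rintegral fineK//; exact: integrable_fin_num.
Qed.

End expectation.

(** * Trigonometric polynomials and the criterion for convergence in distribution *)

Section trigonometric_polynomials.
Context {R : realType} {q : nat}.
Implicit Types (t x : 'cV[R]_q) (f g : 'cV[R]_q -> R).

(** The phase [c] brings in sines, so that the class is closed under products by the product-to-sum
    formulas, with real coefficients only. *)
Inductive trigpoly : ('cV[R]_q -> R) -> Prop :=
| trigpoly_cos t c : trigpoly (fun x => cos ((t^T *m x) 0 0 + c))
| trigpolyD f g : trigpoly f -> trigpoly g -> trigpoly (fun x => f x + g x)
| trigpolyZ a f : trigpoly f -> trigpoly (fun x => a * f x).

Lemma dotDl t t' x :
  ((t + t')^T *m x) 0 0 = (t^T *m x) 0 0 + (t'^T *m x) 0 0.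
Proof.
by rewrite !dotE -big_split/=; apply: eq_bigr => j _; rewrite mxE mulrDl.
Qed.

Lemma dotBl t t' x :
  ((t - t')^T *m x) 0 0 = (t^T *m x) 0 0 - (t'^T *m x) 0 0.
Proof.
by rewrite !dotE -sumrB/=; apply: eq_bigr => j _; rewrite !mxE mulrBl.
Qed.

Lemma trigpoly_cst a : trigpoly (cst a).
Proof.
rewrite (_ : cst a = fun x => a * cos (((0 : 'cV[R]_q)^T *m x) 0 0 + 0)).
  exact/trigpolyZ/trigpoly_cos.
by apply/funext => x; rewrite trmx0 mul0mx mxE addr0 cos0 mulr1.
Qed.

Lemma trigpoly_sum (I : Type) (s : seq I) (F : I -> 'cV[R]_q -> R) :
  (forall i, trigpoly (F i)) -> trigpoly (fun x => \sum_(i <- s) F i x).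
Proof.
move=> tF; elim: s => [|i s ih].
  by under eq_fun do rewrite big_nil; exact: trigpoly_cst.
by under eq_fun do rewrite big_cons; exact: trigpolyD.
Qed.

Lemma trigpolyM f g : trigpoly f -> trigpoly g -> trigpoly (fun x => f x * g x).
Proof.
move=> tf; elim: tf g => [t c|f1 f2 _ ih1 _ ih2|a f1 _ ih1] g tg.
- elim: tg => [t' c'|g1 g2 _ ih1 _ ih2|a g1 _ ih1].
  + rewrite (_ : (fun x => _) = fun x =>
      2^-1 * cos (((t + t')^T *m x) 0 0 + (c + c')) +
      2^-1 * cos (((t - t')^T *m x) 0 0 + (c - c'))).
      by apply: trigpolyD; apply: trigpolyZ; exact: trigpoly_cos.
    apply/funext => x.
    set u := (t^T *m x) 0 0; set u' := (t'^T *m x) 0 0.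
    have -> : ((t + t')^T *m x) 0 0 + (c + c') = (u + c) + (u' + c').
      by rewrite dotDl -/u -/u'; ring.
    have -> : ((t - t')^T *m x) 0 0 + (c - c') = (u + c) - (u' + c').
      by rewrite dotBl -/u -/u'; ring.
    by rewrite (cosD (u + c) (u' + c')) (cosB (u + c) (u' + c')); field.
  + by under eq_fun do rewrite mulrDr; exact: trigpolyD.
  + by under eq_fun do rewrite mulrCA; exact: trigpolyZ.
- by under eq_fun do rewrite mulrDl; apply: trigpolyD; [exact: ih1|exact: ih2].
- by under eq_fun do rewrite -mulrA; apply: trigpolyZ; exact: ih1.
Qed.

Lemma trigpoly_prod (I : Type) (s : seq I) (F : I -> 'cV[R]_q -> R) :
  (forall i, trigpoly (F i)) -> trigpoly (fun x => \prod_(i <- s) F i x).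
Proof.
move=> tF; elim: s => [|i s ih].
  by under eq_fun do rewrite big_nil; exact: trigpoly_cst.
by under eq_fun do rewrite big_cons; exact: trigpolyM.
Qed.

Lemma trigpoly_coord i a c : trigpoly (fun x => cos (a * x i 0 + c)).
Proof.
rewrite (_ : (fun x => _) =
    fun x => cos (((\col_j (a * (j == i)%:R))^T *m x) 0 0 + c)).
  exact: trigpoly_cos.
apply/funext => x; rewrite dotE (bigD1 i)//= big1 ?addr0 ?mxE ?eqxx ?mulr1//.
by move=> j /negPf ji; rewrite mxE ji mulr0 mul0r.
Qed.

Lemma trigpoly_bmeas f : trigpoly f -> bmeas (f : borelV R q -> R).
Proof.
elim=> [t c|f1 f2 _ ih1 _ ih2|a f1 _ ih1].
- by apply: bmeas_cos; apply: measurable_funD => //; exact: measurable_dot.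
- exact: bmeasD.
- exact: bmeasZ.
Qed.

End trigonometric_polynomials.

(** * Fejer kernels: closed form, partition of unity, tails *)

Section fejer_kernel.
Context {R : realType}.
Implicit Types u : R.

(* The Fejer kernel of order [2 ^ k], in the product form which makes its
   properties provable by induction on [k]. *)
Fixpoint fejer k u : R :=
  if k is k'.+1 then cos (u / 2) ^+ 2 * fejer k' (u *+ 2) else 1.

Lemma fejer_ge0 k u : 0 <= fejer k u.
Proof. by elim: k u => //= k ih u; rewrite mulr_ge0// sqr_ge0. Qed.

(** The usual quotient of squared sines, kept free of division so that the zeros of [sin (u / 2)]
    need no separate case. It is [sin u = 2 sin (u / 2) cos (u / 2)] iterated. *)
Lemma fejer_sin k u :
  fejer k u * (2 ^+ k) ^+ 2 * sin (u / 2) ^+ 2 = sin (2 ^+ k * u / 2) ^+ 2.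
Proof.
elim: k u => [|k ih] u /=; first by rewrite !expr0 expr1n !mul1r.
have -> : 2 ^+ k.+1 * u / 2 = 2 ^+ k * (u *+ 2) / 2 :> R.
  by rewrite exprS -mulr_natr; field.
rewrite -ih.
have -> : u *+ 2 / 2 = (u / 2) *+ 2 by rewrite mulrnAl.
by rewrite sin_mulr2n [2 ^+ k.+1]exprS; ring.
Qed.

Lemma fejerB2pi k u : fejer k (u - pi *+ 2) = fejer k u.
Proof.
elim: k u => //= k ih u; congr (_ * _).
  have -> : (u - pi *+ 2) / 2 = u / 2 - pi by field.
  by have := cosDpi (u / 2 - pi); rewrite subrK => ->; rewrite sqrrN.
have -> : (u - pi *+ 2) *+ 2 = u *+ 2 - pi *+ 2 - pi *+ 2.
  by ring.
by rewrite !ih.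
Qed.

(** The translates form a partition of unity. At order [k.+1] the terms [j] and [j + 2 ^ k] are a
    shift by [pi] apart: they share the factor of order [k] at the doubled angle, and their other
    factors [cos ^+ 2] and [sin ^+ 2] add up to 1. *)
Lemma sum_fejer k u :
  \sum_(j < 2 ^ k) fejer k (u - pi *+ 2 * j%:R / 2 ^+ k) = 1.
Proof.
elim: k u => [|k ih] u; first by rewrite big_ord1.
rewrite -(big_mkord xpredT (fun j => fejer k.+1 (u - pi *+ 2 * j%:R / 2 ^+ k.+1))).
rewrite expnS mul2n -addnn (big_cat_nat (n := 2 ^ k))//=; last exact: leq_addr.
rewrite -{2}[(2 ^ k)%N]add0n big_addn addnK !big_mkord -big_split/=.
rewrite -[RHS](ih (u *+ 2)); apply: eq_bigr => j _.
rewrite natrD natrX.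
set v := u - pi *+ 2 * j%:R / 2 ^+ k.+1.
have k0 : 2 ^+ k != 0 :> R by rewrite expf_neq0// pnatr_eq0.
have -> : u - pi *+ 2 * (j%:R + 2 ^+ k) / 2 ^+ k.+1 = v - pi.
  by rewrite /v exprS -mulr_natr; field.
have vE : v *+ 2 = u *+ 2 - pi *+ 2 * j%:R / 2 ^+ k.
  by rewrite /v exprS; field.
have -> : (v - pi) *+ 2 = v *+ 2 - pi *+ 2 by ring.
have -> : (v - pi) / 2 = v / 2 - pi / 2 by field.
by rewrite fejerB2pi vE cosBpihalf -mulrDl cos2Dsin2 mul1r.
Qed.

Lemma trigpoly_fejer q i k a b :
  trigpoly (fun x : 'cV[R]_q => fejer k (a * x i 0 + b)).
Proof.
elim: k a b => [|k ih] a b /=; first exact: trigpoly_cst.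
have cosE : (fun x : 'cV[R]_q => cos ((a * x i 0 + b) / 2)) =
    (fun x => cos (a / 2 * x i 0 + b / 2)).
  by apply/funext => x; congr cos; ring.
apply: trigpolyM.
  under eq_fun do rewrite expr2.
  by apply: trigpolyM; rewrite cosE; exact: trigpoly_coord.
rewrite (_ : (fun x => _) =
  (fun x : 'cV[R]_q => fejer k ((a *+ 2) * x i 0 + b *+ 2))); first exact: ih.
by apply/funext => x; rewrite mulrnDl mulrnAl.
Qed.

(** From the closed form and [sin (v / 2) ^+ 2 >= (v / 2) ^+ 2 / 49]; the constant is
    [196 = 4 * 49]. The range covers an angle of modulus at most [1 / 2] minus a node of
    [[- pi, pi]]. *)
Lemma fejer_tail k v : `|v| <= pi + 2^-1 ->
  v ^+ 2 * fejer k v <= 196 / 4 ^+ k.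
Proof.
move=> vpi.
have h : `|v / 2| <= 9 / 4.
  rewrite normrM normfV normr_nat.
  have := pihalf_lt2 R; lra.
have k0 : 0 < 4 ^+ k :> R by rewrite exprn_gt0.
rewrite ler_pdivlMr//.
have := sqr_sin_ge h; have := fejer_sin k v.
have -> : (2 ^+ k) ^+ 2 = 4 ^+ k :> R by rewrite -exprM mulnC exprM -natrX.
have : sin (2 ^+ k * v / 2) ^+ 2 <= 1.
  by rewrite sin2cos2 gerBl sqr_ge0.
move: (fejer_ge0 k v); set F := fejer k v; set s := sin (v / 2) ^+ 2.
set s' := sin _ ^+ 2 => F0 s1 FE s2.
have : F * 4 ^+ k * ((v / 2) ^+ 2 / 49) <= 1.
  apply: le_trans s1; rewrite -FE ler_wpM2l// mulr_ge0// ltW//.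
lra.
Qed.

End fejer_kernel.

(** * Approximation on a cube by positive trigonometric weights *)

Section trigonometric_approximation.
Context {R : realType} {q : nat}.
Implicit Types (x y : 'cV[R]_q) (f : 'cV[R]_q -> R).

Lemma compact_cube (L : R) : compact [set x : 'cV[R]_q | forall i, `|x i 0| <= L].
Proof.
rewrite (_ : [set x | _] =
    trmx @` [set v : 'rV[R]_q | forall i, `[- L, L]%classic (v ord0 i)]).
  apply: continuous_compact; last first.
    by apply: (@rV_compact _ _ (fun=> `[- L, L]%classic)) => _; exact: segment_compact.
  apply: continuous_subspaceT => v A /nbhs_ballP[e e0 eA].
  apply/nbhs_ballP; exists e => // u [_ uv]; apply: eA; split => // i j.
  by rewrite !mxE; exact: uv.
apply/seteqP; split => [x xL|_ [v vL <-] i]/=.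
  by exists x^T; rewrite ?trmxK// => i /=; rewrite mxE in_itv/= -ler_norml.
by have := vL i; rewrite /= mxE in_itv/= -ler_norml.
Qed.

(** Only [x] is confined to the cube: the grid points compared with [x] later on may fall outside
    it. *)
Lemma uniform_continuity_cube f (L e : R) : continuous f -> 0 < e ->
  exists2 dlt : R, 0 < dlt & forall x, (forall i, `|x i 0| <= L) ->
    forall y, (forall i, `|y i 0 - x i 0| <= dlt) -> `|f y - f x| <= e.
Proof.
move=> cf e0.
have cov := (compact_near_coveringP _).1 (@compact_cube L).
suff H : \forall d \near 0^'+, [set x : 'cV[R]_q | forall i, `|x i 0| <= L] `<=`
    (fun x => forall y, (forall i, `|y i 0 - x i 0| <= d) -> `|f y - f x| <= e).
  have : \forall d \near (0 : R)^'+, 0 < d /\ forall x, (forall i, `|x i 0| <= L) ->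
    forall y, (forall i, `|y i 0 - x i 0| <= d) -> `|f y - f x| <= e.
    by apply: filterS2 (nbhs_right_gt (0 : R)) H => d d0 dP; split => // x; exact: dP.
  by move=> /filter_ex[d [d0 dP]]; exists d.
apply: cov => x xL.
pose U := f @^-1` (ball (f x) (e / 2)).
have oU : open U by apply: open_comp => [? _|]; [exact: cf|exact: ball_open].
have Ux : U x by apply: ballxx; rewrite divr_gt0.
have [n n0 nU] := near_cV oU Ux.
have fn y : (forall j, `|y j 0 - x j 0| < n) -> `|f x - f y| < e / 2.
  by move=> /nU; rewrite /U /= /ball/=.
exists (ball x (n / 2), [set d | d < n / 2]).
  split => /=; first by apply: nbhsx_ballx; rewrite divr_gt0.
  by apply: nbhs_right_lt; rewrite divr_gt0.
move=> [x' d] /= [[_ xx'] dn] y yx'.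
have h1 : `|f x - f x'| < e / 2.
  apply: fn => j; have := xx' j 0; rewrite /ball/= distrC => /lt_le_trans; apply.
  by have := n0; lra.
have h2 : `|f x - f y| < e / 2.
  apply: fn => j; have := xx' j 0; rewrite /ball/= distrC => h.
  have := le_lt_trans (yx' j) dn => h'.
  rewrite -(subrK (x' j 0) (y j 0)) -addrA (le_lt_trans (ler_normD _ _))//.
  by rewrite [n]splitr ltrD.
rewrite ltW// -(subrK (f x) (f y)) -addrA (le_lt_trans (ler_normD _ _))//.
by rewrite [e]splitr ltrD// distrC.
Qed.

Variables (lam : R) (k : nat).
Hypothesis lam0 : 0 < lam.

Definition grid (j : {ffun 'I_q -> 'I_(2 ^ k)}) : 'cV[R]_q :=
  \col_i (lam * (pi *+ 2 * (j i)%:R / 2 ^+ k - pi)).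

(** The factors are Fejer kernels at [(x i 0 - grid j i 0) / lam]. For fixed [x] these weights form
    a product probability on the grid, concentrated near [x]; [trig_approx] is the mean of [f] under
    it, in the manner of Bernstein polynomials. *)
Definition grid_kernel (j : {ffun 'I_q -> 'I_(2 ^ k)}) x : R :=
  \prod_i fejer k (x i 0 / lam + pi - pi *+ 2 * (j i)%:R / 2 ^+ k).

Definition trig_approx f x : R := \sum_j f (grid j) * grid_kernel j x.

Lemma grid_kernel_ge0 j x : 0 <= grid_kernel j x.
Proof. by apply: prodr_ge0 => i _; exact: fejer_ge0. Qed.

Lemma sum_grid_kernel x : \sum_j grid_kernel j x = 1.
Proof.
rewrite -(bigA_distr_bigA (fun i (j : 'I_(2 ^ k)) =>
  fejer k (x i 0 / lam + pi - pi *+ 2 * j%:R / 2 ^+ k)))/=.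
by rewrite big1// => i _; exact: sum_fejer.
Qed.

Lemma trigpoly_trig_approx f : trigpoly (trig_approx f).
Proof.
apply: trigpoly_sum => j; apply: trigpolyZ; apply: trigpoly_prod => i.
under eq_fun do rewrite (mulrC _ lam^-1) -addrA.
exact: trigpoly_fejer.
Qed.

Lemma trig_approx_bound f C x : (forall y, `|f y| <= C) -> `|trig_approx f x| <= C.
Proof.
move=> fC; rewrite (le_trans (ler_norm_sum _ _ _))//.
rewrite -[leRHS]mulr1 -(sum_grid_kernel x) mulr_sumr ler_sum// => j _.
by rewrite normrM ler_pM// ger0_norm// grid_kernel_ge0.
Qed.

(** The weights are a product over the coordinates, so all factors but that of [i0] sum to 1. Each
    of the [2 ^ k] remaining terms is at most [lam ^+ 2 * 196 / 4 ^ k] by the tail bound, whose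
    range is the reason for the bound [lam / 2]. *)
Lemma grid_kernel_variance x i0 : `|x i0 0| <= lam / 2 ->
  \sum_j grid_kernel j x * (grid j i0 0 - x i0 0) ^+ 2 <= lam ^+ 2 * 196 / 2 ^+ k.
Proof.
move=> xlam.
pose F i (j : 'I_(2 ^ k)) :=
  fejer k (x i 0 / lam + pi - pi *+ 2 * j%:R / 2 ^+ k) *
  (if i == i0 then (lam * (pi *+ 2 * j%:R / 2 ^+ k - pi) - x i0 0) ^+ 2 else 1).
rewrite (eq_bigr (fun j : {ffun 'I_q -> 'I_(2 ^ k)} => \prod_i F i (j i))); last first.
  move=> j _; rewrite big_split/=; congr (_ * _).
  by rewrite -big_mkcond/= big_pred1_eq mxE.
rewrite -(bigA_distr_bigA F)/= (bigD1 i0)//= [X in _ * X]big1 ?mulr1; last first.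
  move=> i /negPf ii0; rewrite /F ii0; under eq_bigr do rewrite mulr1.
  exact: sum_fejer.
have k0 : 0 < 2 ^+ k :> R by rewrite exprn_gt0.
have -> : lam ^+ 2 * 196 / 2 ^+ k = \sum_(j < 2 ^ k) lam ^+ 2 * (196 / 4 ^+ k) :> R.
  rewrite sumr_const card_ord -[RHS]mulr_natr natrX.
  have -> : 4 ^+ k = 2 ^+ k * 2 ^+ k :> R by rewrite -exprMn -natrM.
  by field; rewrite gt_eqF.
apply: ler_sum => j _; rewrite /F eqxx.
set v := x i0 0 / lam + pi - pi *+ 2 * j%:R / 2 ^+ k.
have -> : lam * (pi *+ 2 * j%:R / 2 ^+ k - pi) - x i0 0 = - lam * v.
  by rewrite /v; field; rewrite !gt_eqF.
rewrite exprMn sqrrN mulrCA ler_pM2l ?exprn_gt0// mulrC fejer_tail//.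
have j0 : 0 <= j%:R / 2 ^+ k :> R by rewrite divr_ge0// ltW.
have j1 : j%:R / 2 ^+ k <= 1 :> R.
  by rewrite ler_pdivrMr// mul1r -natrX ler_nat ltnW.
have : `|x i0 0 / lam| <= 2^-1.
  by rewrite normrM normfV (gtr0_norm lam0) ler_pdivrMr// mulrC.
rewrite /v -mulrA; set s := j%:R / _ in j0 j1 *; set z := _ / lam.
rewrite !ler_norml => /andP[h1 h2]; have pi0 := pi_gt0 R.
have h3 : 0 <= pi * s by apply: mulr_ge0 => //; exact: ltW.
have h4 : 0 <= pi * (1 - s) by apply: mulr_ge0; rewrite ?subr_ge0// ltW.
by rewrite mulrnAl; apply/andP; split; lra.
Qed.

(** Chebyshev's argument: a grid point [y] is either [dlt]-close to [x], or has a coordinate so far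
    that [(2 * C / dlt ^+ 2) * \sum_i (y i 0 - x i 0) ^+ 2] exceeds the trivial bound [2 * C].
    Averaging over the weights brings in the variances. *)
Lemma trig_approx_error f (C dlt e : R) x : 0 < dlt -> 0 <= C ->
  (forall y, `|f y| <= C) ->
  (forall y, (forall i, `|y i 0 - x i 0| <= dlt) -> `|f y - f x| <= e) ->
  (forall i, `|x i 0| <= lam / 2) -> 0 <= e ->
  `|trig_approx f x - f x| <= e + (2 * C / dlt ^+ 2) * (q%:R * (lam ^+ 2 * 196)) / 2 ^+ k.
Proof.
move=> dlt0 C0 fC fd xlam e0.
have d20 : 0 < dlt ^+ 2 by rewrite exprn_gt0.
have pt y : `|f y - f x| <= e + (2 * C / dlt ^+ 2) * \sum_i (y i 0 - x i 0) ^+ 2.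
  have S0 : 0 <= (2 * C / dlt ^+ 2) * \sum_i (y i 0 - x i 0) ^+ 2.
    rewrite mulr_ge0//; first by rewrite divr_ge0// ?mulr_ge0// ltW.
    by apply: sumr_ge0 => i _; exact: sqr_ge0.
  have [/forallP yx|] := boolP [forall i, `|y i 0 - x i 0| <= dlt].
    by rewrite (le_trans (fd _ yx))// lerDl.
  rewrite negb_forall => /existsP[i]; rewrite -ltNge => yx.
  apply: (@le_trans _ _ (2 * C)).
    rewrite (le_trans (ler_normB _ _))// mulr_natl mulr2n lerD//.
  apply: (@le_trans _ _ ((2 * C / dlt ^+ 2) * \sum_i (y i 0 - x i 0) ^+ 2)); last first.
    by rewrite lerDr.
  rewrite mulrAC ler_pdivlMr// ler_wpM2l ?mulr_ge0//.
  apply: (@le_trans _ _ ((y i 0 - x i 0) ^+ 2)).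
    by rewrite -[leRHS]real_normK ?num_real// lerXn2r ?nnegrE ?normr_ge0 ?ltW//.
  rewrite (bigD1 i)//=.
  by rewrite lerDl sumr_ge0// => l _; exact: sqr_ge0.
have -> : trig_approx f x - f x = \sum_j (f (grid j) - f x) * grid_kernel j x.
  rewrite -[in LHS](mulr1 (f x)) -(sum_grid_kernel x) mulr_sumr -sumrB.
  by apply: eq_bigr => j _; rewrite mulrBl.
rewrite (le_trans (ler_norm_sum _ _ _))//.
apply: (@le_trans _ _ (\sum_j (e + (2 * C / dlt ^+ 2) *
    \sum_i (grid j i 0 - x i 0) ^+ 2) * grid_kernel j x)).
  apply: ler_sum => j _; rewrite normrM (ger0_norm (grid_kernel_ge0 _ _)).
  by rewrite ler_wpM2r// grid_kernel_ge0.
under eq_bigr do rewrite mulrDl -mulrA.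
rewrite big_split/= -!mulr_sumr sum_grid_kernel mulr1 lerD2l -[leRHS]mulrA.
rewrite ler_wpM2l//; first by rewrite divr_ge0// ?mulr_ge0// ltW.
under eq_bigr do rewrite mulr_suml.
rewrite exchange_big/= -mulrA mulr_natl.
set Q := _ / _; have -> : Q *+ q = \sum_(i < q) Q by rewrite sumr_const card_ord.
apply: ler_sum => i _.
under eq_bigr do rewrite mulrC.
exact: grid_kernel_variance.
Qed.

End trigonometric_approximation.

(** * Boundedness and negligibility in probability *)

Section bounded_in_probability.
Context d (T : measurableType d) (R : realType) (P : probability T R).

(* Boundedness in probability, phrased with exceptional events so that no
   measurability of [u] is involved. *)
Definition OP (u : nat -> T -> R) := forall e : R, 0 < e -> exists K : R,
  \forall m \near \oo, exists A, [/\ measurable A, (P A <= e%:E)%E &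
    forall w, ~ A w -> `|u m w| <= K].

Definition oP (u : nat -> T -> R) := forall e h : R, 0 < e -> 0 < h ->
  \forall m \near \oo, exists A, [/\ measurable A, (P A <= e%:E)%E &
    forall w, ~ A w -> `|u m w| <= h].

Lemma le_measureU2 (A B : set T) (a b : R) : measurable A -> measurable B ->
  (P A <= a%:E)%E -> (P B <= b%:E)%E -> (P (A `|` B) <= (a + b)%:E)%E.
Proof.
move=> mA mB Aa Bb; apply: (le_trans (measureU2 _ mA mB)).
by rewrite EFinD leeD.
Qed.

Lemma OP_all (I : finType) (u : I -> nat -> T -> R) : (forall i, OP (u i)) ->
  forall e : R, 0 < e -> exists2 K : R, 0 < K &
  \forall m \near \oo, exists A, [/\ measurable A, (P A <= e%:E)%E &
    forall w, ~ A w -> forall i, `|u i m w| <= K].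
Proof.
move=> uOP.
suff H (s : seq I) e : 0 < e -> exists2 K : R, 0 < K &
    \forall m \near \oo, exists A, [/\ measurable A, (P A <= e%:E)%E &
    forall w, ~ A w -> {in s, forall i, `|u i m w| <= K}].
  move=> e e0; have [K K0 HK] := H (enum I) e e0; exists K => //.
  apply: filterS HK => m [A [mA PA uA]]; exists A; split => // w Aw i.
  by apply: uA => //; rewrite mem_enum.
elim: s e => [|i s ih] e e0.
  exists 1 => //; apply: nearW => m; exists set0; split => //.
  by rewrite measure0 lee_fin ltW.
have e20 : 0 < e / 2 by rewrite divr_gt0.
have [K1 K10 H1] := ih _ e20; have [K2 H2] := uOP i _ e20.
exists (K1 + `|K2|); first by rewrite ltr_wpDr.
apply: filterS2 H1 H2 => m [A [mA PA uA]] [B [mB PB uB]].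
exists (A `|` B); split; first exact: measurableU.
  by rewrite [e]splitr; exact: le_measureU2.
move=> w /not_orP[Aw Bw] j; rewrite inE => /orP[/eqP ->|js].
  by rewrite (le_trans (uB _ Bw))// (le_trans (ler_norm _))// lerDr ltW.
by rewrite (le_trans (uA _ Aw _ js))// lerDl.
Qed.

(** A single law is tight, since the events [n < |g|] decrease to the empty set. Applied to the
    coordinates under the limit law. *)
Lemma OP_cst (g : T -> R) : measurable_fun setT g -> OP (fun=> g).
Proof.
move=> mg e e0.
have mF (n : nat) : measurable [set w | n%:R < `|g w|].
  rewrite -[X in measurable X]setTI.
  have mgn : measurable_fun setT (fun w => `|g w|) by exact: measurableT_comp.
  have := mgn measurableT `]n%:R, +oo[%classic (measurable_itv _).
  by congr (measurable (_ `&` _)); apply/seteqP; split => w /=; rewrite in_itv/= andbT.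
have : P [set w | n%:R < `|g w|] @[n --> \oo] --> P (\bigcap_n [set w | n%:R < `|g w|]).
  apply: nonincreasing_cvg_mu => //.
  - by rewrite (le_lt_trans (probability_le1 P (mF 0%N)))// ltry.
  - exact: bigcap_measurable.
  - move=> n m nm; apply/subsetPset => w /=; apply: le_lt_trans.
    by rewrite ler_nat.
rewrite (_ : \bigcap_n _ = set0); last first.
  rewrite -subset0 => w /(_ (Num.truncn `|g w|).+1 I) /=.
  by rewrite ltNge => /negP; apply; rewrite ltW// truncnS_gt.
rewrite measure0 => /fine_cvgP[_ /cvgrPdist_le/(_ e e0)].
move=> /filter_ex[n /=]; rewrite sub0r normrN ger0_norm; last exact: fine_ge0.
move=> ne; exists n%:R; apply: nearW => _; exists [set w | n%:R < `|g w|].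
split => // [|w /negP]; last by rewrite -leNgt.
by rewrite -lee_fin fineK// in ne; exact: fin_num_measure.
Qed.

End bounded_in_probability.

(** * From cosines to bounded continuous test functions *)

Section weak_convergence_criterion.
Context d (T : measurableType d) (R : realType) (P : probability T R) (q : nat).
Variables (Y : nat -> T -> 'cV[R]_q) (nu : probability (borelV R q) R).
Hypothesis mY : forall m j, measurable_fun setT (fun w => Y m w j 0).
Hypothesis tightY : forall j, OP P (fun m w => Y m w j 0).
Hypothesis cvg_cos : forall (t : 'cV[R]_q) c,
  Ex P (fun w => cos ((t^T *m Y m w) 0 0 + c)) @[m --> \oo] -->
  Ex nu (fun x : borelV R q => cos ((t^T *m (x : 'cV[R]_q)) 0 0 + c)).

Lemma bmeas_compY m (f : 'cV[R]_q -> R) : bmeas (f : borelV R q -> R) ->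
  bmeas (fun w => f (Y m w)).
Proof.
move=> [mf [C fC]]; split; last by exists C.
have := @measurableT_comp _ _ _ T (borelV R q) R f setT (Y m) mf.
by apply; apply: measurable_fun_cV => j; exact: mY.
Qed.

Lemma cvg_trigpoly f : trigpoly f ->
  Ex P (fun w => f (Y m w)) @[m --> \oo] --> Ex nu (f : borelV R q -> R).
Proof.
elim=> [t c|f1 f2 tf1 ih1 tf2 ih2|a f1 tf1 ih1]; first exact: cvg_cos.
- under eq_fun do rewrite ExD ?(bmeas_Lint _ (bmeas_compY _ (trigpoly_bmeas _)))//.
  rewrite (ExD (bmeas_Lint nu (trigpoly_bmeas tf1)) (bmeas_Lint nu (trigpoly_bmeas tf2))).
  exact: cvgD.
- under eq_fun do rewrite ExZ ?(bmeas_Lint _ (bmeas_compY _ (trigpoly_bmeas _)))//.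
  rewrite (ExZ _ (bmeas_Lint nu (trigpoly_bmeas tf1))).
  by apply: cvgM => //; exact: cvg_cst.
Qed.

Lemma Ex_dist_le d' (T' : measurableType d') (Q : probability T' R)
    (f g : T' -> R) (C e : R) (A : set T') : bmeas f -> bmeas g ->
  (forall x, `|f x| <= C) -> (forall x, `|g x| <= C) -> 0 <= e ->
  measurable A -> (Q A <= e%:E)%E -> (forall x, ~ A x -> `|f x - g x| <= e) ->
  `|Ex Q f - Ex Q g| <= e + 2 * C * e.
Proof.
move=> bf bg fC gC e0 mA QA fg.
have C0 : 0 <= C by apply: le_trans (fC point); exact: normr_ge0.
rewrite -ExB; [|exact: bmeas_Lint|exact: bmeas_Lint].
have bfg := bmeasB bf bg.
have bn : bmeas (fun x => `|f x - g x|).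
  case: bfg => mfg [D fgD]; split; first exact: measurableT_comp.
  by exists D => x; rewrite normr_id.
rewrite (le_trans (le_norm_Ex (bmeas_Lint _ bfg)))//.
have bA := bmeasZ (2 * C) (bmeas_indic R mA).
have bA' := bmeasD (bmeas_cst T' e) bA.
apply: le_trans (le_Ex (bmeas_Lint _ bn) (bmeas_Lint _ bA') _) _.
  move=> x; rewrite indicE; have [xA|] := boolP (x \in A).
    rewrite mulr1 (le_trans (ler_normB _ _))// -[leLHS]add0r lerD//.
    by rewrite mulr_natl mulr2n lerD.
  by rewrite notin_setE mulr0 addr0 => /fg.
rewrite (ExD (bmeas_Lint Q (bmeas_cst T' e)) (bmeas_Lint Q bA)).
rewrite Ex_cst lerD2l (ExZ _ (bmeas_Lint Q (bmeas_indic R mA))).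
rewrite ler_wpM2l ?mulr_ge0// Ex_indic// -lee_fin fineK//.
exact: fin_num_measure.
Qed.

Lemma cvg_in_distribution_of_cos : cvg_in_distribution P Y nu.
Proof.
move=> f cf [C fC].
have bf : bmeas (f : borelV R q -> R).
  by split; [exact: continuous_measurable_cV|exists C].
have C0 : 0 <= C by apply: le_trans (fC 0); exact: normr_ge0.
rewrite (expectationE (bmeas_Lint nu bf)).
rewrite (_ : (fun n => _) = (fun m => (Ex P (fun w => f (Y m w)))%:E)); last first.
  by apply/funext => m; rewrite expectationE//; exact/bmeas_Lint/bmeas_compY.
apply: cvg_EFin; first by apply: nearW.
apply/cvgrPdist_le => /= eps eps0.
(* One [e] for the convergence on the approximating polynomial, and [e + 2 * C * e] for each of the
   two replacements of [f] by it, under [nu] and under the law of [Y m]. *)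
pose e := eps / (1 + (1 + 2 * C) + (1 + 2 * C)).
have D0 : 0 < 1 + (1 + 2 * C) + (1 + 2 * C) by lra.
have e0 : 0 < e by rewrite divr_gt0.
have [K1 K10 tY] := OP_all tightY e0.
have mcoord (j : 'I_q) := OP_cst nu (@measurable_coord R q j).
have [K2 K20 /filter_ex[_ [A2 [mA2 nuA2 uA2]]]] := OP_all mcoord e0.
(* The cube of half-side [L] carries all but [e] of the mass of [nu] and, for large [m], of [Y m];
   with [lam = 2 * L] it is the region [|x i 0| <= lam / 2] of the error bound. *)
pose L := K1 + K2; have L0 : 0 < L by rewrite addr_gt0.
pose lam := 2 * L; have lam0 : 0 < lam by rewrite mulr_gt0.
have e20 : 0 < e / 2 by rewrite divr_gt0.
have [dlt dlt0 fdlt] := uniform_continuity_cube L cf e20.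
have [k kP] : exists k, (2 * C / dlt ^+ 2) * (q%:R * (lam ^+ 2 * 196)) / 2 ^+ k <= e / 2.
  (* Any [k] with [D / (e / 2) <= 2 ^ k] will do, and [k < 2 ^ k]. *)
  set D := _ * (_ * _); exists (Num.truncn (D / (e / 2))).
  rewrite ler_pdivrMr ?exprn_gt0// -ler_pdivrMl// mulrC.
  rewrite (le_trans (ltW (truncnS_gt _)))// -natrX ler_nat.
  by rewrite -[X in (_ <= X)%N]/(expn _ _) ltn_expl.
pose g := trig_approx lam k f.
have tg : trigpoly g by exact: trigpoly_trig_approx.
have gC (x : 'cV[R]_q) : `|g x| <= C by exact: trig_approx_bound.
have fg (x : 'cV[R]_q) : (forall i, `|x i 0| <= L) -> `|f x - g x| <= e.
  move=> xL; rewrite distrC.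
  have xlam i : `|x i 0| <= lam / 2.
    by rewrite /lam mulrAC divff ?mul1r// pnatr_eq0.
  apply: le_trans (trig_approx_error k lam0 dlt0 C0 fC (fdlt _ xL) xlam (ltW e20)) _.
  by rewrite [leRHS]splitr lerD2l.
have /cvgrPdist_le/(_ e e0) cg := cvg_trigpoly tg.
apply: filterS2 cg tY => m cgm [A [mA PA uA]].
have d1 : `|Ex nu (f : borelV R q -> R) - Ex nu (g : borelV R q -> R)| <= e + 2 * C * e.
  apply: (Ex_dist_le (A := A2)) => //; [exact: trigpoly_bmeas|exact: ltW|].
  move=> x /uA2 xA; apply: fg => i; rewrite (le_trans (xA i))// lerDr ltW//.
have d2 : `|Ex P (fun w => g (Y m w)) - Ex P (fun w => f (Y m w))| <= e + 2 * C * e.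
  rewrite distrC; apply: (Ex_dist_le (A := A)) => //.
  - exact: bmeas_compY.
  - exact/bmeas_compY/trigpoly_bmeas.
  - exact: ltW.
  - move=> w /uA wA; apply: fg => i; rewrite (le_trans (wA i))// lerDl ltW//.
set a := Ex nu (f : borelV R q -> R) in d1 *.
set b := Ex nu (g : borelV R q -> R) in d1 cgm *.
set a' := Ex P _ in d2 cgm; set b' := Ex P _ in d2 *.
have -> : eps = e * (1 + (1 + 2 * C) + (1 + 2 * C)).
  by rewrite /e divfK// gt_eqF.
rewrite (_ : a - b' = (a - b) + (b - a') + (a' - b')); last by ring.
rewrite (le_trans (ler_normD _ _))// (le_trans (lerD (ler_normD _ _) (lexx _)))//.
by lra.
Qed.

End weak_convergence_criterion.

(** * The central limit theorem for independent arrays *)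

Section dominated_expectation.
Context d (T : measurableType d) (R : realType) (P : probability T R).

Lemma Ex_cvg0 (u : nat -> T -> R) (g : T -> R) :
  (forall n, measurable_fun setT (u n)) -> Lint P g ->
  (forall n x, `|u n x| <= g x) -> (forall x, u n x @[n --> \oo] --> 0) ->
  Ex P (u n) @[n --> \oo] --> 0.
Proof.
move=> mu ig ug u0.
have H : (\int[P]_x (u n x)%:E @[n --> \oo] --> \int[P]_x (cst 0%E x))%E.
  apply: (@dominated_cvg _ _ _ P setT measurableT _ _ (EFin \o g)).
  - by move=> n; exact/measurable_EFinP.
  - by move=> x _; apply: cvg_EFin; [exact: nearW|exact: u0].
  - by [].
  - exact: ig.
  - by move=> n x _; rewrite lee_fin ug.
by move: H; rewrite integral_cst// mul0e => /fine_cvg.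
Qed.

End dominated_expectation.

(** * Independence, from events to expectations *)

Section uniform_approximation.
Context {R : realType} {U : Type}.
Implicit Types f : U -> R.

(** For [0 <= f < 1] the sum counts the levels [k.+1 <= n * f y], so this is [n * f y] rounded down,
    divided by [n]. Written with indicators, it lets a factorisation known for indicators extend by
    linearity. *)
Definition step_approx f n (y : U) : R :=
  \sum_(k < n) n%:R^-1 * \1_[set y | k.+1%:R <= n%:R * f y] y.

Lemma step_approx_dist f n y : (0 < n)%N -> 0 <= f y < 1 ->
  `|f y - step_approx f n y| <= n%:R^-1.
Proof.
move=> n0 /andP[f0 f1]; have n0' : 0 < n%:R :> R by rewrite ltr0n.
set m := Num.truncn (n%:R * f y).
have nf0 : 0 <= n%:R * f y by rewrite mulr_ge0// ltW.
have mn : (m <= n)%N.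
  by rewrite ltnW// truncn_lt_nat// gtr_pMr.
have -> : step_approx f n y = n%:R^-1 * m%:R.
  rewrite /step_approx -mulr_sumr; congr (_ * _).
  rewrite -[in RHS](card_ord m) -sum1_card natr_sum.
  rewrite (big_ord_widen _ (fun=> 1) mn) [RHS]big_mkcond/=.
  apply: eq_bigr => k _; rewrite indicE; case: ifPn => km.
    by rewrite mem_set//= -truncn_ge_nat.
  by rewrite memNset//= -truncn_ge_nat//; exact/negP.
have /andP[h1 h2] : m%:R <= n%:R * f y < m.+1%:R.
  by have := truncn_itv nf0.
rewrite -(ler_pM2l n0') mulfV ?gt_eqF// -[X in X * `|_|](gtr0_norm n0') -normrM.
rewrite mulrBr mulrA mulfV ?gt_eqF// mul1r ger0_norm ?subr_ge0//.
by rewrite lerBlDr addrC -[X in _ + X]/(1%:R) -natrD addn1 ltW.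
Qed.

End uniform_approximation.

Section independence.
Context d (T : measurableType d) (R : realType) (P : probability T R).

Lemma bmeas_comp d' (T' : measurableType d') (X : T -> T') (f : T' -> R) :
  measurable_fun setT X -> bmeas f -> bmeas (fun w => f (X w)).
Proof.
by move=> mX [mf [C fC]]; split; [exact: measurableT_comp mf mX|exists C].
Qed.

Lemma bmeas_step_approx d' (T' : measurableType d') (f : T' -> R) n :
  measurable_fun setT f -> bmeas (step_approx f n).
Proof.
move=> mf; split.
  apply: measurable_sum => k; apply: measurable_funM => //.
  apply: measurable_indic.
  have := measurable_funM (measurable_cst (n%:R : R)) mf.
  move=> /(_ measurableT `[k.+1%:R, +oo[%classic (measurable_itv _)).
  rewrite setTI; congr measurable.
  by apply/seteqP; split => y /=; rewrite in_itv/= andbT.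
exists (\sum_(k < n) n%:R^-1) => x; rewrite (le_trans (ler_norm_sum _ _ _))//.
apply: ler_sum => k _; rewrite indicE.
by case: (_ \in _); rewrite ?mulr1 ?mulr0 ?normr0 ?ger0_norm ?invr_ge0 ?ler0n.
Qed.

Lemma Ex_norm_le (f : T -> R) C : bmeas f -> (forall x, `|f x| <= C) ->
  `|Ex P f| <= C.
Proof.
move=> bf fC; rewrite (le_trans (le_norm_Ex (bmeas_Lint P bf)))//.
rewrite -[leRHS](Ex_cst P); apply: le_Ex => //; last exact/bmeas_Lint/bmeas_cst.
apply: bmeas_Lint; split; first by case: bf => mf _; exact: measurableT_comp.
by exists C => x; rewrite normr_id.
Qed.

(** Both sides are linear in [f] and stable under uniform limits. After an affine change of [f] to
    values in [[0, 1)], step functions approximate it uniformly. *)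
Lemma Ex_indep_of_indic d' (T' : measurableType d') (X : T -> T') (W : T -> R) :
  measurable_fun setT X -> bmeas W ->
  (forall B, measurable B -> Ex P (fun w => \1_B (X w) * W w) =
    Ex P (fun w => \1_B (X w)) * Ex P W) ->
  forall f : T' -> R, bmeas f ->
    Ex P (fun w => f (X w) * W w) = Ex P (fun w => f (X w)) * Ex P W.
Proof.
move=> mX bW HB f bf.
have [mW [D WD]] := bW.
suff H (g : T' -> R) : measurable_fun setT g -> (forall y, 0 <= g y < 1) ->
    Ex P (fun w => g (X w) * W w) = Ex P (fun w => g (X w)) * Ex P W.
  have [mf [C fC]] := bf.
  have C0 : 0 <= C by apply: le_trans (fC point); exact: normr_ge0.
  (* The summand 1 makes [(f y + C) / (2 * C + 1)] strictly less than 1, also when [C = 0]. *)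
  have C1 : 0 < 2 * C + 1 by lra.
  pose g y := (2 * C + 1)^-1 * (f y + C).
  have mg : measurable_fun setT g.
    by apply: measurable_funM => //; exact: measurable_funD.
  have g01 y : 0 <= g y < 1.
    have := fC y; rewrite ler_norml => /andP[h1 h2].
    rewrite mulr_ge0 ?invr_ge0 ?(ltW C1)//=; last by lra.
    by rewrite /g mulrC ltr_pdivrMr// mul1r; lra.
  have bg : bmeas (fun w => g (X w)).
    apply: bmeas_comp => //; split => //; exists 1 => y.
    by have /andP[? ?] := g01 y; rewrite ger0_norm// ltW.
  have fE y : f y = (2 * C + 1) * g y - C.
    by rewrite /g mulrA mulfV ?gt_eqF// mul1r addrK.
  have gW := bmeasM bg bW.
  under eq_fun do rewrite fE mulrBl -mulrA.
  rewrite (ExB (bmeas_Lint P (bmeasZ _ gW)) (bmeas_Lint P (bmeasZ C bW))).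
  rewrite (ExZ _ (bmeas_Lint P gW)) (ExZ _ (bmeas_Lint P bW)) H//.
  under [in RHS]eq_fun do rewrite fE.
  rewrite (ExB (bmeas_Lint P (bmeasZ _ bg)) (bmeas_Lint P (bmeas_cst T C))).
  by rewrite (ExZ _ (bmeas_Lint P bg)) Ex_cst; ring.
move=> mg g01.
have bg : bmeas (fun w => g (X w)).
  apply: bmeas_comp => //; split => //; exists 1 => y.
  by have /andP[? ?] := g01 y; rewrite ger0_norm// ltW.
have D0 : 0 <= D.
  by have := Ex_norm_le bW WD; exact/le_trans/normr_ge0.
apply/eqP; rewrite -subr_eq0 -normr_le0; apply/ler_addgt0Pr => e e0; rewrite add0r.
have [n0 nP] : exists n, (0 < n)%N /\ 2 * D * n%:R^-1 <= e.
  exists (Num.truncn (2 * D / e)).+1; split => //.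
  have := truncnS_gt (2 * D / e); rewrite ltr_pdivrMr// => /ltW h.
  by rewrite ler_pdivrMr ?ltr0n// [leRHS]mulrC.
case: nP => n0' nP; pose g' := step_approx g n0.
have bg' : bmeas (fun w => g' (X w)).
  by apply: bmeas_comp => //; exact: bmeas_step_approx.
have g'E : Ex P (fun w => g' (X w) * W w) = Ex P (fun w => g' (X w)) * Ex P W.
  pose B k := [set y | k.+1%:R <= n0%:R * g y].
  have mB k : measurable (B k).
    have := measurable_funM (measurable_cst (n0%:R : R)) mg.
    move=> /(_ measurableT `[k.+1%:R, +oo[%classic (measurable_itv _)).
    rewrite setTI; congr measurable.
    by apply/seteqP; split => y /=; rewrite in_itv/= andbT.
  have b1 k : bmeas (fun w => \1_(B k) (X w) : R).
    by apply: bmeas_comp => //; exact: bmeas_indic.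
  rewrite /g' /step_approx.
  under eq_fun do rewrite mulr_suml.
  rewrite Ex_sum; last first.
    by move=> k; apply: bmeas_Lint; apply: bmeasM => //; exact: bmeasZ (b1 k).
  rewrite Ex_sum; last by move=> k; apply: bmeas_Lint; exact: bmeasZ (b1 k).
  rewrite mulr_suml; apply: eq_bigr => k _.
  under eq_fun do rewrite -mulrA.
  rewrite (ExZ _ (bmeas_Lint P (bmeasM (b1 k) bW))).
  by rewrite (ExZ _ (bmeas_Lint P (b1 k))) HB// mulrA.
have -> : Ex P (fun w => g (X w) * W w) - Ex P (fun w => g (X w)) * Ex P W =
  Ex P (fun w => (g (X w) - g' (X w)) * W w) -
  Ex P (fun w => g (X w) - g' (X w)) * Ex P W.
  have -> : (fun w => (g (X w) - g' (X w)) * W w) =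
      (fun w => g (X w) * W w - g' (X w) * W w).
    by apply/funext => w; rewrite mulrBl.
  rewrite (ExB (bmeas_Lint P (bmeasM bg bW)) (bmeas_Lint P (bmeasM bg' bW))).
  by rewrite (ExB (bmeas_Lint P bg) (bmeas_Lint P bg')) g'E; ring.
have bd := bmeasB bg bg'.
have gg' y : `|g y - g' y| <= n0%:R^-1 by exact: step_approx_dist.
have h1 : `|Ex P (fun w => (g (X w) - g' (X w)) * W w)| <= n0%:R^-1 * D.
  by apply: Ex_norm_le => [|w]; [exact: bmeasM|rewrite normrM ler_pM].
have h2 : `|Ex P (fun w => g (X w) - g' (X w)) * Ex P W| <= n0%:R^-1 * D.
  by rewrite normrM ler_pM//; apply: Ex_norm_le.
rewrite (le_trans (ler_normB _ _))// (le_trans (lerD h1 h2))//.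
by move: nP; lra.
Qed.

End independence.

Section independent_family.
Context d (T : measurableType d) (R : realType) (P : probability T R).
Context (I : eqType) (q : nat) (Y : I -> {RV P >-> borelV R q}).
Hypothesis indepY : mutually_independent Y.

Let mY i : measurable_fun setT (Y i).
Proof. exact: measurable_funPT. Qed.

Definition ind_prod (p : seq I) (B : I -> set (borelV R q)) (w : T) : R :=
  \prod_(i <- p) \1_(B i) (Y i w).

Lemma ind_prodE p B : ind_prod p B = \1_(\bigcap_(i in [set` p]) (Y i @^-1` B i)).
Proof.
apply/funext => w; rewrite /ind_prod indicE.
elim: p => [|i p ih].
  by rewrite big_nil mem_set// => j /=.
rewrite big_cons {}ih indicE.
have [Bi|Bi] := boolP (Y i w \in B i); last first.
  rewrite mul0r memNset// => /(_ i) /=; rewrite mem_head => /(_ isT).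
  by move: Bi; rewrite notin_setE.
rewrite mul1r; have [Bp|Bp] := boolP (w \in _).
  rewrite mem_set// => j /=; rewrite inE => /orP[/eqP ->|jp]; first by rewrite inE in Bi.
  by move: Bp; rewrite inE => /(_ j); exact.
rewrite memNset// => H; move: Bp; rewrite notin_setE; apply => j /= jp.
by apply: H => /=; rewrite inE jp orbT.
Qed.

Lemma measurable_ind_prod (p : seq I) B : (forall i, measurable (B i)) ->
  measurable (\bigcap_(i in [set` p]) (Y i @^-1` B i)).
Proof.
move=> mB; apply: fin_bigcap_measurable => // i _.
by rewrite -[X in measurable X]setTI; exact: mY.
Qed.

Lemma bmeas_ind_prod p B : (forall i, measurable (B i)) -> bmeas (ind_prod p B).
Proof. by move=> mB; rewrite ind_prodE; exact/bmeas_indic/measurable_ind_prod. Qed.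

Lemma Ex_ind_prod p B : uniq p -> (forall i, measurable (B i)) ->
  Ex P (ind_prod p B) = \prod_(i <- p) fine (P (Y i @^-1` B i)).
Proof.
move=> up mB; rewrite ind_prodE Ex_indic; last exact: measurable_ind_prod.
rewrite indepY//; elim: p {up} => [|i p ih]; first by rewrite !big_nil.
rewrite !big_cons fineM ?ih//.
  by apply: fin_num_measure; rewrite -[X in measurable X]setTI; exact: mY.
elim: p {ih} => [|j p ih]; first by rewrite big_nil.
rewrite big_cons fin_numM//.
by apply: fin_num_measure; rewrite -[X in measurable X]setTI; exact: mY.
Qed.

Lemma ind_prod_cons i p B C : i \notin p ->
  (fun w => \1_C (Y i w) * ind_prod p B w) =
  ind_prod (i :: p) (fun j => if j == i then C else B j).
Proof.
move=> ip; apply/funext => w; rewrite /ind_prod big_cons eqxx; congr (_ * _).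
apply: eq_big_seq => j jp; case: eqP => // ji.
by move: ip; rewrite -ji jp.
Qed.

Lemma Ex_ind_prod_cons i p B C : i \notin p -> uniq p ->
  (forall j, measurable (B j)) -> measurable C ->
  Ex P (fun w => \1_C (Y i w) * ind_prod p B w) =
  Ex P (fun w => \1_C (Y i w)) * Ex P (ind_prod p B).
Proof.
move=> ip up mB mC.
have mBC : forall j, measurable (if j == i then C else B j).
  by move=> j; case: ifP.
rewrite ind_prod_cons// Ex_ind_prod//; last by rewrite /= ip.
rewrite big_cons eqxx Ex_ind_prod//; congr (_ * _).
  rewrite -Ex_indic//; last by rewrite -[X in measurable X]setTI; exact: mY.
apply: eq_big_seq => j jp; case: eqP => // ji.
by move: ip; rewrite -ji jp.
Qed.

Lemma Ex_indep2 i j (f g : borelV R q -> R) : i != j -> bmeas f -> bmeas g ->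
  Ex P (fun w => f (Y i w) * g (Y j w)) =
  Ex P (fun w => f (Y i w)) * Ex P (fun w => g (Y j w)).
Proof.
move=> ij bf bg.
have bgj : bmeas (fun w => g (Y j w)) by exact: bmeas_comp.
apply: (Ex_indep_of_indic (mY i) bgj) => // B mB.
under eq_fun do rewrite mulrC.
have bB : bmeas (fun w => \1_B (Y i w) : R).
  by apply: bmeas_comp => //; exact: bmeas_indic.
rewrite (Ex_indep_of_indic (mY j) bB)// 1?mulrC// => C mC.
have E D k : (fun w => \1_D (Y k w) : R) = ind_prod [:: k] (fun=> D).
  by apply/funext => w; rewrite /ind_prod big_seq1.
have -> : (fun w => \1_C (Y j w) * \1_B (Y i w)) =
    (fun w => \1_C (Y j w) * ind_prod [:: i] (fun=> B) w) :> (T -> R).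
  by rewrite -(E B i).
by rewrite Ex_ind_prod_cons ?inE 1?eq_sym// -(E B i).
Qed.

Variable xi : I -> borelV R q -> R.
Hypothesis mxi : forall i, measurable_fun setT (xi i).

Definition xsum (s : seq I) (w : T) : R := \sum_(i <- s) xi i (Y i w).

Lemma measurable_xi i : measurable_fun setT (fun w => xi i (Y i w)).
Proof. by apply: (measurableT_comp (mxi i)); exact: mY. Qed.

Lemma measurable_xsum s : measurable_fun setT (xsum s).
Proof. by apply: measurable_sum => i; exact: measurable_xi. Qed.

Lemma bmeas_cos_xsum c s : bmeas (fun w => cos (c + xsum s w)).
Proof. by apply: bmeas_cos; apply: measurable_funD => //; exact: measurable_xsum. Qed.

Lemma cos_xsum_cons i s c w : cos (c + xsum (i :: s) w) =
  cos (xi i (Y i w)) * cos (c + xsum s w) -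
  sin (xi i (Y i w)) * cos (c - pi / 2 + xsum s w).
Proof.
have -> : c + xsum (i :: s) w = xi i (Y i w) + (c + xsum s w).
  by rewrite /xsum big_cons addrCA.
have -> : c - pi / 2 + xsum s w = c + xsum s w - pi / 2 by rewrite addrAC.
by rewrite cosBpihalf cosD.
Qed.

(** Induction on [s]. The addition formula splits off the head of [s], and the sine of the remaining
    sum is a cosine with phase [c - pi / 2]: hence the quantification over [c]. The head is moved
    into [p] as an indicator: hence the quantification over [p] and [B]. *)
Lemma Ex_ind_prod_cos s p B c : uniq (p ++ s) -> (forall i, measurable (B i)) ->
  Ex P (fun w => ind_prod p B w * cos (c + xsum s w)) =
  Ex P (ind_prod p B) * Ex P (fun w => cos (c + xsum s w)).
Proof.
elim: s p B c => [|i s ih] p B c ups mB.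
  have -> : (fun w => cos (c + xsum [::] w)) = cst (cos c).
    by apply/funext => w; rewrite /xsum big_nil addr0.
  under eq_fun do rewrite /xsum big_nil addr0 mulrC.
  by rewrite (ExZ _ (bmeas_Lint P (bmeas_ind_prod p mB))) Ex_cst mulrC.
have up : uniq p by move: ups; rewrite cat_uniq => /and3P[].
have ip : i \notin p.
  by move: ups; rewrite uniq_catC /= mem_cat negb_or => /andP[/andP[]].
have uips : uniq ((i :: p) ++ s) by rewrite -cat1s -catA uniq_catCA.
have ups' : uniq (p ++ s) by move: uips => /= /andP[].
have bp := bmeas_ind_prod p mB.
(* Used with [f] equal to [cos] and [sin]. It suffices to treat an indicator of [Y i], which joins
   the product over [p]. *)
have key (f : R -> R) c' : (forall g : borelV R q -> R, measurable_fun setT g ->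
      bmeas (fun y => f (g y))) ->
    Ex P (fun w => f (xi i (Y i w)) * (ind_prod p B w * cos (c' + xsum s w))) =
    Ex P (fun w => f (xi i (Y i w))) *
      (Ex P (ind_prod p B) * Ex P (fun w => cos (c' + xsum s w))).
  move=> bf.
  have bW := bmeasM bp (bmeas_cos_xsum c' s).
  rewrite (Ex_indep_of_indic (mY i) bW _ (bf _ (mxi i))) ?ih// => C mC.
  under eq_fun do rewrite mulrA.
  have -> : (fun w => \1_C (Y i w) * ind_prod p B w * cos (c' + xsum s w)) =
      (fun w => ind_prod (i :: p) (fun j => if j == i then C else B j) w *
                cos (c' + xsum s w)).
    by rewrite -ind_prod_cons.
  have mBC : forall j, measurable (if j == i then C else B j).
    by move=> j; case: ifP.
  by rewrite ih// -ind_prod_cons// Ex_ind_prod_cons// mulrA.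
(* The same without the product over [p]; here [ih] is applied to the singleton [[:: i]]. *)
have key0 (f : R -> R) c' : (forall g : borelV R q -> R, measurable_fun setT g ->
      bmeas (fun y => f (g y))) ->
    Ex P (fun w => f (xi i (Y i w)) * cos (c' + xsum s w)) =
    Ex P (fun w => f (xi i (Y i w))) * Ex P (fun w => cos (c' + xsum s w)).
  move=> bf.
  have bW := bmeas_cos_xsum c' s.
  rewrite (Ex_indep_of_indic (mY i) bW _ (bf _ (mxi i)))// => C mC.
  have E : (fun w => \1_C (Y i w) : R) = ind_prod [:: i] (fun=> C).
    by apply/funext => w; rewrite /ind_prod big_seq1.
  have -> : (fun w => \1_C (Y i w) * cos (c' + xsum s w)) =
      (fun w => ind_prod [:: i] (fun=> C) w * cos (c' + xsum s w)).
    by rewrite -E.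
  rewrite ih// -?E//.
  by move: uips; rewrite -cat1s -catA uniq_catCA cat_uniq => /and3P[].
have cosE := cos_xsum_cons i s c.
have bc g : measurable_fun setT g -> bmeas (fun y : borelV R q => cos (g y) : R).
  exact: bmeas_cos.
have bs g : measurable_fun setT g -> bmeas (fun y : borelV R q => sin (g y) : R).
  exact: bmeas_sin.
have b1 c' : bmeas (fun w => cos (xi i (Y i w)) * cos (c' + xsum s w)).
  by apply: bmeasM; [apply: bmeas_cos; exact: measurable_xi|exact: bmeas_cos_xsum].
have b2 c' : bmeas (fun w => sin (xi i (Y i w)) * cos (c' + xsum s w)).
  by apply: bmeasM; [apply: bmeas_sin; exact: measurable_xi|exact: bmeas_cos_xsum].
have b3 c' : bmeas (fun w => cos (xi i (Y i w)) * (ind_prod p B w * cos (c' + xsum s w))).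
  apply: bmeasM; [apply: bmeas_cos; exact: measurable_xi|].
  by apply: bmeasM => //; exact: bmeas_cos_xsum.
have b4 c' : bmeas (fun w => sin (xi i (Y i w)) * (ind_prod p B w * cos (c' + xsum s w))).
  apply: bmeasM; [apply: bmeas_sin; exact: measurable_xi|].
  by apply: bmeasM => //; exact: bmeas_cos_xsum.
have -> : (fun w => cos (c + xsum (i :: s) w)) = (fun w =>
    cos (xi i (Y i w)) * cos (c + xsum s w) -
    sin (xi i (Y i w)) * cos (c - pi / 2 + xsum s w)) by apply/funext.
have -> : (fun w => ind_prod p B w * cos (c + xsum (i :: s) w)) = (fun w =>
    cos (xi i (Y i w)) * (ind_prod p B w * cos (c + xsum s w)) -
    sin (xi i (Y i w)) * (ind_prod p B w * cos (c - pi / 2 + xsum s w))).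
  by apply/funext => w; rewrite cosE; ring.
rewrite (ExB (bmeas_Lint P (b1 _)) (bmeas_Lint P (b2 _))).
rewrite (ExB (bmeas_Lint P (b3 _)) (bmeas_Lint P (b4 _))).
by rewrite (key (@cos R))// (key (@sin R))// (key0 (@cos R))// (key0 (@sin R))//; ring.
Qed.

Lemma Ex_cos_cons i s c : uniq (i :: s) ->
  Ex P (fun w => cos (c + xsum (i :: s) w)) =
  Ex P (fun w => cos (xi i (Y i w))) * Ex P (fun w => cos (c + xsum s w)) -
  Ex P (fun w => sin (xi i (Y i w))) * Ex P (fun w => cos (c - pi / 2 + xsum s w)).
Proof.
move=> uis.
have cosE := cos_xsum_cons i s c.
have key (f : R -> R) c' : (forall g : borelV R q -> R, measurable_fun setT g ->
      bmeas (fun y => f (g y))) ->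
    Ex P (fun w => f (xi i (Y i w)) * cos (c' + xsum s w)) =
    Ex P (fun w => f (xi i (Y i w))) * Ex P (fun w => cos (c' + xsum s w)).
  move=> bf.
  have bW := bmeas_cos_xsum c' s.
  rewrite (Ex_indep_of_indic (mY i) bW _ (bf _ (mxi i)))// => C mC.
  have E : (fun w => \1_C (Y i w) : R) = ind_prod [:: i] (fun=> C).
    by apply/funext => w; rewrite /ind_prod big_seq1.
  have -> : (fun w => \1_C (Y i w) * cos (c' + xsum s w)) =
      (fun w => ind_prod [:: i] (fun=> C) w * cos (c' + xsum s w)).
    by rewrite -E.
  by rewrite Ex_ind_prod_cos// -?E.
under eq_fun do rewrite cosE.
have b1 c' : bmeas (fun w => cos (xi i (Y i w)) * cos (c' + xsum s w)).
  by apply: bmeasM; [apply: bmeas_cos; exact: measurable_xi|exact: bmeas_cos_xsum].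
have b2 c' : bmeas (fun w => sin (xi i (Y i w)) * cos (c' + xsum s w)).
  by apply: bmeasM; [apply: bmeas_sin; exact: measurable_xi|exact: bmeas_cos_xsum].
rewrite (ExB (bmeas_Lint P (b1 _)) (bmeas_Lint P (b2 _))).
rewrite (key (@cos R)) ?(key (@sin R))// => g mg; [exact: bmeas_sin|exact: bmeas_cos].
Qed.

(* Replacing the factors [xi i] one at a time: the error made at each step is
   the distance between the characteristic function of [xi i] and [rho i]. *)
Lemma Ex_cos_dist (rho : I -> R) s c : uniq s -> (forall i, 0 <= rho i <= 1) ->
  `|Ex P (fun w => cos (c + xsum s w)) - (\prod_(i <- s) rho i) * cos c| <=
  \sum_(i <- s) (`|Ex P (fun w => cos (xi i (Y i w))) - rho i| +
                 `|Ex P (fun w => sin (xi i (Y i w)))|).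
Proof.
move=> us rho01; elim: s c us => [|i s ih] c us.
  rewrite !big_nil mul1r; under eq_fun do rewrite /xsum big_nil addr0.
  by rewrite Ex_cst subrr normr0.
have /andP[_ us'] : (i \notin s) && uniq s by [].
rewrite Ex_cos_cons// !big_cons.
set a := Ex P _; set b := Ex P _; set s' := Ex P _; set b' := Ex P _.
have b1 : `|b| <= 1.
  by apply: Ex_norm_le => [|w]; [exact: bmeas_cos_xsum|exact: cos_max].
have b1' : `|b'| <= 1.
  by apply: Ex_norm_le => [|w]; [exact: bmeas_cos_xsum|exact: cos_max].
set p := \prod_(_ <- _) _.
have -> : a * b - s' * b' - rho i * p * cos c =
  (a - rho i) * b + - (s' * b') + rho i * (b - p * cos c) by ring.
rewrite (le_trans (ler_normD _ _))//; apply: lerD.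
  rewrite (le_trans (ler_normD _ _))// normrN !normrM.
  by apply: lerD; rewrite ler_piMr.
have /andP[r0 r1] := rho01 i.
rewrite normrM (ger0_norm r0).
by apply: le_trans (ih c us'); rewrite ler_piMl.
Qed.

End independent_family.

Section vanishing_sequences.
Context {R : realType}.

Lemma cvg0_le_divn (u : nat -> R) (C : R) :
  (forall n, (0 < n)%N -> `|u n| <= C / n%:R) -> u n @[n --> \oo] --> 0.
Proof.
move=> uC; apply/cvgr0Pnorm_le => e e0.
exists (Num.truncn (C / e)).+1 => // n /= hn.
have n0 : (0 < n)%N by exact: leq_trans hn.
rewrite (le_trans (uC _ n0))// ler_pdivrMr ?ltr0n// mulrC -ler_pdivrMr//.
rewrite ltW// (lt_le_trans (truncnS_gt _))// ler_nat//.
Qed.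

Lemma cvg0_le_divsqrt (u : nat -> R) (C : R) :
  (forall n, (0 < n)%N -> `|u n| <= C / Num.sqrt n%:R) -> u n @[n --> \oo] --> 0.
Proof.
move=> uC.
suff : u n ^+ 2 @[n --> \oo] --> 0.
  move=> /cvgr0Pnorm_le h; apply/cvgr0Pnorm_le => e e0.
  apply: filterS (h (e ^+ 2) (exprn_gt0 _ e0)) => n.
  by rewrite normrX ler_pXn2r// ?nnegrE// ltW.
apply: (@cvg0_le_divn _ (C ^+ 2)) => n n0.
have s0 : 0 < Num.sqrt n%:R :> R by rewrite sqrtr_gt0 ltr0n.
rewrite normrX -[X in _ / X]sqr_sqrtr ?ler0n// -expr_div_n.
rewrite ler_pXn2r ?nnegrE// ?uC//.
exact: le_trans (uC n n0).
Qed.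

Lemma norm_cos_sub_taylor2_sqr (x : R) : `|cos x - 1 + x ^+ 2 / 2| <= x ^+ 2.
Proof.
have := norm_cos_sub1 x; have := sqr_ge0 x.
by rewrite !ler_norml => ? /andP[? ?]; apply/andP; split; lra.
Qed.

Lemma expR_taylor1 (y : R) : 0 <= y -> `|expR (- y) - 1 + y| <= y ^+ 2.
Proof.
move=> y0; rewrite ger0_norm; last by have := expR_ge1Dx (- y); lra.
have h : 1 - y + y ^+ 2 - expR (- y) >= 0.
  apply: (@ge0_of_derive_ge0 _ (fun y => 1 - y + y ^+ 2 - expR (- y))
    (fun y => 2 * y - 1 + expR (- y))) => //.
  - by move=> z; apply: is_derive_eq; rewrite /GRing.scale/=; ring.
  - by rewrite oppr0 expR0 expr0n/=; ring.
  - by move=> z z0; have := expR_ge1Dx (- z); lra.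
by lra.
Qed.

End vanishing_sequences.

(** * Square integrable variables at scale [1 / sqrt n] *)

Section square_integrable.
Context d (T : measurableType d) (R : realType) (P : probability T R).
Implicit Types xi : T -> R.

Definition L2 xi := measurable_fun setT xi /\ Lint P (fun w => xi w ^+ 2).

Lemma L2_Lint xi : L2 xi -> Lint P xi.
Proof.
move=> [mxi i2]; apply: (@le_Lint _ _ _ _ _ (fun w => 1 + xi w ^+ 2)) => //.
  by apply: LintD => //; exact/bmeas_Lint/bmeas_cst.
move=> w; have := sqr_ge0 (xi w); rewrite -(real_normK (num_real (xi w))).
by have := sqr_ge0 (`|xi w| - 1); nra.
Qed.

Lemma L2M xi zt : L2 xi -> L2 zt -> Lint P (fun w => xi w * zt w).
Proof.
move=> [mx ix] [mz iz].
apply: (@le_Lint _ _ _ _ _ (fun w => xi w ^+ 2 + zt w ^+ 2)).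
- exact: measurable_funM.
- exact: LintD.
move=> w; rewrite normrM -(real_normK (num_real (xi w))).
rewrite -(real_normK (num_real (zt w))).
have := sqr_ge0 (`|xi w| - `|zt w|).
by have := normr_ge0 (xi w); have := normr_ge0 (zt w); nra.
Qed.

Lemma L2D xi zt : L2 xi -> L2 zt -> L2 (fun w => xi w + zt w).
Proof.
move=> hx hz; have hxz := L2M hx hz; case: hx hz => [mx ix] [mz iz].
split; first exact: measurable_funD.
rewrite (_ : (fun w => _) = fun w => (xi w ^+ 2 + 2 * (xi w * zt w)) + zt w ^+ 2).
  by apply: LintD => //; apply: LintD => //; exact: LintZ.
by apply/funext => w; ring.
Qed.

Lemma L2Z a xi : L2 xi -> L2 (fun w => a * xi w).
Proof.
move=> [mx ix]; split; first exact: measurable_funM.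
by under eq_fun do rewrite exprMn; exact: LintZ.
Qed.

Lemma L2_bmeas xi : bmeas xi -> L2 xi.
Proof.
move=> bx; split; first by case: bx.
by under eq_fun do rewrite expr2; exact/bmeas_Lint/bmeasM.
Qed.

Lemma L2_sum (I : Type) (s : seq I) (F : I -> T -> R) :
  (forall i, L2 (F i)) -> L2 (fun x => \sum_(i <- s) F i x).
Proof.
move=> FL; elim: s => [|i s ih].
  by under eq_fun do rewrite big_nil; exact/L2_bmeas/bmeas_cst.
by under eq_fun do rewrite big_cons; exact: L2D.
Qed.

Let rsq n : R := (Num.sqrt n%:R)^-1.

Let rsqE n : (0 < n)%N -> n%:R * rsq n ^+ 2 = 1.
Proof.
by move=> n0; rewrite /rsq exprVn sqr_sqrtr// mulfV// pnatr_eq0 -lt0n.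
Qed.

(** Both transforms agree with [1 - s2 / (2 n)] up to [o(1 / n)]. For the cosine this is dominated
    convergence with envelope [xi ^+ 2], the quartic Taylor bound giving the pointwise limit; for
    the exponential it is its own Taylor bound. *)
Lemma clt_cos xi s2 : L2 xi -> Ex P (fun w => xi w ^+ 2) = s2 ->
  n%:R * (Ex P (fun w => cos ((Num.sqrt n%:R)^-1 * xi w)) -
          expR (- (s2 / 2 / n%:R))) @[n --> \oo] --> 0.
Proof.
move=> [mx ix] s2E.
have s20 : 0 <= s2 by rewrite -s2E; apply: Ex_ge0 => w; exact: sqr_ge0.
pose u n w := n%:R * (cos (rsq n * xi w) - 1 + (rsq n * xi w) ^+ 2 / 2).
have mxi2 n : measurable_fun setT (fun w => (rsq n * xi w) ^+ 2 / 2).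
  apply: measurable_funM => //; under eq_fun do rewrite expr2.
  by apply: measurable_funM; exact: measurable_funM.
have bc n : bmeas (fun w => cos (rsq n * xi w)).
  by apply: bmeas_cos; exact: measurable_funM.
have u0 : Ex P (u n) @[n --> \oo] --> 0.
  apply: (Ex_cvg0 (g := fun w => xi w ^+ 2)) => //.
  - move=> n; apply: measurable_funM => //; apply: measurable_funD => //.
    by apply: measurable_funD => //; case: (bc n).
  (* For [n = 0] the prefactor vanishes; otherwise [n * rsq n ^+ 2 = 1] turns the quadratic bound
     into the envelope. *)
  - move=> [|n] w; first by rewrite /u mul0r normr0 sqr_ge0.
    have h := rsqE (ltn0Sn n).
    rewrite /u normrM ger0_norm//.
    apply: le_trans (ler_wpM2l (ler0n _ _) (norm_cos_sub_taylor2_sqr _)) _.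
    by rewrite exprMn mulrA h mul1r.
  - move=> w; apply: (@cvg0_le_divn _ _ (xi w ^+ 4 / 24)) => n n0.
    rewrite /u normrM ger0_norm//.
    apply: (@le_trans _ _ (n%:R * ((rsq n * xi w) ^+ 4 / 24))).
      by rewrite ler_wpM2l// norm_cos_sub_taylor2.
    rewrite exprMn.
    have -> : n%:R * (rsq n ^+ 4 * xi w ^+ 4 / 24) =
      (n%:R * rsq n ^+ 2) * rsq n ^+ 2 * (xi w ^+ 4 / 24) by ring.
    rewrite rsqE// mul1r mulrC ler_wpM2l// ?divr_ge0// ?exprn_even_ge0//.
    by rewrite /rsq exprVn sqr_sqrtr.
pose v n : R := n%:R * (1 - s2 / 2 / n%:R - expR (- (s2 / 2 / n%:R))).
have v0 : v n @[n --> \oo] --> 0.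
  apply: (@cvg0_le_divn _ _ ((s2 / 2) ^+ 2)) => n n0.
  have n0' : 0 < n%:R :> R by rewrite ltr0n.
  rewrite /v normrM gtr0_norm// mulrC -ler_pdivlMr//.
  have -> : 1 - s2 / 2 / n%:R - expR (- (s2 / 2 / n%:R)) =
    - (expR (- (s2 / 2 / n%:R)) - 1 + s2 / 2 / n%:R) by ring.
  rewrite normrN (le_trans (expR_taylor1 _))//.
    by rewrite divr_ge0// divr_ge0.
  by rewrite expr_div_n expr2 invfM mulrA.
have uv : Ex P (u n) + v n @[n --> \oo] --> 0.
  by rewrite -[X in _ --> X](addr0 (0 : R)); exact: cvgD.
apply: cvg_trans uv; apply: near_eq_cvg.
exists 1%N => // n /= n0; rewrite /u /v.
have n0' : n%:R != 0 :> R by rewrite pnatr_eq0 -lt0n.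
have b1 := bmeasD (bc n) (bmeas_cst T (-1)).
have i2 : Lint P (fun w => (rsq n * xi w) ^+ 2 / 2).
  have -> : (fun w => (rsq n * xi w) ^+ 2 / 2) =
      (fun w => (rsq n ^+ 2 / 2) * xi w ^+ 2).
    by apply/funext => w; rewrite exprMn; ring.
  exact: LintZ.
have i1 := LintD (bmeas_Lint P b1) i2.
rewrite (ExZ _ i1) (ExD (bmeas_Lint P b1) i2).
rewrite (ExD (bmeas_Lint P (bc n)) (bmeas_Lint P (bmeas_cst T (-1)))) Ex_cst.
have -> : Ex P (fun w => (rsq n * xi w) ^+ 2 / 2) = s2 / 2 / n%:R.
  have -> : (fun w => (rsq n * xi w) ^+ 2 / 2) =
      (fun w => (rsq n ^+ 2 / 2) * xi w ^+ 2).
    by apply/funext => w; rewrite exprMn; ring.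
  rewrite (ExZ _ ix) s2E -[rsq n ^+ 2](mulKf n0') rsqE//; by field.
by rewrite /rsq; ring.
Qed.

(** Centring allows [rsq n * xi] to be subtracted from the sine without changing the expectation;
    the difference is then dominated by [xi ^+ 2]. *)
Lemma clt_sin xi : L2 xi -> Ex P xi = 0 ->
  n%:R * Ex P (fun w => sin ((Num.sqrt n%:R)^-1 * xi w)) @[n --> \oo] --> 0.
Proof.
move=> hx x0; have [mx ix] := hx; have i1 := L2_Lint hx.
pose u n w := n%:R * (sin (rsq n * xi w) - rsq n * xi w).
have bs n : bmeas (fun w => sin (rsq n * xi w)).
  by apply: bmeas_sin; exact: measurable_funM.
have u0 : Ex P (u n) @[n --> \oo] --> 0.
  apply: (Ex_cvg0 (g := fun w => xi w ^+ 2)) => //.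
  - move=> n; apply: measurable_funM => //; apply: measurable_funB => //.
      by case: (bs n).
    exact: measurable_funM.
  - move=> [|n] w; first by rewrite /u mul0r normr0 sqr_ge0.
    have h := rsqE (ltn0Sn n).
    rewrite /u normrM ger0_norm//.
    apply: le_trans (ler_wpM2l (ler0n _ _) (norm_sin_sub_id_sqr _)) _.
    by rewrite exprMn mulrA h mul1r.
  - move=> w; apply: (@cvg0_le_divsqrt _ _ (`|xi w| ^+ 3 / 6)) => n n0.
    rewrite /u normrM ger0_norm//.
    apply: (@le_trans _ _ (n%:R * (`|rsq n * xi w| ^+ 3 / 6))).
      by rewrite ler_wpM2l// norm_sin_sub_id.
    have rs0 : 0 <= rsq n by rewrite invr_ge0 sqrtr_ge0.
    rewrite normrM (ger0_norm rs0) exprMn.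
    have -> : n%:R * (rsq n ^+ 3 * `|xi w| ^+ 3 / 6) =
      (n%:R * rsq n ^+ 2) * rsq n * (`|xi w| ^+ 3 / 6) by ring.
    by rewrite rsqE// mul1r mulrC.
move: u0; apply: cvg_trans; apply: near_eq_cvg; apply: nearW => n.
have i2 : Lint P (fun w => rsq n * xi w) by exact: LintZ.
have i3 : Lint P (fun w => sin (rsq n * xi w) - rsq n * xi w).
  by rewrite /Lint; exact: (integrableB _ (bmeas_Lint P (bs n)) i2).
by rewrite /u (ExZ _ i3) (ExB (bmeas_Lint P (bs n)) i2) (ExZ _ i1) x0 mulr0 subr0.
Qed.

End square_integrable.

Section truncation.
Context d (T : measurableType d) (R : realType).
Implicit Types f : T -> R.

Definition truncate (n : nat) f (w : T) : R := f w * \1_[set w | `|f w| <= n%:R] w.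

Lemma bmeas_truncate n f : measurable_fun setT f -> bmeas (truncate n f).
Proof.
move=> mf; split.
  apply: measurable_funM => //; apply: measurable_indic.
  have mnf : measurable_fun setT (fun w => `|f w|) by exact: measurableT_comp.
  have := mnf measurableT `]-oo, n%:R]%classic (measurable_itv _).
  by rewrite setTI; congr measurable; apply/seteqP; split => w /=; rewrite in_itv.
exists n%:R => w; rewrite /truncate indicE; have [|_] := boolP (w \in _).
  by rewrite inE/= mulr1.
by rewrite mulr0 normr0.
Qed.

Lemma truncate_le n f w : `|truncate n f w| <= `|f w|.
Proof.
rewrite /truncate indicE; case: (w \in _); first by rewrite mulr1.
by rewrite mulr0 normr0.
Qed.

Lemma near_truncate f w : \forall n \near \oo, truncate n f w = f w.
Proof.
exists (Num.truncn `|f w|).+1 => // n /= hn; rewrite /truncate indicE mem_set ?mulr1//=.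
by rewrite ltW// (lt_le_trans (truncnS_gt _))// ler_nat.
Qed.

End truncation.

Section expectation_truncate.
Context d (T : measurableType d) (R : realType) (P : probability T R).

Lemma cvg_Ex_dominated (u : nat -> T -> R) (v g : T -> R) :
  (forall n, measurable_fun setT (u n)) -> Lint P v -> Lint P g ->
  (forall n x, `|u n x| <= g x) -> (forall x, `|v x| <= g x) ->
  (forall x, \forall n \near \oo, u n x = v x) ->
  Ex P (u n) @[n --> \oo] --> Ex P v.
Proof.
move=> mu iv ig ug vg uv.
have iu n : Lint P (u n) by exact: le_Lint ig _.
have : Ex P (fun w => u n w - v w) @[n --> \oo] --> 0.
  apply: (@Ex_cvg0 _ _ _ _ _ (fun w => 2 * g w)).
  - by move=> n; apply: measurable_funB => //; exact: Lint_measurable iv.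
  - exact: LintZ.
  - by move=> n w; rewrite (le_trans (ler_normB _ _))// mulr_natl mulr2n lerD.
  - move=> w; apply: cvg_near_cst; apply: filterS (uv w) => n ->.
    by rewrite subrr.
under eq_fun do rewrite ExB//.
by move=> /subr_cvg0.
Qed.

Lemma chebyshev_Ex (xi : T -> R) (C K : R) : L2 P xi -> 0 < K ->
  Ex P (fun w => xi w ^+ 2) <= C ->
  measurable [set w | K < `|xi w|] /\ (P [set w | (K < `|xi w|)%R] <= (C / K ^+ 2)%:E)%E.
Proof.
move=> [mx ix] K0 xC.
have mA : measurable [set w | K < `|xi w|].
  have mnx : measurable_fun setT (fun w => `|xi w|) by exact: measurableT_comp.
  have := mnx measurableT `]K, +oo[%classic (measurable_itv _).
  by rewrite setTI; congr measurable; apply/seteqP; split => w /=; rewrite in_itv/= andbT.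
split => //; set A := [set w | _] in mA *.
have K20 : 0 < K ^+ 2 by rewrite exprn_gt0.
have bA := bmeasZ (K ^+ 2) (bmeas_indic R mA).
rewrite -[leLHS]fineK ?fin_num_measure// lee_fin -Ex_indic// ler_pdivlMr// mulrC.
rewrite -(ExZ _ (bmeas_Lint P (bmeas_indic R mA))); apply: le_trans xC.
apply: le_Ex => //; first exact: bmeas_Lint.
move=> w; rewrite indicE; have [|_] := boolP (w \in A); last first.
  by rewrite mulr0 sqr_ge0.
rewrite inE mulr1 /A /= => h.
by rewrite -[leRHS](real_normK (num_real _)) lerXn2r// ?nnegrE// ltW.
Qed.

Lemma OP_of_L2 (u : nat -> T -> R) (C : R) : (forall n, L2 P (u n)) ->
  (\forall n \near \oo, Ex P (fun w => u n w ^+ 2) <= C) -> OP P u.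
Proof.
move=> uL uC e e0.
(* Keeps the threshold [sqrt (D / e)] positive even if [C = 0]; Chebyshev's bound then equals [e]
   exactly. *)
pose D := `|C| + 1; have D0 : 0 < D by rewrite ltr_wpDl.
exists (Num.sqrt (D / e)); apply: filterS uC => n un.
have K0 : 0 < Num.sqrt (D / e) by rewrite sqrtr_gt0 divr_gt0.
have CD : C <= D by rewrite (le_trans (ler_norm _))// lerDl.
have [mA PA] := chebyshev_Ex (uL n) K0 (le_trans un CD).
exists [set w | Num.sqrt (D / e) < `|u n w|]; split => //.
  rewrite (le_trans PA)// lee_fin sqr_sqrtr; last by rewrite divr_ge0// ltW.
  by rewrite invf_div mulrCA mulfV ?gt_eqF// mulr1.
by move=> w /negP; rewrite -leNgt.
Qed.

End expectation_truncate.

(** * Normalised sums over groups of independent observations *)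

Section array.
Context d (T : measurableType d) (R : realType) (P : probability T R).
Context (a q : nat) (Y : 'I_a * nat -> {RV P >-> borelV R q}).
Hypothesis indepY : mutually_independent Y.
Hypothesis identY : forall i k, identically_distributed (Y (i, k)) (Y (i, 0%N)).

Let mY i : measurable_fun setT (Y i).
Proof. exact: measurable_funPT. Qed.

Lemma Lint_ident i k (f : borelV R q -> R) : measurable_fun setT f ->
  Lint P (fun w => f (Y (i, 0%N) w)) -> Lint P (fun w => f (Y (i, k) w)).
Proof.
move=> mf fi; apply/integrableP; split.
  by apply/measurable_EFinP; exact: measurableT_comp.
have mnf : measurable_fun setT (fun y => `|(f y)%:E|%E).
  by apply: measurableT_comp => //; exact/measurable_EFinP.
have -> : (\int[P]_x `|(f (Y (i, k) x))%:E| =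
    \int[distribution P (Y (i, k))]_y `|(f y)%:E|)%E.
  by rewrite ge0_integral_distribution.
rewrite (eq_measure_integral (distribution P (Y (i, 0%N)))); last first.
  by move=> A mA _; exact: identY.
by rewrite ge0_integral_distribution//; case/integrableP : fi.
Qed.

Lemma Ex_ident i k (f : borelV R q -> R) : measurable_fun setT f ->
  Lint P (fun w => f (Y (i, 0%N) w)) ->
  Ex P (fun w => f (Y (i, k) w)) = Ex P (fun w => f (Y (i, 0%N) w)).
Proof.
move=> mf fi; rewrite /Ex /Rintegral; congr fine.
have mf' : measurable_fun setT (fun y => (f y)%:E) by exact/measurable_EFinP.
have E k' := @integral_distribution _ _ _ _ _ P (Y (i, k')) (fun y => (f y)%:E) mf'.
rewrite -(E k (Lint_ident k mf fi)) -(E 0%N fi).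
by apply: eq_measure_integral => A mA _; exact: identY.
Qed.

(** The identity holds for the truncations of [f] and [g] at level [n]; both sides pass to the limit
    by dominated convergence, with [|f|], [|g|] and [|f g|] as envelopes, and limits are unique. *)
Lemma Ex_indep2_L2 i j (f g : borelV R q -> R) : i != j ->
  measurable_fun setT f -> measurable_fun setT g ->
  L2 P (fun w => f (Y i w)) -> L2 P (fun w => g (Y j w)) ->
  Ex P (fun w => f (Y i w) * g (Y j w)) =
  Ex P (fun w => f (Y i w)) * Ex P (fun w => g (Y j w)).
Proof.
move=> ij mf mg Lf Lg.
have tr (h : borelV R q -> R) l n : bmeas (truncate n h) -> bmeas (fun w => truncate n h (Y l w)).
  by move=> ?; exact: bmeas_comp.
have bf n := tr _ i n (bmeas_truncate n mf).
have bg n := tr _ j n (bmeas_truncate n mg).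
have nL (h : T -> R) : L2 P h -> Lint P (fun w => `|h w|).
  move=> /L2_Lint ih; apply: (le_Lint (g := fun w => `|h w|)).
  - by apply: measurableT_comp => //; exact: Lint_measurable ih.
  - exact: (integrable_norm ih).
  - by move=> w; rewrite normr_id.
have cf : Ex P (fun w => truncate n f (Y i w)) @[n --> \oo] --> Ex P (fun w => f (Y i w)).
  apply: (@cvg_Ex_dominated _ _ _ _ _ _ (fun w => `|f (Y i w)|)) => //.
  - by move=> n; case: (bf n).
  - exact: L2_Lint.
  - exact: nL.
  - by move=> n w; exact: truncate_le.
  - by move=> w; exact: near_truncate.
have cg : Ex P (fun w => truncate n g (Y j w)) @[n --> \oo] --> Ex P (fun w => g (Y j w)).
  apply: (@cvg_Ex_dominated _ _ _ _ _ _ (fun w => `|g (Y j w)|)) => //.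
  - by move=> n; case: (bg n).
  - exact: L2_Lint.
  - exact: nL.
  - by move=> n w; exact: truncate_le.
  - by move=> w; exact: near_truncate.
have cfg : Ex P (fun w => truncate n f (Y i w) * truncate n g (Y j w)) @[n --> \oo] -->
    Ex P (fun w => f (Y i w) * g (Y j w)).
  have iM := L2M Lf Lg.
  apply: (@cvg_Ex_dominated _ _ _ _ _ _ (fun w => `|f (Y i w) * g (Y j w)|)) => //.
  - by move=> n; case: (bmeasM (bf n) (bg n)).
  - exact: (integrable_norm iM).
  - by move=> n w; rewrite (normrM (truncate _ _ _)) [leRHS]normrM; apply: ler_pM => //; exact: truncate_le.
  - move=> w; apply: filterS2 (near_truncate f (Y i w)) (near_truncate g (Y j w)).
    by move=> n -> ->.
have cM : Ex P (fun w => truncate n f (Y i w)) * Ex P (fun w => truncate n g (Y j w))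
    @[n --> \oo] --> Ex P (fun w => f (Y i w)) * Ex P (fun w => g (Y j w)).
  exact: cvgM.
have E : (fun n => Ex P (fun w => truncate n f (Y i w) * truncate n g (Y j w))) =
  (fun n => Ex P (fun w => truncate n f (Y i w)) * Ex P (fun w => truncate n g (Y j w))).
  apply/funext => n; apply: Ex_indep2 => //; exact: bmeas_truncate.
by rewrite -(cvg_lim (@Rhausdorff R) cfg) E; exact: cvg_lim cM.
Qed.

Variables (g : 'I_a -> borelV R q -> R) (s2 : 'I_a -> R).
Hypothesis mg : forall i, measurable_fun setT (g i).
Hypothesis Lg : forall i, L2 P (fun w => g i (Y (i, 0%N) w)).
Hypothesis g0 : forall i, Ex P (fun w => g i (Y (i, 0%N) w)) = 0.
Hypothesis g2 : forall i, Ex P (fun w => g i (Y (i, 0%N) w) ^+ 2) = s2 i.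

Let mg2 i : measurable_fun setT (fun y => g i y ^+ 2).
Proof. by under eq_fun do rewrite expr2; exact: measurable_funM. Qed.

Let Lgk i k : L2 P (fun w => g i (Y (i, k) w)).
Proof.
split; first exact: measurableT_comp.
by apply: (Lint_ident k (mg2 i)); case: (Lg i).
Qed.

Definition nsum i n w : R := (Num.sqrt n%:R)^-1 * \sum_(k < n) g i (Y (i, k : nat) w).

Lemma L2_nsum i n : L2 P (nsum i n).
Proof. by apply: L2Z; apply: L2_sum => k; exact: Lgk. Qed.

Lemma Ex_nsum_sqr i n : (0 < n)%N -> Ex P (fun w => nsum i n w ^+ 2) = s2 i.
Proof.
move=> n0.
have -> : (fun w => nsum i n w ^+ 2) = (fun w => n%:R^-1 *
    \sum_(k < n) \sum_(l < n) g i (Y (i, k : nat) w) * g i (Y (i, l : nat) w)).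
  apply/funext => w; rewrite /nsum exprMn exprVn sqr_sqrtr// expr2 mulr_suml.
  by under eq_bigr do rewrite mulr_sumr.
have iM k l : Lint P (fun w => g i (Y (i, k) w) * g i (Y (i, l) w)) by exact: L2M.
have iM1 (k : 'I_n) : Lint P (fun w => \sum_(l < n) g i (Y (i, k : nat) w) * g i (Y (i, l : nat) w)).
  by apply: Lint_sum => l; exact: iM.
rewrite (ExZ _ (Lint_sum _ iM1)) Ex_sum//.
rewrite (eq_bigr (fun=> s2 i)); last first.
  move=> k _; rewrite Ex_sum//.
  rewrite (bigD1 k)//= big1 ?addr0; last first.
    move=> l lk; rewrite Ex_indep2_L2//.
      by rewrite (Ex_ident _ (mg i)) ?g0 ?mul0r//; exact: L2_Lint.
    by rewrite xpair_eqE eqxx/= eq_sym.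
  have -> : (fun w => g i (Y (i, k : nat) w) * g i (Y (i, k : nat) w)) =
    (fun w => g i (Y (i, k : nat) w) ^+ 2) by apply/funext => w; rewrite expr2.
  by rewrite (@Ex_ident i k _ (mg2 i)) ?g2//; case: (Lg i).
by rewrite sumr_const card_ord -[s2 i *+ n]mulr_natl mulKf// pnatr_eq0 -lt0n.
Qed.

Lemma OP_nsum i : OP P (nsum i).
Proof.
apply: (OP_of_L2 (C := s2 i)); first exact: L2_nsum.
by exists 1%N => // n /= n0; rewrite Ex_nsum_sqr.
Qed.

(** A replacement in group [i] costs [(e1 + e2) / n m i] and there are [n m i] of them, so group [i]
    contributes [e1 + e2] at its own size, which tends to 0. *)
Theorem array_clt (n : nat -> 'I_a -> nat) c :
  (forall b : nat, \forall m \near \oo, forall i, (b <= n m i)%N) ->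
  Ex P (fun w => cos (c + \sum_i nsum i (n m i) w)) @[m --> \oo] -->
  expR (- (\sum_i s2 i) / 2) * cos c.
Proof.
move=> noo.
have s20 i : 0 <= s2 i by rewrite -g2; apply: Ex_ge0 => w; exact: sqr_ge0.
pose e1 i k := `|k%:R * (Ex P (fun w => cos ((Num.sqrt k%:R)^-1 * g i (Y (i, 0%N) w))) -
  expR (- (s2 i / 2 / k%:R)))|.
pose e2 i k := `|k%:R * Ex P (fun w => sin ((Num.sqrt k%:R)^-1 * g i (Y (i, 0%N) w)))|.
have e0 i : e1 i k + e2 i k @[k --> \oo] --> 0.
  rewrite -[X in _ --> X](addr0 (0 : R)); apply: cvgD.
    rewrite -(normr0 R); apply: cvg_norm; exact: clt_cos.
  rewrite -(normr0 R); apply: cvg_norm; exact: clt_sin.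
have bnd m : (forall i, (0 < n m i)%N) ->
    `|Ex P (fun w => cos (c + \sum_i nsum i (n m i) w)) -
      expR (- (\sum_i s2 i) / 2) * cos c| <=
    \sum_i (e1 i (n m i) + e2 i (n m i)).
  move=> n0.
  (* All observations of all groups as one list without repetition, of group-dependent row lengths;
     [rho] is the Gaussian factor of one summand. *)
  pose s := [seq (i, k) | i <- enum 'I_a, k <- iota 0 (n m i)].
  have us : uniq s.
    apply: allpairs_uniq_dep => [|i _|].
    - exact: enum_uniq.
    - exact: iota_uniq.
    - by move=> [i k] [i' k'] _ _ /= [-> ->].
  pose xi (ik : 'I_a * nat) y := (Num.sqrt (n m ik.1)%:R)^-1 * g ik.1 y.
  have mxi ik : measurable_fun setT (xi ik) by exact: measurable_funM.
  pose rho (ik : 'I_a * nat) := expR (- (s2 ik.1 / 2 / (n m ik.1)%:R)).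
  have rho01 ik : 0 <= rho ik <= 1.
    by rewrite expR_ge0/= -expR0 ler_expR oppr_le0 !divr_ge0.
  have big_s (V : Type) (idx : V) (op : Monoid.com_law idx) (F : 'I_a * nat -> V) :
      \big[op/idx]_(ik <- s) F ik =
      \big[op/idx]_(i < a) \big[op/idx]_(k < n m i) F (i, k : nat).
    rewrite big_allpairs_dep big_enum/=; apply: eq_bigr => i _.
    by rewrite -(big_mkord xpredT (fun k => F (i, k))) /index_iota subn0.
  have := Ex_cos_dist indepY mxi c us rho01.
  have -> : \prod_(i <- s) rho i = expR (- (\sum_i s2 i) / 2).
    rewrite big_s/= mulNr mulr_suml -sumrN expR_sum; apply: eq_bigr => i _.
    rewrite /rho/= prodr_const card_ord -expRM_natl; congr expR.
    rewrite mulrN; congr (- _); rewrite mulrC divfK//.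
    by rewrite pnatr_eq0 -lt0n.
  rewrite big_s/=.
  have -> : (fun w => cos (c + xsum Y xi s w)) =
      (fun w => cos (c + \sum_i nsum i (n m i) w)).
    apply/funext => w; congr (cos (c + _)); rewrite /xsum big_s/=.
    by apply: eq_bigr => i _; rewrite /xi/= -mulr_sumr.
  move=> /le_trans; apply; apply: ler_sum => i _.
  have n0' : 0 < (n m i)%:R :> R by rewrite ltr0n.
  rewrite (eq_bigr (fun=> (n m i)%:R^-1 * (e1 i (n m i) + e2 i (n m i)))).
    rewrite sumr_const card_ord -[X in X <= _]mulr_natl mulVKf ?gt_eqF//.
  move=> k _; rewrite /e1 /e2 /rho /xi/= !normrM !(gtr0_norm n0') -mulrDr mulKf ?gt_eqF//.
  have mgi : measurable_fun setT (fun y => (Num.sqrt (n m i)%:R)^-1 * g i y).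
    exact: measurable_funM.
  have bc : bmeas (fun y : borelV R q => cos ((Num.sqrt (n m i)%:R)^-1 * g i y)).
    exact: bmeas_cos.
  have bs : bmeas (fun y : borelV R q => sin ((Num.sqrt (n m i)%:R)^-1 * g i y)).
    exact: bmeas_sin.
  rewrite (@Ex_ident i k (fun y => cos ((Num.sqrt (n m i)%:R)^-1 * g i y))).
  - rewrite (@Ex_ident i k (fun y => sin ((Num.sqrt (n m i)%:R)^-1 * g i y)))//.
    + by case: bs.
    + by apply: bmeas_Lint; exact: (bmeas_comp (mY (i, 0%N)) bs).
  - by case: bc.
  - by apply: bmeas_Lint; exact: (bmeas_comp (mY (i, 0%N)) bc).
apply/cvgrPdist_le => /= eps eps0.
(* [a.+1] rather than [a] keeps each share positive when [a = 0]. *)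
have ea0 : 0 < eps / a.+1%:R by rewrite divr_gt0.
have : \forall k \near \oo, forall i, e1 i k + e2 i k <= eps / a.+1%:R.
  have /filter_forall : forall i : 'I_a,
      \forall k \near \oo, e1 i k + e2 i k <= eps / a.+1%:R.
    move=> i; have /cvgr0Pnorm_le/(_ _ ea0) := e0 i.
    by apply: filterS => k; apply: le_trans; exact: ler_norm.
  by apply.
move=> [b _ hb].
apply: filterS2 (noo b) (noo 1%N) => m nb n1.
rewrite distrC (le_trans (bnd _ n1))//.
apply: (@le_trans _ _ (\sum_(i < a) eps / a.+1%:R)).
  by apply: ler_sum => i _; apply: hb => /=; exact: nb.
rewrite sumr_const card_ord -[leLHS]mulr_natl mulrCA ler_piMr ?ltW//.
by rewrite ltr_pdivrMr// mul1r ltr_nat.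
Qed.

End array.

(** * Normal laws and their characteristic functions *)

Section lebesgue_affine.
Context {R : realType}.
Local Notation mu := (@lebesgue_measure R).

Lemma measurable_affine (al x : R) :
  measurable_fun setT (fun y : measurableTypeR R => (al * y + x : measurableTypeR R)).
Proof. by apply: measurable_funD => //; exact: measurable_funM. Qed.

(** The rescaled image measure agrees with Lebesgue measure on half-open intervals, which determines
    it. *)
Lemma lebesgue_measure_affine (al x : R) (A : set R) : al != 0 -> measurable A ->
  (`|al|%:E * mu ((fun y : R => (al * y + x)%R) @^-1` A))%E = mu A.
Proof.
move=> al0 mA.
have na0 : 0 <= `|al| by [].
pose f (y : measurableTypeR R) : measurableTypeR R := al * y + x.
have mf : measurable_fun setT f by exact: measurable_affine.
suff H : forall (X : set R), ocitv X -> mu X = mscale (NngNum na0) (pushforward mu f) X.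
  by rewrite (lebesgue_measure_unique (H mf) mA).
move=> m0 X [[a b]] _ <-; rewrite /mscale/= /pushforward /f.
rewrite lebesgue_measure_itv/= lte_fin.
have [al1|al1] := ltP 0 al.
  have -> : (fun y : R => al * y + x) @^-1` `]a, b] = `](a - x) / al, (b - x) / al]%classic.
    apply/seteqP; split => y /=; rewrite !in_itv/= ltr_pdivrMr// ler_pdivlMr//.
      by rewrite ltrBlDr lerBrDr mulrC.
    by rewrite ltrBlDr lerBrDr mulrC.
  rewrite lebesgue_measure_itv/= lte_fin ltr_pM2r ?invr_gt0// ltrD2r.
  case: ifPn => _; last by rewrite mule0.
  rewrite gtr0_norm// -!EFinB -EFinM; congr EFin; field.
  by rewrite gt_eqF.
(* A negative slope reverses the interval and exchanges which end is closed; its length is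
   unaffected. *)
have {}al1 : al < 0 by rewrite lt_neqAle al0.
have -> : (fun y : R => al * y + x) @^-1` `]a, b] = `[(b - x) / al, (a - x) / al[%classic.
  apply/seteqP; split => y /=; rewrite !in_itv/= ler_ndivrMr// ltr_ndivlMr//.
    by rewrite ltrBlDr lerBrDr mulrC andbC.
  by rewrite ltrBlDr lerBrDr mulrC andbC.
rewrite lebesgue_measure_itv/= lte_fin ltr_nM2r ?invr_lt0// ltrD2r.
case: ifPn => _; last by rewrite mule0.
rewrite ltr0_norm// -!EFinB -EFinM; congr EFin; field.
by rewrite lt_eqF.
Qed.

Lemma ge0_integral_affine (al x : R) (f : R -> \bar R) : al != 0 ->
  measurable_fun setT f -> (forall y, 0 <= f y)%E ->
  (`|al|%:E * \int[mu]_y f (al * y + x)%R)%E = (\int[mu]_y f y)%E.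
Proof.
move=> al0 mf f0.
have na0 : 0 <= `|al| by [].
have mphi := measurable_affine al x.
rewrite -(ge0_integral_pushforward mphi mu measurableT mf)//.
have h := @ge0_integral_mscale _ _ _ (pushforward mu
  (fun y : measurableTypeR R => (al * y + x : measurableTypeR R))) setT measurableT
  (NngNum na0) f mf.
rewrite -[LHS]h//.
apply: eq_measure_integral => A mA _.
by rewrite /mscale/= /pushforward; exact: lebesgue_measure_affine.
Qed.

End lebesgue_affine.

Section normal_integral.
Context {R : realType}.
Local Notation mu := (@lebesgue_measure R).

(** The Radon-Nikodym derivative of the normal law has the same integrals over measurable sets as
    [normal_pdf], so the two agree almost everywhere. *)
Lemma integral_normal_prob (m s : R) (f : R -> \bar R) :
  (normal_prob m s).-integrable setT f ->
  (\int[normal_prob m s]_x f x = \int[mu]_x (f x * (normal_pdf m s x)%:E))%E.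
Proof.
move=> fi; have mf := measurable_int _ fi.
rewrite -(Radon_Nikodym_change_of_variables (@normal_prob_dominates R m s))//.
apply: ae_eq_integral => //.
- apply: emeasurable_funM => //; apply: (measurable_int mu).
  by apply: Radon_Nikodym_integrable; exact: normal_prob_dominates.
- apply: emeasurable_funM => //; apply/measurable_EFinP; exact: measurable_normal_pdf.
- apply: ae_eqe_mul2l => /=.
  rewrite Radon_NikodymE//=; first exact: normal_prob_dominates.
  move=> dom.
  case: cid => /= h [h1 h2 h3].
  apply: integral_ae_eq => //=.
  + by apply/measurable_EFinP; exact: measurable_normal_pdf.
  + by move=> E _ mE; rewrite -h3.
Qed.

Lemma Ex_normal (m s : R) (f : R -> R) : bmeas f ->
  Ex (normal_prob m s : probability _ R) f = \int[mu]_x (f x * normal_pdf m s x).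
Proof.
move=> bf; rewrite /Ex /Rintegral integral_normal_prob//.
exact: (@bmeas_Lint _ _ _ (normal_prob m s : probability _ R) f bf).
Qed.

End normal_integral.

(** * Scaling and convolution of normal laws *)

Section gaussian_convolution.
Context {R : realType}.
Local Notation mu := (@lebesgue_measure R).
Local Notation N01 := (normal_prob 0 1 : probability (measurableTypeR R) R).

Lemma normal_pdf_scale (al z : R) : al != 0 ->
  normal_pdf 0 1 (al^-1 * z) = `|al| * normal_pdf 0 `|al| z.
Proof.
move=> al0; have nal0 : `|al| != 0 by rewrite normr_eq0.
rewrite !normal_pdfE// ?oner_eq0// /normal_peak /normal_fun !subr0 real_normK ?num_real//.
rewrite expr1n mul1r mulrA; congr (_ * expR _); last by field.
rewrite -mulrnAr sqrtrM ?sqr_ge0// sqrtr_sqr invfM mulrA mulfV// mul1r//.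
Qed.

Lemma normal_probE (m s : R) (B : set R) :
  normal_prob m s B = (\int[mu]_x (\1_B x * normal_pdf m s x)%:E)%E.
Proof.
rewrite /normal_prob integral_mkcond; apply: eq_integral => x _.
by rewrite patchE indicE; case: ifPn => _; rewrite ?mul1r ?mul0r.
Qed.

Lemma measurable_indic_normal_pdf (m s : R) (B : set R) : measurable B ->
  measurable_fun setT (fun x : measurableTypeR R => (\1_B x * normal_pdf m s x)%:E).
Proof.
move=> mB; apply/measurable_EFinP; apply: measurable_funM.
  exact: measurable_indic.
exact: measurable_normal_pdf.
Qed.

Lemma indic_normal_pdf_ge0 (m s : R) (B : set R) x :
  (0 <= (\1_B x * normal_pdf m s x)%:E)%E.
Proof.
by rewrite lee_fin mulr_ge0 ?normal_pdf_ge0// indicE; case: (_ \in _).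
Qed.

Lemma normal_prob_scale (al : R) (B : set R) : al != 0 -> measurable B ->
  N01 ((fun g => al * g) @^-1` B) = normal_law 0 (al ^+ 2) B.
Proof.
move=> al0 mB; rewrite /normal_law sqrf_eq0 (negPf al0) sqrtr_sqr.
rewrite [LHS]normal_probE [RHS]normal_probE.
rewrite -[RHS](@ge0_integral_affine _ al 0 _ al0); last 2 first.
- exact: measurable_indic_normal_pdf.
- exact: indic_normal_pdf_ge0.
rewrite -ge0_integralZl//; last 2 first.
- apply: (measurableT_comp (measurable_indic_normal_pdf 0 `|al| mB)).
  exact: measurable_affine.
- by move=> y _; exact: indic_normal_pdf_ge0.
apply: eq_integral => g _; rewrite addr0 -EFinM; congr EFin.
have -> : \1_((fun g0 => al * g0) @^-1` B) g = \1_B (al * g) :> R.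
  by rewrite !indicE; congr (nat_of_bool _)%:R; apply/idP/idP; rewrite !inE.
by rewrite mulrCA -normal_pdf_scale// mulKf.
Qed.

(** Completing the square in [g]: the joint density of [g] and [z = al * g + y] is the density of
    [z], of variance [al ^+ 2 + s ^+ 2], times the conditional density of [g] given [z], of mean
    [al * z / c ^+ 2] and standard deviation [s / c]. *)
Lemma normal_pdf_convolution (al s z g : R) : al != 0 -> 0 < s ->
  let c := Num.sqrt (al ^+ 2 + s ^+ 2) in
  normal_pdf 0 1 g * normal_pdf 0 s (z - al * g) =
  normal_pdf 0 c z * normal_pdf (al * z / c ^+ 2) (s / c) g.
Proof.
move=> al0 s0 c.
have al20 : 0 < al ^+ 2 by rewrite exprn_even_gt0.
have c20 : 0 < al ^+ 2 + s ^+ 2 by rewrite addr_gt0// exprn_gt0.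
have c0 : 0 < c by rewrite sqrtr_gt0.
have c2 : c ^+ 2 = al ^+ 2 + s ^+ 2 by rewrite sqr_sqrtr// ltW.
rewrite !normal_pdfE ?oner_eq0 ?gt_eqF ?divr_gt0//.
rewrite /normal_peak /normal_fun !subr0 expr1n mul1r.
rewrite mulrACA [RHS]mulrACA -!expRD; congr (_ * expR _).
  have pi2 : 0 <= (pi : R) *+ 2 by rewrite mulrn_wge0// pi_ge0.
  rewrite -!mulrnAr !(sqrtrM _ (sqr_ge0 _)) !sqrtr_sqr gtr0_norm// gtr0_norm// gtr0_norm ?divr_gt0//.
  by rewrite !invfM invrK; field; rewrite !gt_eqF// sqrtr_gt0 mulrn_wgt0// pi_gt0.
rewrite expr_div_n c2; field.
by rewrite !gt_eqF.
Qed.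

Lemma normal_law_convolution (al s2 : R) (B : set R) : 0 <= s2 -> measurable B ->
  (\int[N01]_g normal_law 0 s2 ((fun y : R => al * g + y)%R @^-1` B))%E =
  normal_law 0 (al ^+ 2 + s2) B.
Proof.
move=> s20 mB.
(* The density computation requires [al] nonzero and [s2] positive; for [s2 = 0] the inner law is a
   Dirac mass. *)
have [->|al0] := eqVneq al 0.
  rewrite expr0n/= add0r.
  under eq_integral.
    move=> g _; rewrite (_ : _ @^-1` B = B); last first.
      by apply/seteqP; split => y /=; rewrite mul0r add0r.
    over.
  rewrite integral_cst//=; set p := normal_prob 0 1 setT.
  by have -> : p = 1%E by [exact: (probability_setT N01)]; rewrite mule1.
have [->|s2n0] := eqVneq s2 0.
  rewrite addr0 -normal_prob_scale//.
  rewrite /normal_law eqxx.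
  under eq_integral.
    move=> g _; rewrite diracE (_ : (0 \in _) = (g \in (fun g => al * g) @^-1` B)); last first.
      by apply/idP/idP; rewrite !inE/= addr0.
    over.
  rewrite (_ : (fun x => _) = EFin \o \1_((fun g => al * g) @^-1` B)); last first.
    by apply/funext => x /=; rewrite indicE.
  rewrite integral_indic//= ?setIT//.
  rewrite -[X in measurable X]setTI; apply: (measurable_funM (measurable_cst al) (@measurable_id _ _ setT)) => //.
have s0 : 0 < Num.sqrt s2 by rewrite sqrtr_gt0 lt_neqAle eq_sym s2n0.
rewrite /normal_law (negPf s2n0) gt_eqF; last first.
  by rewrite ltr_pwDl// ?exprn_even_gt0.
set s := Num.sqrt s2 in s0 *.
have s2E : s2 = s ^+ 2 by rewrite sqr_sqrtr.
rewrite s2E; set c := Num.sqrt (al ^+ 2 + s ^+ 2).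
pose A : set (measurableTypeR R * measurableTypeR R) := [set gy | B (al * gy.1 + gy.2)].
have maff : measurable_fun setT (fun gy : measurableTypeR R * measurableTypeR R =>
    (al * gy.1 + gy.2 : measurableTypeR R)).
  by apply: measurable_funD => //; apply: measurable_funM.
have mA : measurable A by rewrite -[A]setTI; exact: maff.
have mN : measurable_fun setT (fun g : measurableTypeR R =>
    normal_prob 0 s ((fun y : R => al * g + y) @^-1` B)).
  have := measurable_fun_xsection (normal_prob 0 s : probability _ R) mA.
  apply: eq_measurable_fun => g _ /=; congr normal_prob.
  by apply/seteqP; split => y; rewrite /xsection/= inE.
have mBg (g : R) : measurable ((fun y : R => al * g + y) @^-1` B).
  by rewrite -[X in measurable X]setTI; apply: (measurable_funD (measurable_cst (al * g)) (@measurable_id _ _ setT)).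
have N1 (g : R) : (normal_prob 0 s ((fun y : R => al * g + y)%R @^-1` B) <= 1)%E.
  exact: (probability_le1 (normal_prob 0 s : probability _ R) (mBg g)).
have N0 (g : R) : (0 <= normal_prob 0 s ((fun y : R => al * g + y)%R @^-1` B))%E.
  exact: (measure_ge0 (normal_prob 0 s : probability _ R)).
rewrite integral_normal_prob; last first.
  apply: (@le_integrable _ _ R N01 setT measurableT _ (cst 1%E)) => //.
    by move=> g _; rewrite gee0_abs ?gee0_abs.
  exact: (finite_measure_integrable_cst N01 1).
pose k (gz : measurableTypeR R * measurableTypeR R) : \bar R :=
  (\1_B gz.2 * (normal_pdf 0 1 gz.1 * normal_pdf 0 s (gz.2 - al * gz.1)))%:E.
have k0 gz : (0 <= k gz)%E.
  by rewrite lee_fin !mulr_ge0 ?normal_pdf_ge0// indicE; case: (_ \in _).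
have mk : measurable_fun setT k.
  apply/measurable_EFinP; apply: measurable_funM.
    exact: (measurableT_comp (@measurable_indic _ (measurableTypeR R) R setT B mB)).
  apply: measurable_funM.
    by apply: (measurableT_comp (measurable_normal_pdf 0 1)).
  apply: (measurableT_comp (measurable_normal_pdf 0 s)).
  by apply: measurable_funB => //; apply: measurable_funM.
(* The translation [z = al * g + y] makes the event [B z] independent of [g]; after exchanging the
   integrals, the conditional density of [g] integrates to 1. *)
transitivity (\int[mu]_g \int[mu]_z k (g, z))%E.
  apply: eq_integral => g _; rewrite normal_probE.
  rewrite -(@ge0_integral_affine _ 1 (- (al * g)) _ (oner_neq0 R)); last 2 first.
  - apply/measurable_EFinP; apply: measurable_funM; last exact: measurable_normal_pdf.
    exact: measurable_indic.
  - by move=> y; exact: indic_normal_pdf_ge0.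
  rewrite normr1 mul1e -ge0_integralZr//; last 3 first.
  - apply: (measurableT_comp (f := fun x => (\1_((fun y : R => al * g + y) @^-1` B) x * normal_pdf 0 s x)%:E)).
      exact: measurable_indic_normal_pdf.
    exact: measurable_affine.
  - by move=> y _; exact: indic_normal_pdf_ge0.
  - by rewrite lee_fin normal_pdf_ge0.
  apply: eq_integral => z _; rewrite /k/= mul1r -EFinM; congr EFin.
  have -> : \1_((fun y : R => al * g + y) @^-1` B) (z - al * g) = \1_B z :> R.
    rewrite !indicE; congr (nat_of_bool _)%:R; apply/idP/idP; rewrite !inE/= addrC subrK//.
  by rewrite -mulrA; congr (_ * _); rewrite mulrC.
rewrite (fubini_tonelli k)// normal_probE; apply: eq_integral => z _.
under eq_integral do rewrite /k/= normal_pdf_convolution// mulrA EFinM.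
rewrite ge0_integralZl//.
- by rewrite integral_normal_pdf mule1.
- by apply/measurable_EFinP; exact: measurable_normal_pdf.
- by move=> y _; rewrite lee_fin normal_pdf_ge0.
- exact: indic_normal_pdf_ge0.
Qed.

End gaussian_convolution.

Section laws.
Context d1 d2 (T1 : measurableType d1) (T2 : measurableType d2) (R : realType).
Variables (Q1 : probability T1 R) (Q2 : probability T2 R).

Lemma Ex_law (Z1 : T1 -> R) (Z2 : T2 -> R) (f : R -> R) :
  measurable_fun setT Z1 -> measurable_fun setT Z2 ->
  (forall B, measurable B -> Q1 (Z1 @^-1` B) = Q2 (Z2 @^-1` B)) ->
  bmeas f -> Ex Q1 (fun x => f (Z1 x)) = Ex Q2 (fun x => f (Z2 x)).
Proof.
move=> m1 m2 law bf; rewrite /Ex /Rintegral; congr fine.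
have mf : measurable_fun setT (EFin \o f) by apply/measurable_EFinP; case: bf.
have i1 : Q1.-integrable setT ((EFin \o f) \o Z1) := bmeas_Lint Q1 (bmeas_comp m1 bf).
have i2 : Q2.-integrable setT ((EFin \o f) \o Z2) := bmeas_Lint Q2 (bmeas_comp m2 bf).
rewrite -[LHS](integral_pushforward m1 mf i1 measurableT).
rewrite -[RHS](integral_pushforward m2 mf i2 measurableT).
by apply: eq_measure_integral => A mA _; exact: law.
Qed.

Lemma Ex_fst (f : T1 -> R) : bmeas f ->
  Ex (Q1 \x Q2)%E (fun z => f z.1) = Ex Q1 f.
Proof.
move=> bf; rewrite /Ex /Rintegral; congr fine.
have mf : measurable_fun setT (EFin \o f) by apply/measurable_EFinP; case: bf.
have m1 : measurable_fun setT (@fst T1 T2) by [].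
have i1 := bmeas_Lint (Q1 \x Q2)%E (bmeas_comp m1 bf).
rewrite -[LHS](integral_pushforward m1 mf i1 measurableT).
apply: eq_measure_integral => A mA _; rewrite /pushforward.
have E : (@fst T1 T2) @^-1` A = A `*` [set: T2].
  by apply/seteqP; split => z //= [].
have h : (Q1 \x Q2)%E (A `*` [set: T2]) = (Q1 A * 1)%E.
  by rewrite -(probability_setT Q2); exact: product_measure1E.
by rewrite mule1 -E in h.
Qed.

Lemma Ex_snd (g : T2 -> R) : bmeas g ->
  Ex (Q1 \x Q2)%E (fun z => g z.2) = Ex Q2 g.
Proof.
move=> bf; rewrite /Ex /Rintegral; congr fine.
have mf : measurable_fun setT (EFin \o g) by apply/measurable_EFinP; case: bf.
have m1 : measurable_fun setT (@snd T1 T2) by [].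
have i1 := bmeas_Lint (Q1 \x Q2)%E (bmeas_comp m1 bf).
rewrite -[LHS](integral_pushforward m1 mf i1 measurableT).
apply: eq_measure_integral => A mA _; rewrite /pushforward.
have E : (@snd T1 T2) @^-1` A = [set: T1] `*` A.
  by apply/seteqP; split => z //= [].
have h : (Q1 \x Q2)%E ([set: T1] `*` A) = (1 * Q2 A)%E.
  by rewrite -(probability_setT Q1); exact: product_measure1E.
by rewrite mul1e -E in h.
Qed.

Lemma Ex_prod (f : T1 -> R) (g : T2 -> R) : bmeas f -> bmeas g ->
  Ex (Q1 \x Q2)%E (fun z => f z.1 * g z.2) = Ex Q1 f * Ex Q2 g.
Proof.
move=> bf bg; rewrite -(Ex_fst bf) -(Ex_snd bg).
have m1 : measurable_fun setT (@fst T1 T2) by [].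
have m2 : measurable_fun setT (@snd T1 T2) by [].
apply: (Ex_indep_of_indic m1 (bmeas_comp m2 bg)) => // B mB.
have bB : bmeas (\1_B : T1 -> R) by exact: bmeas_indic.
under eq_fun do rewrite mulrC.
rewrite (Ex_indep_of_indic m2 (bmeas_comp m1 bB))// 1?mulrC// => C mC.
have bC : bmeas (\1_C : T2 -> R) by exact: bmeas_indic.
rewrite (Ex_snd bC) (Ex_fst bB) !Ex_indic//.
have -> : (fun z : T1 * T2 => \1_C z.2 * \1_B z.1) = \1_(B `*` C) :> (T1 * T2 -> R).
  apply/funext => z; rewrite !indicE -natrM mulnb; congr (nat_of_bool _)%:R.
  by apply/andP/idP; rewrite !inE => -[].
rewrite Ex_indic; last exact: measurableX.
have h := product_measure1E Q1 Q2 mB mC.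
rewrite (_ : fine _ = fine (Q1 B * Q2 C)%E); last by rewrite -h.
by rewrite fineM ?fin_num_measure// mulrC.
Qed.

End laws.

(** * The characteristic function of N(0, 1) *)

Section gaussian_charfun.
Context {R : realType}.
Local Notation mu := (@lebesgue_measure R).
Local Notation N01 := (normal_prob 0 1 : probability (measurableTypeR R) R).

Lemma normal_prob_scale_all (al : R) (B : set R) : measurable B ->
  N01 ((fun g => al * g) @^-1` B) = normal_law 0 (al ^+ 2) B.
Proof.
move=> mB; have [->|] := eqVneq al 0; last by move=> ?; exact: normal_prob_scale.
rewrite /normal_law expr0n/= eqxx diracE.
have [B0|B0] := boolP (0 \in B).
  rewrite (_ : _ @^-1` B = setT); first exact: (probability_setT N01).
  by apply/seteqP; split => x //= _; rewrite mul0r; rewrite inE in B0.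
rewrite (_ : _ @^-1` B = set0); first exact: (measure0 N01).
by rewrite -subset0 => x /=; rewrite mul0r => B0'; rewrite notin_setE in B0.
Qed.

(** The full characteristic function: its imaginary part vanishes by symmetry ([Ex_sin_normal]). *)
Definition psi (s : R) : R := Ex N01 (fun x => cos (s * x)).

Lemma measurable_mul (s : R) : measurable_fun setT (fun x : measurableTypeR R => s * x).
Proof. exact: measurable_funM. Qed.

Lemma bmeas_sinR (s : R) : bmeas (fun x : measurableTypeR R => sin (s * x) : R).
Proof. by apply: bmeas_sin; exact: measurable_mul. Qed.

Lemma bmeas_cosR0 (s : R) : bmeas (fun x : measurableTypeR R => cos (s * x) : R).
Proof. by apply: bmeas_cos; exact: measurable_mul. Qed.

Lemma Ex_sin_normal (s : R) : Ex N01 (fun x => sin (s * x)) = 0.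
Proof.
have h : Ex N01 (fun x => sin (s * (-1 * x))) = Ex N01 (fun x => sin (s * (1 * x))).
  apply: (@Ex_law _ _ _ _ _ N01 N01 (fun x => -1 * x) (fun x => 1 * x) (fun y => sin (s * y))).
  - exact: measurable_mul.
  - exact: measurable_mul.
  - move=> B mB; have e1 := normal_prob_scale_all (-1) mB.
    have e2 := normal_prob_scale_all 1 mB.
    by rewrite sqrrN -e2 in e1.
  - exact: bmeas_sinR.
have hN : (fun x => sin (s * (-1 * x))) = (fun x => -1 * sin (s * x)).
  by apply/funext => x; rewrite mulN1r mulrN sinN mulN1r.
have hP : (fun x => sin (s * (1 * x))) = (fun x => sin (s * x)).
  by apply/funext => x; rewrite mul1r.
move: h; rewrite hN hP (ExZ (-1) (bmeas_Lint N01 (bmeas_sinR s))); lra.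
Qed.

(** The sum of two independent N(0, 1) variables has the law of [sqrt 2] times one of them; in the
    addition formula the product of sines has null expectation. *)
Lemma psi_sqrt2 (s : R) : psi (s * Num.sqrt 2) = psi s ^+ 2.
Proof.
have mB1 (B : set R) : measurable B -> (N01 \x N01)%E ((fun z => z.1 + z.2) @^-1` B) =
    normal_law 0 2 B.
  move=> mB; rewrite (_ : 2 = 1 ^+ 2 + 1 :> R); last by rewrite expr1n.
  rewrite -(normal_law_convolution 1 (@ler01 R) mB).
  apply: eq_integral => x _; rewrite /normal_law oner_eq0 sqrtr1/=.
  congr normal_prob; apply/seteqP; split => y; rewrite /xsection/= inE/= mul1r//.
have mD : measurable_fun setT (fun z : measurableTypeR R * measurableTypeR R =>
    (z.1 + z.2 : measurableTypeR R)) by exact: measurable_funD.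
have h : Ex (N01 \x N01)%E (fun z => cos (s * (z.1 + z.2))) =
         Ex N01 (fun x => cos (s * (Num.sqrt 2 * x))).
  apply: (@Ex_law _ _ _ _ _ (N01 \x N01)%E N01 (fun z => z.1 + z.2)
    (fun x => Num.sqrt 2 * x) (fun y => cos (s * y))).
  - exact: mD.
  - exact: measurable_mul.
  - move=> B mB; have e1 := normal_prob_scale_all (Num.sqrt 2) mB.
    by rewrite sqr_sqrtr// -(mB1 _ mB) in e1.
  - exact: bmeas_cosR0.
have m1 : measurable_fun setT (@fst (measurableTypeR R) (measurableTypeR R)) by [].
have m2 : measurable_fun setT (@snd (measurableTypeR R) (measurableTypeR R)) by [].
rewrite /psi; under eq_fun do rewrite -mulrA.
rewrite -h.
have -> : (fun z : measurableTypeR R * measurableTypeR R => cos (s * (z.1 + z.2))) =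
    (fun z => cos (s * z.1) * cos (s * z.2) - sin (s * z.1) * sin (s * z.2)).
  by apply/funext => z; rewrite mulrDr cosD.
have bc := bmeasM (bmeas_comp m1 (bmeas_cosR0 s)) (bmeas_comp m2 (bmeas_cosR0 s)).
have bs := bmeasM (bmeas_comp m1 (bmeas_sinR s)) (bmeas_comp m2 (bmeas_sinR s)).
rewrite (ExB (bmeas_Lint _ bc) (bmeas_Lint _ bs)).
rewrite (Ex_prod N01 N01 (bmeas_cosR0 s) (bmeas_cosR0 s)).
rewrite (Ex_prod N01 N01 (bmeas_sinR s) (bmeas_sinR s)).
by rewrite Ex_sin_normal mulr0 subr0 expr2.
Qed.

Lemma psi_pow (k : nat) (s : R) :
  psi s = psi ((Num.sqrt (2 ^ k)%:R)^-1 * s) ^+ (2 ^ k).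
Proof.
elim: k s => [|k ih] s; first by rewrite sqrtr1 invr1 mul1r expr1.
rewrite ih expnS exprM; congr (_ ^+ _).
rewrite -psi_sqrt2; congr psi.
rewrite natrM sqrtrM//; field.
by rewrite !gt_eqF// sqrtr_gt0// ltr0n expn_gt0.
Qed.

(** Since [x ^+ 2 / 4 <= expR (x ^+ 2 / 4)], the integrand is at most 4 times [expR (- x ^+ 2 / 4)]
    up to normalisation, a multiple of the N(0, 2) density; [sqrt 2] is the ratio of the peaks. *)
Lemma integrable_sqr_normal_pdf :
  mu.-integrable setT (fun x => (x ^+ 2 * normal_pdf 0 1 x)%:E).
Proof.
have s0 : Num.sqrt 2 != 0 :> R by rewrite gt_eqF// sqrtr_gt0.
apply: (@le_integrable _ _ _ mu setT measurableT _
  (fun x => ((4 * Num.sqrt 2) * normal_pdf 0 (Num.sqrt 2) x)%:E)).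
- apply/measurable_EFinP; apply: measurable_funM; last exact: measurable_normal_pdf.
  by under eq_fun do rewrite expr2; exact: measurable_funM.
- move=> x _; rewrite lee_fin ger0_norm; last first.
    by rewrite mulr_ge0 ?sqr_ge0 ?normal_pdf_ge0.
  apply: le_trans (ler_norm _).
  rewrite !normal_pdfE ?oner_eq0// /normal_peak /normal_fun !subr0 sqr_sqrtr// expr1n mul1r.
  rewrite -mulrnAr (sqrtrM _ (ler0n _ 2)) invfM.
  have sp : 0 < Num.sqrt ((pi : R) *+ 2) by rewrite sqrtr_gt0 mulrn_wgt0// pi_gt0.
  have -> : 4 * Num.sqrt 2 * ((Num.sqrt 2)^-1 * (Num.sqrt (pi *+ 2))^-1 * expR (- x ^+ 2 / (2 *+ 2)))
     = (Num.sqrt (pi *+ 2))^-1 * (4 * expR (- x ^+ 2 / (2 *+ 2))) :> R.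
    by field; rewrite s0 gt_eqF.
  rewrite mulrCA; apply: ler_wpM2l; first by rewrite invr_ge0 ltW.
  have -> : - x ^+ 2 / (1 *+ 2) = - x ^+ 2 / (2 *+ 2) + - (x ^+ 2 / 4) :> R by field.
  rewrite expRD mulrCA [leRHS]mulrC; apply: ler_wpM2l; first exact: expR_ge0.
  rewrite expRN ler_pdivrMr ?expR_gt0//.
  have := expR_ge1Dx (x ^+ 2 / 4); lra.
- under eq_fun do rewrite EFinM.
  by apply: integrableZl => //; exact: integrable_normal_pdf.
Qed.

(** The integrand times the density is [c] times the density of standard deviation
    [c = (1 + v) ^ (- 1 / 2)]. This explicit value lets [psiE] compare the cosine with
    [expR (- (v * x ^+ 2 / 2))], so that only the integrability of [x ^+ 2] is required and not the
    value of its integral. *)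
Lemma Ex_expR_normal (v : R) : 0 <= v ->
  Ex N01 (fun x => expR (- (v * x ^+ 2 / 2))) = (Num.sqrt (1 + v))^-1.
Proof.
move=> v0.
have v1 : 0 < 1 + v by rewrite ltr_pwDl.
have be : bmeas (fun x : measurableTypeR R => expR (- (v * x ^+ 2 / 2)) : R).
  split.
    apply: (measurableT_comp (@measurable_expR R)).
    under eq_fun do rewrite -mulN1r.
    apply: measurable_funM => //; apply: measurable_funM => //.
    by apply: measurable_funM => //; exact: measurable_funX.
  exists 1 => x; rewrite ger0_norm ?expR_ge0// -expR0 ler_expR oppr_le0.
  by rewrite divr_ge0// mulr_ge0// sqr_ge0.
rewrite Ex_normal//.
pose c : R := (Num.sqrt (1 + v))^-1.
have c0 : 0 < c by rewrite invr_gt0 sqrtr_gt0.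
have -> : (fun x => expR (- (v * x ^+ 2 / 2)) * normal_pdf 0 1 x) =
    (fun x => c * normal_pdf 0 c x).
  apply/funext => x; rewrite !normal_pdfE ?oner_eq0 ?gt_eqF//.
  rewrite /normal_peak /normal_fun !subr0 expr1n mul1r mulrCA -expRD.
  have c2 : c ^+ 2 = (1 + v)^-1 by rewrite /c exprVn sqr_sqrtr// ltW.
  have -> : c * ((Num.sqrt (c ^+ 2 * pi *+ 2))^-1 * expR (- x ^+ 2 / (c ^+ 2 *+ 2))) =
      (Num.sqrt (pi *+ 2))^-1 * expR (- x ^+ 2 / (c ^+ 2 *+ 2)).
    rewrite mulrA -mulrnAr (sqrtrM _ (sqr_ge0 _)) sqrtr_sqr gtr0_norm// invfM mulrA.
    by rewrite mulfV ?mul1r// gt_eqF.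
  by congr (_ * expR _); rewrite c2; field; rewrite gt_eqF.
rewrite RintegralZl//; last exact: integrable_normal_pdf.
by rewrite /Rintegral integral_normal_pdf/= mulr1.
Qed.

End gaussian_charfun.

Section gaussian_charfun_value.
Context {R : realType}.
Local Notation mu := (@lebesgue_measure R).
Local Notation N01 := (normal_prob 0 1 : probability (measurableTypeR R) R).

Lemma norm_subXn_le (x y : R) n : `|x| <= 1 -> `|y| <= 1 ->
  `|x ^+ n - y ^+ n| <= n%:R * `|x - y|.
Proof.
move=> x1 y1; elim: n => [|n ih]; first by rewrite !expr0 subrr normr0 mul0r.
have -> : x ^+ n.+1 - y ^+ n.+1 = x * (x ^+ n - y ^+ n) + (x - y) * y ^+ n.
  by rewrite !exprS; ring.
rewrite (le_trans (ler_normD _ _))// !normrM -natr1 mulrDl mul1r; apply: lerD.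
  by apply: le_trans ih; rewrite ler_piMl.
by rewrite ler_piMr// normrX exprn_ile1.
Qed.

(** Write [A] and [B] for the two terms. Then [A ^+ 2 <= 1 - v + v ^+ 2] and [1 - v <= B ^+ 2],
    while [0 < B <= A] gives [A * (A - B) <= A ^+ 2 - B ^+ 2 <= v ^+ 2]. *)
Lemma invsqrt_sub_expR (v : R) : 0 <= v ->
  `|(Num.sqrt (1 + v))^-1 - expR (- (v / 2))| <= v ^+ 2 * Num.sqrt (1 + v).
Proof.
move=> v0; have v1 : 0 < 1 + v by rewrite ltr_pwDl.
set s := Num.sqrt (1 + v); have s0 : 0 < s by rewrite sqrtr_gt0.
have s2 : s ^+ 2 = 1 + v by rewrite sqr_sqrtr// ltW.
set B := expR _; have B0 : 0 < B by exact: expR_gt0.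
have B2 : B ^+ 2 = expR (- v).
  by rewrite /B -expRM_natl; congr expR; field.
have lo : 1 - v <= B ^+ 2 by rewrite B2; have := expR_ge1Dx (- v).
have up : B ^+ 2 <= (s^-1) ^+ 2.
  rewrite B2 exprVn s2 expRN lef_pV2 ?posrE ?expR_gt0//; exact: expR_ge1Dx.
have BA : B <= s^-1.
  by move: up; rewrite ler_pXn2r// nnegrE ?invr_ge0 ltW.
rewrite ger0_norm ?subr_ge0//.
have A2 : (s^-1) ^+ 2 <= 1 - v + v ^+ 2.
  rewrite exprVn s2 -[leLHS]mul1r ler_pdivrMr//.
  have : 0 <= v ^+ 3 by rewrite exprn_ge0.
  by rewrite !exprS expr0; lra.
have AA : s^-1 * (s^-1 - B) <= v ^+ 2.
  have : s^-1 * (s^-1 - B) <= (s^-1) ^+ 2 - B ^+ 2.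
    by rewrite mulrBr -expr2 lerD2l lerN2 expr2 ler_wpM2r// ltW.
  by lra.
by rewrite -ler_pdivrMr// mulrC.
Qed.

(** Both sides are [2 ^ k]-th powers of their values at [s / sqrt (2 ^ k)]. With [n = 2 ^ k], those
    values differ by [o(1 / n)], and the [n]-th powers of numbers of modulus at most 1 by at most
    [n] times as much. *)
Lemma psiE (s : R) : psi s = expR (- (s ^+ 2 / 2)).
Proof.
pose rsq n : R := (Num.sqrt n%:R)^-1.
have rsqE n : (0 < n)%N -> n%:R * rsq n ^+ 2 = 1.
  by move=> n0; rewrite /rsq exprVn sqr_sqrtr// mulfV// pnatr_eq0 -lt0n.
have be v : 0 <= v -> bmeas (fun x : measurableTypeR R => expR (- (v * x ^+ 2 / 2)) : R).
  move=> v0; split.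
    apply: (measurableT_comp (@measurable_expR R)).
    under eq_fun do rewrite -mulN1r.
    apply: measurable_funM => //; apply: measurable_funM => //.
    by apply: measurable_funM => //; exact: measurable_funX.
  exists 1 => x; rewrite ger0_norm ?expR_ge0// -expR0 ler_expR oppr_le0.
  by rewrite divr_ge0// mulr_ge0// sqr_ge0.
have rs20 n : 0 <= (rsq n * s) ^+ 2 by exact: sqr_ge0.
pose u n x : R := n%:R * (cos (rsq n * s * x) - expR (- ((rsq n * s) ^+ 2 * x ^+ 2 / 2))).
have bu n : bmeas (u n : measurableTypeR R -> R).
  by apply: bmeasZ; apply: bmeasB; [exact: bmeas_cosR0|exact: be].
have u0 : Ex N01 (u n) @[n --> \oo] --> 0.
  have -> : (fun n => Ex N01 (u n)) = (fun n => \int[mu]_x (u n x * normal_pdf 0 1 x)).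
    by apply/funext => n; rewrite (Ex_normal _ _ (bu n)).
  have H : (\int[mu]_x (u n x * normal_pdf 0 1 x)%:E @[n --> \oo] -->
            \int[mu]_x (cst 0%E x))%E.
    apply: (@dominated_cvg _ _ _ mu setT measurableT _ _
      (fun x => (s ^+ 2 * (x ^+ 2 * normal_pdf 0 1 x))%:E)).
    - move=> n; apply/measurable_EFinP; apply: measurable_funM; last exact: measurable_normal_pdf.
      by case: (bu n).
    - move=> x _; apply: cvg_EFin; first exact: nearW.
      rewrite -[X in _ --> X](mul0r (normal_pdf 0 1 x)).
      apply: cvgM; last exact: cvg_cst.
      apply: (@cvg0_le_divn _ _ ((s * x) ^+ 4)) => n n0.
      rewrite /u normrM ger0_norm//.
      set y := rsq n * s * x.
      have -> : (rsq n * s) ^+ 2 * x ^+ 2 / 2 = y ^+ 2 / 2 by rewrite /y; ring.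
      have y20 : 0 <= y ^+ 2 / 2 by rewrite divr_ge0// sqr_ge0.
      have ub : `|cos y - expR (- (y ^+ 2 / 2))| <= y ^+ 4.
        have -> : cos y - expR (- (y ^+ 2 / 2)) = (cos y - 1 + y ^+ 2 / 2) -
          (expR (- (y ^+ 2 / 2)) - 1 + y ^+ 2 / 2) by ring.
        rewrite (le_trans (ler_normB _ _))//.
        have := norm_cos_sub_taylor2 y; have := expR_taylor1 y20.
        have -> : (y ^+ 2 / 2) ^+ 2 = y ^+ 4 / 4 by field.
        have : 0 <= y ^+ 4 by rewrite exprn_even_ge0.
        by lra.
      rewrite (le_trans (ler_wpM2l (ler0n _ _) ub))//.
      have -> : n%:R * y ^+ 4 = (n%:R * rsq n ^+ 2) * rsq n ^+ 2 * (s * x) ^+ 4.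
        by rewrite /y; ring.
      by rewrite rsqE// mul1r mulrC /rsq exprVn sqr_sqrtr.
    - by [].
    - under eq_fun do rewrite EFinM.
      by apply: integrableZl => //; exact: integrable_sqr_normal_pdf.
    - move=> [|n] x _; rewrite lee_fin.
        rewrite /u !mul0r normr0; apply: mulr_ge0; first exact: sqr_ge0.
        by rewrite mulr_ge0 ?sqr_ge0 ?normal_pdf_ge0.
      rewrite normrM (ger0_norm (normal_pdf_ge0 _ _ _)) mulrA ler_wpM2r ?normal_pdf_ge0//.
      rewrite /u normrM ger0_norm//.
      set y := rsq n.+1 * s * x.
      have -> : (rsq n.+1 * s) ^+ 2 * x ^+ 2 / 2 = y ^+ 2 / 2 by rewrite /y; ring.
      have y20 : 0 <= y ^+ 2 / 2 by rewrite divr_ge0// sqr_ge0.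
      have ub : `|cos y - expR (- (y ^+ 2 / 2))| <= y ^+ 2.
        have -> : cos y - expR (- (y ^+ 2 / 2)) = (cos y - 1) -
          (expR (- (y ^+ 2 / 2)) - 1) by ring.
        rewrite (le_trans (ler_normB _ _))//.
        have := norm_cos_sub1 y; have := expR_ge1Dx (- (y ^+ 2 / 2)).
        have e1 : expR (- (y ^+ 2 / 2)) <= 1 by rewrite -[leRHS]expR0 ler_expR oppr_le0.
        by rewrite [`|expR _ - 1|]ler0_norm ?subr_le0//; lra.
      rewrite (le_trans (ler_wpM2l (ler0n _ _) ub))//.
      have -> : n.+1%:R * y ^+ 2 = (n.+1%:R * rsq n.+1 ^+ 2) * (s ^+ 2 * x ^+ 2).
        by rewrite /y; ring.
      by rewrite rsqE// mul1r.
  by move: H; rewrite integral_cst// mul0e => H; exact: (fine_cvg H).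
pose v n : R := n%:R * ((Num.sqrt (1 + (rsq n * s) ^+ 2))^-1 - expR (- ((rsq n * s) ^+ 2 / 2))).
have v0 : v n @[n --> \oo] --> 0.
  apply: (@cvg0_le_divn _ _ (s ^+ 4 * Num.sqrt (1 + s ^+ 2))) => n n0.
  rewrite /v normrM ger0_norm//.
  rewrite (le_trans (ler_wpM2l (ler0n _ _) (invsqrt_sub_expR (rs20 n))))//.
  have r1 : rsq n ^+ 2 = n%:R^-1 by rewrite /rsq exprVn sqr_sqrtr.
  have -> : n%:R * ((rsq n * s) ^+ 2 ^+ 2 * Num.sqrt (1 + (rsq n * s) ^+ 2)) =
    (n%:R * rsq n ^+ 2) * rsq n ^+ 2 * (s ^+ 4 * Num.sqrt (1 + (rsq n * s) ^+ 2)).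
    by ring.
  rewrite rsqE// mul1r r1 mulrC ler_wpM2r ?invr_ge0//.
  rewrite ler_wpM2l ?exprn_even_ge0// ler_wsqrtr// lerD2l exprMn r1.
  by rewrite ler_piMl ?sqr_ge0// invf_le1 ?ltr0n// ler1n.
have w0 : Ex N01 (u n) + v n @[n --> \oo] --> 0.
  rewrite -[X in _ --> X](addr0 (0 : R)).
  exact: (cvgD u0 v0).
apply/eqP; rewrite -subr_eq0 -normr_le0; apply/ler_addgt0Pr => e e0; rewrite add0r.
move/cvgr0Pnorm_le : w0 => /(_ e e0) [n0 _ hn].
(* A power of 2, so that [psi_pow] applies, and at least [n0]. *)
set N := (2 ^ n0)%N.
have N0 : (0 < N)%N by rewrite expn_gt0.
have := hn N => /= /(_ (ltnW (ltn_expl n0 (ltnSn 1)))).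
rewrite /u (ExZ _ (bmeas_Lint N01 (bmeasB (bmeas_cosR0 _) (be _ (rs20 _))))).
rewrite (ExB (bmeas_Lint N01 (bmeas_cosR0 _)) (bmeas_Lint N01 (be _ (rs20 _)))).
rewrite Ex_expR_normal// -/(psi (rsq N * s)) /v -mulrDr addrA subrK => hN.
rewrite (psi_pow n0 s) -/N -/(rsq N).
have -> : expR (- (s ^+ 2 / 2)) = expR (- ((rsq N * s) ^+ 2 / 2)) ^+ N.
  rewrite -expRM_natl; congr expR.
  have -> : N%:R * - ((rsq N * s) ^+ 2 / 2) = - ((N%:R * rsq N ^+ 2) * s ^+ 2 / 2) by ring.
  by rewrite rsqE// mul1r.
apply: le_trans (norm_subXn_le N _ _) _.
- by apply: Ex_norm_le => [|x]; [exact: bmeas_cosR0|exact: cos_max].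
- rewrite ger0_norm ?expR_ge0// -expR0 ler_expR oppr_le0 divr_ge0//.
- by move: hN; rewrite normrM normr_nat.
Qed.

Lemma Ex_cos_normal_law d (T : measurableType d) (Q : probability T R) (Z : T -> R) (v c : R) :
  measurable_fun setT Z -> 0 <= v ->
  (forall B, measurable B -> Q (Z @^-1` B) = normal_law 0 v B) ->
  Ex Q (fun w => cos (Z w + c)) = expR (- v / 2) * cos c.
Proof.
move=> mZ v0 law.
have bc : bmeas (fun y : measurableTypeR R => cos (y + c) : R).
  by apply: bmeas_cos; exact: measurable_funD.
rewrite (@Ex_law _ _ _ _ _ Q N01 Z (fun x => Num.sqrt v * x) (fun y => cos (y + c)))//; last 2 first.
- exact: measurable_mul.
- move=> B mB; have e1 := normal_prob_scale_all (Num.sqrt v) mB.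
  by rewrite sqr_sqrtr// -(law _ mB) in e1.
have -> : (fun x : measurableTypeR R => cos (Num.sqrt v * x + c)) =
    (fun x => cos c * cos (Num.sqrt v * x) - sin c * sin (Num.sqrt v * x)).
  by apply/funext => x; rewrite cosD; ring.
rewrite (ExB (bmeas_Lint N01 (bmeasZ _ (bmeas_cosR0 _))) (bmeas_Lint N01 (bmeasZ _ (bmeas_sinR _)))).
rewrite (ExZ _ (bmeas_Lint N01 (bmeas_cosR0 _))) (ExZ _ (bmeas_Lint N01 (bmeas_sinR _))).
rewrite Ex_sin_normal mulr0 subr0 -/(psi _) psiE sqr_sqrtr// mulrC mulNr//.
Qed.

End gaussian_charfun_value.

(** * Positive semidefinite forms as sums of squares *)

Section gram_decomposition.
Context {R : realType} {q : nat}.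
Implicit Types (S : 'M[R]_q) (t u x y : 'cV[R]_q).

Definition psd S := S^T = S /\ forall t, 0 <= (t^T *m S *m t) 0 0.

Let ev i : 'cV[R]_q := delta_mx i 0.

Lemma form_delta S i j : ((ev i)^T *m S *m ev j) 0 0 = S i j.
Proof. by rewrite trmx_delta -rowE -colE !mxE. Qed.

Lemma form_sym S x y : S^T = S -> (x^T *m S *m y) 0 0 = (y^T *m S *m x) 0 0.
Proof.
move=> sS; rewrite -[in RHS](trmxK x) -[in RHS]sS -mulmxA -trmx_mul -trmx_mul.
by rewrite [RHS]mxE mulmxA.
Qed.

Lemma form_subZ S x y (c : R) : S^T = S ->
  ((x - c *: y)^T *m S *m (x - c *: y)) 0 0 =
  (x^T *m S *m x) 0 0 - 2 * c * (x^T *m S *m y) 0 0 + c ^+ 2 * (y^T *m S *m y) 0 0.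
Proof.
move=> sS; have -> : (x - c *: y)^T = x^T - c *: y^T by rewrite linearB linearZ.
rewrite !mulmxBl !mulmxBr -!scalemxAl -!scalemxAr.
have := form_sym x y sS; move: ((x^T *m S *m y)) (y^T *m S *m x) => A B AB.
by rewrite !mxE AB; ring.
Qed.

Lemma psd_diag0 S i j : psd S -> S i i = 0 -> S j i = 0.
Proof.
move=> [sS pS] Sii; apply/eqP/negP => /negP Sij.
(* As [S i i = 0], the form is affine in the coefficient of [ev i]; this coefficient makes its value
   [- 1]. *)
have := pS (ev j - ((S j j + 1) / (2 * S j i)) *: ev i).
rewrite form_subZ// !form_delta Sii mulr0 addr0.
have -> : 2 * ((S j j + 1) / (2 * S j i)) * S j i = S j j + 1 by field.
by rewrite opprD addrA subrr add0r oppr_ge0 ler10.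
Qed.

(* Cholesky: subtracting from [S] the rank one form [u u^T] which clears a
   positive diagonal entry keeps [S] positive and all null diagonal entries null. *)
Lemma psd_sum_sqr S : psd S -> exists us : seq 'cV[R]_q,
  forall t, (t^T *m S *m t) 0 0 = \sum_(u <- us) ((u^T *m t) 0 0) ^+ 2.
Proof.
(* The induction is on the number of nonzero diagonal entries. *)
have [k] := ubnP #|[pred i | S i i != 0]|; elim: k S => // k ih S /ltnSE leS psdS.
have [sS pS] := psdS.
have [D0|] := pselect (forall i, S i i = 0).
  have -> : S = 0 by apply/matrixP => i j; rewrite (psd_diag0 _ psdS)// mxE.
  by exists [::] => t; rewrite big_nil mulmx0 mul0mx mxE.
move=> /existsNP[i /eqP Sii]; set s := S i i in Sii.
have s0 : 0 < s by rewrite lt_neqAle eq_sym Sii/= /s -form_delta.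
pose u : 'cV[R]_q := (Num.sqrt s)^-1 *: (S *m ev i).
have us t : ((u^T *m t) 0 0) ^+ 2 = s^-1 * ((t^T *m S *m ev i) 0 0) ^+ 2.
  have -> : (u^T *m t) 0 0 = (Num.sqrt s)^-1 * (t^T *m S *m ev i) 0 0.
    rewrite form_sym// /u linearZ/= trmx_mul sS -scalemxAl mxE//.
  by rewrite exprMn exprVn sqr_sqrtr// ltW.
pose S' := S - u *m u^T.
have S'E t : (t^T *m S' *m t) 0 0 = (t^T *m S *m t) 0 0 - ((u^T *m t) 0 0) ^+ 2.
  rewrite /S' mulmxBr mulmxBl mxE [in X in _ + X]mxE mulmxA -(mulmxA (t^T *m u)).
  congr (_ - _); rewrite mxE big_ord1 expr2; congr (_ * _).
  by rewrite -[u in LHS]trmxK -trmx_mul mxE.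
have psdS' : psd S'.
  split; first by rewrite /S' linearB/= sS trmx_mul trmxK.
  move=> t; rewrite S'E us.
  (* The minimiser of the form of [S] along direction [ev i]; the minimum is exactly the form of
     [S'] at [t]. *)
  have := pS (t - ((t^T *m S *m ev i) 0 0 / s) *: ev i).
  rewrite form_subZ// form_delta -/s.
  by move=> /le_trans; apply; rewrite le_eqVlt; apply/orP; left; apply/eqP; field.
have S'd j : S' j j = S j j - ((u^T *m ev j) 0 0) ^+ 2 by rewrite -!form_delta S'E.
have [|us' us'E] := ih S' _ psdS'.
  apply: leq_trans leS; apply: proper_card; apply/properP; split.
    apply/fintype.subsetP => j; rewrite !inE; apply: contraNneq => Sj.
    have := S'd j; have := psdS'.2 (ev j); rewrite form_delta Sj sub0r => + E.
    by rewrite E oppr_ge0 oppr_eq0 => H; rewrite eq_le H sqr_ge0.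
  exists i; rewrite !inE// S'd us form_delta -/s.
  by rewrite expr2 mulKf ?subrr ?eqxx.
exists (u :: us') => t; rewrite big_cons -us'E S'E addrC subrK//.
Qed.

End gram_decomposition.

Section mvnormal_existence.
Context {R : realType} {q : nat}.
Local Notation N01 := (normal_prob 0 1 : probability (measurableTypeR R) R).

Lemma exists_normal_sum_sqr (us : seq 'cV[R]_q) :
  exists nu : probability (borelV R q) R, forall (t : 'cV[R]_q) (B : set R), measurable B ->
    nu [set x : 'cV[R]_q | B ((t^T *m x) 0 0)] =
    normal_law 0 (\sum_(u <- us) ((u^T *m t) 0 0) ^+ 2) B.
Proof.
elim: us => [|u us [nu nuE]].
  exists (\d_(0 : borelV R q)) => t B mB; rewrite big_nil /normal_law eqxx.
  rewrite !diracE; congr (_%:R%:E); congr nat_of_bool.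
  by apply/idP/idP; rewrite !inE/= mulmx0 mxE.
pose Q : probability (measurableTypeR R * borelV R q)%type R := (N01 \x nu)%E.
pose X0 (z : measurableTypeR R * borelV R q) : borelV R q := (z.1 : R) *: u + (z.2 : 'cV[R]_q).
have mX0 : measurable_fun setT X0.
  apply: measurable_fun_cV => j.
  rewrite (_ : (fun w => _) = (fun w => (w.1 : R) * u j 0 + (w.2 : 'cV[R]_q) j 0)); last first.
    by apply/funext => w; rewrite !mxE.
  apply: measurable_funD; first exact: measurable_funM.
  exact: (measurableT_comp (measurable_coord j)).
pose X : {RV Q >-> borelV R q} := HB.pack X0 (isMeasurableFun.Build _ _ _ _ X0 mX0).
exists (distribution Q X) => t B mB.
set s2 := \sum_(v <- us) ((v^T *m t) 0 0) ^+ 2.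
have s20 : 0 <= s2 by apply: sumr_ge0 => v _; exact: sqr_ge0.
rewrite big_cons -/s2 -(normal_law_convolution _ s20 mB).
rewrite /distribution /pushforward /Q /=.
apply: eq_integral => g _ /=.
have -> : xsection (X @^-1` [set x : 'cV[R]_q | B ((t^T *m x) 0 0)]) g =
  [set x : 'cV[R]_q | ((fun y => (u^T *m t) 0 0 * g + y) @^-1` B) ((t^T *m x) 0 0)].
  have E x : (t^T *m X0 (g, x)) 0 0 = (u^T *m t) 0 0 * g + (t^T *m (x : 'cV[R]_q)) 0 0.
    rewrite /X0/= mulmxDr mxE -scalemxAr mxE mulrC; congr (_ * _ + _).
    by rewrite -[u in LHS]trmxK -trmx_mul mxE.
  by apply/seteqP; split => x; rewrite /xsection/= inE/= E.
have m' : measurable ((fun y : R => (u^T *m t) 0 0 * g + y) @^-1` B).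
  by rewrite -[X in measurable X]setTI; exact: (measurable_funD (measurable_cst _) (@measurable_id _ _ setT)).
exact: (nuE t _ m').
Qed.

Lemma exists_mvnormal (S : 'M[R]_q) : psd S ->
  exists nu : probability (borelV R q) R, is_mvnormal nu 0 S.
Proof.
move=> /psd_sum_sqr[us usE]; have [nu nuE] := exists_normal_sum_sqr us.
exists nu => t B mB; have e0 : (t^T *m (0 : 'cV[R]_q)) 0 0 = 0 by rewrite mulmx0 mxE.
by have e := nuE t B mB; rewrite -usE in e; rewrite e0.
Qed.

End mvnormal_existence.

(** * Stochastic order and the delta method *)

Section stochastic_order.
Context d (T : measurableType d) (R : realType) (P : probability T R).
Implicit Types u v : nat -> T -> R.

Lemma eq_oP u v : (forall n w, u n w = v n w) -> oP P u -> oP P v.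
Proof. by move=> uv; rewrite (_ : v = u)//; apply/funext => n; apply/funext => w. Qed.

Lemma near_oP u v : (\forall n \near \oo, forall w, u n w = v n w) -> oP P u -> oP P v.
Proof.
move=> uv uo e h e0 h0; apply: filterS2 uv (uo e h e0 h0) => n uv [A [mA PA uA]].
by exists A; split => // w /uA; rewrite uv.
Qed.

Lemma oP0 : oP P (fun _ _ => 0).
Proof.
move=> e h e0 h0; apply: nearW => n; exists set0; split => //.
  by rewrite measure0 lee_fin ltW.
by move=> w _; rewrite normr0 ltW.
Qed.

Lemma oP_OP u : oP P u -> OP P u.
Proof. by move=> uo e e0; exists 1; exact: uo. Qed.

Lemma oPD u v : oP P u -> oP P v -> oP P (fun n w => u n w + v n w).
Proof.
move=> uo vo e h e0 h0.
have e20 : 0 < e / 2 by rewrite divr_gt0.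
have h20 : 0 < h / 2 by rewrite divr_gt0.
apply: filterS2 (uo _ _ e20 h20) (vo _ _ e20 h20) => n [A [mA PA uA]] [B [mB PB vB]].
exists (A `|` B); split; first exact: measurableU.
  by rewrite [e]splitr; exact: le_measureU2.
move=> w /not_orP[Aw Bw]; rewrite (le_trans (ler_normD _ _))// [h]splitr.
by apply: lerD; [exact: uA|exact: vB].
Qed.

Lemma OPD u v : OP P u -> OP P v -> OP P (fun n w => u n w + v n w).
Proof.
move=> uo vo e e0.
have e20 : 0 < e / 2 by rewrite divr_gt0.
have [K hK] := uo _ e20; have [L hL] := vo _ e20; exists (K + L).
apply: filterS2 hK hL => n [A [mA PA uA]] [B [mB PB vB]].
exists (A `|` B); split; first exact: measurableU.
  by rewrite [e]splitr; exact: le_measureU2.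
move=> w /not_orP[Aw Bw]; rewrite (le_trans (ler_normD _ _))//.
by apply: lerD; [exact: uA|exact: vB].
Qed.

Lemma OPM u v : OP P u -> OP P v -> OP P (fun n w => u n w * v n w).
Proof.
move=> uo vo e e0.
have e20 : 0 < e / 2 by rewrite divr_gt0.
have [K hK] := uo _ e20; have [L hL] := vo _ e20; exists (K * L).
apply: filterS2 hK hL => n [A [mA PA uA]] [B [mB PB vB]].
exists (A `|` B); split; first exact: measurableU.
  by rewrite [e]splitr; exact: le_measureU2.
move=> w /not_orP[Aw Bw]; rewrite normrM.
by apply: ler_pM => //; [exact: uA|exact: vB].
Qed.

Lemma OP_const (c : R) : OP P (fun _ _ => c).
Proof.
move=> e e0; exists `|c|; apply: nearW => n; exists set0; split => //.
by rewrite measure0 lee_fin ltW.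
Qed.

Lemma oPM u v : OP P u -> oP P v -> oP P (fun n w => u n w * v n w).
Proof.
move=> uo vo e h e0 h0.
have e20 : 0 < e / 2 by rewrite divr_gt0.
have [K hK] := uo _ e20; pose L := `|K| + 1; have L0 : 0 < L by rewrite ltr_wpDl.
have h20 : 0 < h / L by rewrite divr_gt0.
apply: filterS2 hK (vo _ _ e20 h20) => n [A [mA PA uA]] [B [mB PB vB]].
exists (A `|` B); split; first exact: measurableU.
  by rewrite [e]splitr; exact: le_measureU2.
move=> w /not_orP[Aw Bw]; rewrite normrM -[h](divfK (lt0r_neq0 L0)) mulrC.
apply: ler_pM => //; [exact: vB|apply: le_trans (uA _ Aw) _].
by rewrite (le_trans (ler_norm _))// lerDl.
Qed.

Lemma oP_cvg0 (c : nat -> R) : c n @[n --> \oo] --> 0 -> oP P (fun n _ => c n).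
Proof.
move=> /cvgr0Pnorm_le c0 e h e0 h0; apply: filterS (c0 h h0) => n cn.
by exists set0; split => //; rewrite measure0 lee_fin ltW.
Qed.

Lemma oPZ (c : R) u : oP P u -> oP P (fun n w => c * u n w).
Proof. by move=> uo; apply: oPM => //; exact: OP_const. Qed.

Lemma OPZ (c : R) u : OP P u -> OP P (fun n w => c * u n w).
Proof. by move=> uo; apply: OPM => //; exact: OP_const. Qed.

Lemma oPB u v : oP P u -> oP P v -> oP P (fun n w => u n w - v n w).
Proof.
move=> uo vo; apply: eq_oP (oPD uo (oPZ (-1) vo)) => n w; by rewrite mulN1r.
Qed.

Lemma oP_sum (I : Type) (s : seq I) (F : I -> nat -> T -> R) :
  (forall i, oP P (F i)) -> oP P (fun n w => \sum_(i <- s) F i n w).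
Proof.
move=> FO; elim: s => [|i s ih]; first by apply: eq_oP oP0 => n w; rewrite big_nil.
by apply: eq_oP (oPD (FO i) ih) => n w; rewrite big_cons.
Qed.

Lemma OP_sum (I : Type) (s : seq I) (F : I -> nat -> T -> R) :
  (forall i, OP P (F i)) -> OP P (fun n w => \sum_(i <- s) F i n w).
Proof.
move=> FO; elim: s => [|i s ih].
  rewrite (_ : (fun n w => _) = fun _ _ => 0); first exact: OP_const.
  by apply/funext => n; apply/funext => w; rewrite big_nil.
rewrite (_ : (fun n w => _) = fun n w => F i n w + \sum_(j <- s) F j n w).
  exact: OPD.
by apply/funext => n; apply/funext => w; rewrite big_cons.
Qed.

Lemma OP_comp u (n : nat -> nat) : n m @[m --> \oo] --> \oo -> OP P u ->
  OP P (fun m => u (n m)).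
Proof. by move=> ninf uO e e0; have [K hK] := uO e e0; exists K; exact: (ninf _ hK). Qed.

Lemma oP_comp u (n : nat -> nat) : n m @[m --> \oo] --> \oo -> oP P u ->
  oP P (fun m => u (n m)).
Proof. by move=> ninf uo e h e0 h0; exact: ninf (uo e h e0 h0). Qed.

Lemma cvg_invsqrtn : (Num.sqrt n%:R : R)^-1 @[n --> \oo] --> 0.
Proof.
apply/cvgr0Pnorm_le => e e0; exists (Num.truncn (e ^- 2)).+1 => // n /= hn.
have n0 : (0 < n)%N by exact: leq_trans hn.
have sn0 : 0 < Num.sqrt n%:R :> R by rewrite sqrtr_gt0 ltr0n.
rewrite gtr0_norm ?invr_gt0// -[leRHS]invrK lef_pV2 ?posrE ?invr_gt0//.
rewrite -[leLHS]gtr0_norm ?invr_gt0// -sqrtr_sqr ler_wsqrtr// exprVn ltW//.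
by rewrite (lt_le_trans (truncnS_gt _))// ler_nat.
Qed.

(* [X n = x + A n / sqrt n + o_P(1 / sqrt n)] with [A n = O_P(1)]. *)
Definition lin (X : nat -> T -> R) (x : R) (A : nat -> T -> R) :=
  OP P A /\ oP P (fun n w => Num.sqrt n%:R * (X n w - x) - A n w).

Lemma lin_OP X x A : lin X x A -> OP P (fun n w => Num.sqrt n%:R * (X n w - x)).
Proof.
move=> [hA /oP_OP hX].
rewrite (_ : (fun n w => _) = (fun n w => (Num.sqrt n%:R * (X n w - x) - A n w) + A n w)).
  exact: OPD.
by apply/funext => n; apply/funext => w; rewrite subrK.
Qed.

Lemma linM X x A Y y B : lin X x A -> lin Y y B ->
  lin (fun n w => X n w * Y n w) (x * y) (fun n w => y * A n w + x * B n w).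
Proof.
move=> hX hY; have hx := lin_OP hX; have hy := lin_OP hY.
move: hX hY => [OA oA] [OB oB]; split; first by apply: OPD; exact: OPZ.
(* The second order term [sqrt n * (X - x) * (Y - y)], a product of two [O_P(1)] factors over
   [sqrt n]. *)
have o1 := oPM (OPM hx hy) (oP_cvg0 cvg_invsqrtn).
apply: near_oP (oPD (oPD (oPZ y oA) (oPZ x oB)) o1).
exists 1%N => // n /= n0 w.
have sn0 : Num.sqrt n%:R != 0 :> R by rewrite gt_eqF// sqrtr_gt0 ltr0n.
by move: (X n w) (Y n w) => X' Y'; field.
Qed.

(** The delta method: near [x] the remainder is at most [eta * |X - x|], and [sqrt n * |X - x|] is
    bounded in probability, so [X] is eventually near [x] and [sqrt n] times the remainder is small.
    Differentiability at the single point [x] suffices. *)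
Lemma lin_comp X (x : R) A (f : R -> R) (f' : R) : is_derive x 1 f f' -> lin X x A ->
  lin (fun n w => f (X n w)) (f x) (fun n w => f' * A n w).
Proof.
move=> df hX; have hx := lin_OP hX; case: hX => OA oA; split; first exact: OPZ.
suff H : oP P (fun n w => Num.sqrt n%:R * (f (X n w) - f x) -
    f' * (Num.sqrt n%:R * (X n w - x))).
  by apply: eq_oP (oPD H (oPZ f' oA)) => n w; ring.
have cf : (h^-1 * (f (h + x) - f x)) @[h --> 0^'] --> f'.
  have [dv <-] := df; have := dv; rewrite /derivable /derive => /cvg_ex[l hl].
  have E : (fun h : R => h^-1 *: ((f \o shift x) (h *: 1) - f x)) =
           (fun h => h^-1 * (f (h + x) - f x)).
    by apply/funext => h /=; rewrite -[h *: 1]/(h * 1) mulr1.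
  by rewrite E in hl *; rewrite (cvg_lim (@Rhausdorff R) hl).
have fdiff eta : 0 < eta -> exists2 del : R, 0 < del & forall y, `|y - x| < del ->
    `|f y - f x - f' * (y - x)| <= eta * `|y - x|.
  move=> eta0; move/cvgrPdist_le : cf => /(_ eta eta0) [del /= del0 hdel].
  exists del => // y ydel; have [->|yx] := eqVneq y x.
    by rewrite !subrr mulr0 subr0 normr0 mulr0.
  have h0 : y - x != 0 by rewrite subr_eq0.
  have := hdel (y - x); rewrite /ball_/= sub0r normrN subrK => /(_ ydel h0).
  rewrite -ler_pdivrMr ?normr_gt0// -normfV -normrM distrC.
  by congr (`|_| <= _); field.
move=> e h e0 h0; have [K hK] := hx e e0.
pose L := `|K| + 1; have L0 : 0 < L by rewrite ltr_wpDl.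
(* Off the exceptional event [sqrt n * |X - x| <= L], so the slope [h / L] yields the tolerance
   [h]. *)
have [del del0 hdel] := fdiff (h / L) (divr_gt0 h0 L0).
have s0 : \forall n \near \oo, `|(Num.sqrt n%:R : R)^-1| < del / L.
  by move/cvgr0Pnorm_lt : cvg_invsqrtn => /(_ _ (divr_gt0 del0 L0)).
have n1 : \forall n \near \oo, (1 <= n)%N by exists 1%N.
apply: filterS3 hK s0 n1 => n [A' [mA PA xA]] sn n0; exists A'; split => // w Aw.
have sn0 : 0 < Num.sqrt n%:R :> R by rewrite sqrtr_gt0 ltr0n.
have xL : Num.sqrt n%:R * `|X n w - x| <= L.
  have := xA _ Aw; rewrite normrM gtr0_norm// => /le_trans; apply.
  by rewrite (le_trans (ler_norm _))// lerDl.
have xdel : `|X n w - x| < del.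
  have -> : `|X n w - x| = (Num.sqrt n%:R)^-1 * (Num.sqrt n%:R * `|X n w - x|).
    by rewrite mulKf// gt_eqF.
  rewrite gtr0_norm ?invr_gt0// ltr_pdivlMr// in sn.
  by apply: le_lt_trans sn; rewrite ler_wpM2l// invr_ge0 ltW.
rewrite (_ : _ - _ = Num.sqrt n%:R * (f (X n w) - f x - f' * (X n w - x))); last by ring.
rewrite normrM gtr0_norm//.
apply: (le_trans (ler_wpM2l (ltW sn0) (hdel _ xdel))).
rewrite mulrCA -[leRHS](divfK (lt0r_neq0 L0)).
by rewrite ler_wpM2l// divr_ge0// ltW.
Qed.

End stochastic_order.

Section inverse_square_root.
Context {R : realType}.

Lemma measurable_sqrt : measurable_fun setT (@Num.sqrt R).
Proof. by apply: continuous_measurable_fun; exact: sqrt_continuous. Qed.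

Lemma measurable_invsqrt : measurable_fun setT (fun x : R => (Num.sqrt x)^-1).
Proof.
have -> : (fun x : R => (Num.sqrt x)^-1) = (fun y => y `^ (-1)) \o @Num.sqrt R.
  by apply/funext => x /=; rewrite powR_inv1// sqrtr_ge0.
by apply: measurableT_comp; [exact: measurable_powR|exact: measurable_sqrt].
Qed.

Lemma is_derive_invsqrt (y : R) : 0 < y ->
  is_derive y 1 (fun x : R => (Num.sqrt x)^-1) (- (2 * y * Num.sqrt y)^-1).
Proof.
move=> y0; have s0 : Num.sqrt y != 0 :> R by rewrite gt_eqF// sqrtr_gt0.
have := is_deriveV s0 (is_derive1_sqrt y0); congr (is_derive _ _ _ _).
rewrite -[X in _ = - (2 * X * _)^-1](sqr_sqrtr (ltW y0)) /GRing.scale/=.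
by field.
Qed.

End inverse_square_root.

Section oP1.
Context d (T : measurableType d) (R : realType) (P : probability T R) (q : nat).

Lemma oP_is_oP1 (Y : nat -> T -> 'cV[R]_q) :
  (forall n j, measurable_fun setT (fun w => Y n w j 0)) ->
  (forall j, oP P (fun n w => Y n w j 0)) -> is_oP1 P Y.
Proof.
move=> mY oY e e0.
have mE n : measurable [set w | e < enorm (Y n w)].
  have me : measurable_fun setT (fun w => enorm (Y n w)).
    apply: (measurableT_comp measurable_sqrt); apply: measurable_sum => j.
    exact: measurable_funX.
  have := me measurableT `]e, +oo[%classic (measurable_itv _).
  rewrite setTI; congr (measurable _); apply/seteqP.
  by split => w /=; rewrite in_itv/= andbT.
have EN n w : enorm (Y n w) <= \sum_(j < q) `|Y n w j 0|.
  have S0 : 0 <= \sum_(j < q) `|Y n w j 0| by apply: sumr_ge0.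
  rewrite -[leRHS]ger0_norm// -sqrtr_sqr ler_wsqrtr// expr2 mulr_suml.
  apply: ler_sum => j _; rewrite -real_normK ?num_real// expr2 ler_wpM2l//.
  by rewrite (bigD1 j)//= lerDl sumr_ge0.
have oN : oP P (fun n w => \sum_(j < q) `|Y n w j 0|).
  apply: oP_sum => j h h' hh hh'; apply: filterS (oY j h h' hh hh') => n [A [mA PA hA]].
  by exists A; split => // w /hA; rewrite normr_id.
apply/fine_cvgP; split.
  by apply: nearW => n; exact: fin_num_measure.
apply/cvgr0Pnorm_le => h h0; apply: filterS (oN h e h0 e0) => n [A [mA PA hA]] /=.
rewrite ger0_norm ?fine_ge0// -lee_fin fineK ?fin_num_measure//.
apply: le_trans PA; apply: le_measure; rewrite ?inE// => w /= eY.
apply: contrapT => /hA; rewrite leNgt => /negP; apply.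
by rewrite (lt_le_trans eY)// (le_trans (EN _ _))// ler_norm.
Qed.

Lemma Lint_expectation (f : T -> R) : measurable_fun setT f -> (forall w, 0 <= f w) ->
  ('E_P[f] < +oo)%E -> Lint P f.
Proof.
move=> mf f0; rewrite unlock => fi; apply/integrableP; split; first exact/measurable_EFinP.
rewrite (eq_integral (EFin \o f))// => w _ /=; by rewrite ger0_norm.
Qed.

(** Coordinates are bounded by the norm [N], so a squared product of two is at most [N ^+ 4], and a
    squared coordinate at most [N ^+ 2 <= 1 + N ^+ 4]. *)
Lemma L2_of_moment4 (Y : {RV P >-> borelV R q}) :
  ('E_P[(fun w => enorm (Y w : 'cV[R]_q) ^+ 4)%R] < +oo)%E ->
  (forall j, L2 P (fun w => (Y w : 'cV[R]_q) j 0)) /\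
  (forall j k, L2 P (fun w => (Y w : 'cV[R]_q) j 0 * (Y w : 'cV[R]_q) k 0)).
Proof.
move=> Y4.
have mY j : measurable_fun setT (fun w => (Y w : 'cV[R]_q) j 0).
  by apply: (measurableT_comp (measurable_coord j)).
pose N w := enorm (Y w : 'cV[R]_q).
have mN : measurable_fun setT N.
  apply: (measurableT_comp measurable_sqrt); apply: measurable_sum => j.
  exact: measurable_funX.
have N4 : Lint P (fun w => N w ^+ 4).
  apply: Lint_expectation => //; first exact: measurable_funX.
  by move=> w; rewrite exprn_ge0// sqrtr_ge0.
have YN w j : `|(Y w : 'cV[R]_q) j 0| <= N w.
  rewrite -sqrtr_sqr ler_wsqrtr// (bigD1 j)//= lerDl sumr_ge0// => i _.
  exact: sqr_ge0.
split=> [j|j k]; split => //; last 2 first.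
- exact: measurable_funM.
- apply: le_Lint N4 _; first by apply: measurable_funX; exact: measurable_funM.
  move=> w; rewrite exprMn normrM !normrX (exprD _ 2 2).
  by apply: ler_pM; rewrite ?exprn_ge0// lerXn2r ?nnegrE// (le_trans (normr_ge0 _) (YN w j)).
apply: (le_Lint (g := fun w => 1 + N w ^+ 4)).
- exact: measurable_funX.
- by apply: LintD => //; exact/bmeas_Lint/bmeas_cst.
- move=> w; rewrite normrX; have Y2 : `|(Y w : 'cV[R]_q) j 0| ^+ 2 <= N w ^+ 2.
    by rewrite lerXn2r ?nnegrE// (le_trans (normr_ge0 _) (YN w j)).
  apply: le_trans Y2 _; rewrite (exprM _ 2 2); have := sqr_ge0 (N w ^+ 2 - 1); have := sqr_ge0 (N w ^+ 2).
  by move: (N w ^+ 2) => z; nra.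
Qed.

End oP1.

Section sample_covariance.
Context {R : realType}.

(** The shifts [b] and [c] cancel against the means; this is how [mu] disappears from the empirical
    covariance. *)
Lemma sum_centered (u v : nat -> R) (b c : R) n : (0 < n)%N ->
  \sum_(k < n) (b + u k - n%:R^-1 * \sum_(l < n) (b + u l)) *
               (c + v k - n%:R^-1 * \sum_(l < n) (c + v l)) =
  \sum_(k < n) u k * v k - n%:R^-1 * (\sum_(k < n) u k) * (\sum_(k < n) v k).
Proof.
move=> n0; have nn0 : n%:R != 0 :> R by rewrite pnatr_eq0 -lt0n.
set U := \sum_(k < n) u k; set W := \sum_(k < n) v k.
have sb (z : R) (f : nat -> R) : \sum_(l < n) (z + f l) = n%:R * z + \sum_(l < n) f l.
  by rewrite big_split/= sumr_const card_ord mulr_natl.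
rewrite !sb -/U -/W.
rewrite (eq_bigr (fun k : 'I_n => (u k * v k - (n%:R^-1 * W) * u k) +
  (n%:R^-1 * n%:R^-1 * U * W - (n%:R^-1 * U) * v k))); last by move=> k _; field.
rewrite !big_split/= !sumrN -!mulr_sumr -/U -/W sumr_const card_ord -[W *+ n]mulr_natl.
by field.
Qed.

Lemma sample_covE d (b : 'cV[R]_d) (e : nat -> 'cV[R]_d) n j k : (0 < n)%N ->
  sample_cov (fun l => b + e l) n j k = (n%:R - 1)^-1 *
   (\sum_(l < n) e l j 0 * e l k 0 -
    n%:R^-1 * (\sum_(l < n) e l j 0) * (\sum_(l < n) e l k 0)).
Proof.
move=> n0; rewrite -(sum_centered (fun l => e l j 0) (fun l => e l k 0) (b j 0) (b k 0))//.
have sm i : sample_mean (fun l => b + e l) n i 0 = n%:R^-1 * \sum_(l < n) (b i 0 + e l i 0).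
  by rewrite mxE summxE; congr (_ * _); apply: eq_bigr => l _; rewrite mxE.
rewrite mxE summxE; congr (_ * _); apply: eq_bigr => l _.
by rewrite mxE big_ord1 [X in X * _]mxE [X in _ * X]mxE [X in _ * X]mxE !mxE -!sm !mxE.
Qed.

End sample_covariance.

(** * Positions in half-vectorizations *)

Section half_vectorization_positions.
Variable d : nat.
Local Notation I2 := ('I_d * 'I_d)%type.

Lemma filter_leq_iota j : (j <= d)%N -> [seq k <- iota 0 d | (j <= k)%N] = iota j (d - j).
Proof.
move=> jd; rewrite -{1}(subnKC jd) iotaD filter_cat add0n.
rewrite (eq_in_filter (a2 := pred0)) ?filter_pred0; last first.
  by move=> k; rewrite mem_iota add0n => /andP[_]; rewrite ltnNge => /negbTE.
rewrite (eq_in_filter (a2 := predT)) ?filter_predT// => k.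
by rewrite mem_iota => /andP[].
Qed.

Lemma val_filter_leq j : (j <= d)%N ->
  [seq val k | k <- [seq k : 'I_d <- enum 'I_d | (j <= k)%N]] = iota j (d - j).
Proof. by move=> jd; rewrite -(filter_leq_iota jd) -val_enum_ord filter_map. Qed.

Definition row_pairs (j : 'I_d) : seq I2 := [seq (j, k) | k : 'I_d <- enum 'I_d & (j <= k)%N].
Definition row_pairsm (j : 'I_d) : seq I2 := [seq (j, k) | k : 'I_d <- enum 'I_d & (j < k)%N].
Definition pairs : seq I2 := flatten [seq row_pairs j | j <- enum 'I_d].
Definition pairsm : seq I2 := flatten [seq row_pairsm j | j <- enum 'I_d].

Lemma size_row_pairs j : size (row_pairs j) = (d - j)%N.
Proof. by rewrite size_map -(size_map val) val_filter_leq ?size_iota// ltnW. Qed.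

Lemma size_row_pairsm j : size (row_pairsm j) = (d - j.+1)%N.
Proof. by rewrite size_map -(size_map val) val_filter_leq ?size_iota. Qed.

Lemma shape_pairs : shape [seq row_pairs j | j <- enum 'I_d] = [seq (d - j)%N | j <- iota 0 d].
Proof.
rewrite /shape -map_comp -val_enum_ord -[RHS]map_comp.
by apply: eq_map => j /=; rewrite size_row_pairs.
Qed.

Lemma sum_sub n : (\sum_(0 <= j < n) (n - j))%N = 'C(n.+1, 2).
Proof.
rewrite big_nat_rev/= -triangular_sum/= [RHS]big_nat_recl//= add0n.
by apply: eq_big_nat => j /andP[_ jn]; rewrite subKn.
Qed.

Lemma size_pairs : size pairs == dimp d.
Proof.
rewrite size_flatten shape_pairs sumnE big_map /dimp.
have := sum_sub d; rewrite /index_iota subn0 => ->.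
by rewrite bin2 -divn2 mulnC /= addn1.
Qed.

Lemma size_pairsm : size pairsm == dimpu d.
Proof.
rewrite size_flatten /shape -map_comp sumnE big_map /dimpu.
rewrite (eq_bigr (fun j : 'I_d => d - j.+1)%N); last by move=> j _ /=; rewrite size_row_pairsm.
rewrite -(big_map val xpredT (fun j => d - j.+1)%N) val_enum_ord.
have -> : (\sum_(j <- iota 0 d) (d - j.+1) = \sum_(0 <= j < d) j)%N.
  by rewrite [RHS]big_nat_rev/= /index_iota subn0; apply: eq_bigr => j _; rewrite add0n.
by rewrite triangular_sum bin2 -divn2 subn1.
Qed.

(** The entry (row, column) stored at position [l]. It reduces identities between
    half-vectorizations to identities between matrix entries. *)
Definition pairp (l : 'I_(dimp d)) : I2 := tnth (Tuple size_pairs) l.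
Definition pairpm (l : 'I_(dimpu d)) : I2 := tnth (Tuple size_pairsm) l.

Lemma vechE (U : nmodType) (A : 'M[U]_d) l : vech A l 0 = A (pairp l).1 (pairp l).2.
Proof.
rewrite mxE /pairp (tnth_nth (pairp l)) /=.
rewrite -(nth_map _ 0 (fun p => A p.1 p.2)) ?(eqP size_pairs)//.
rewrite /pairs map_flatten -map_comp; congr (nth _ (flatten _) _).
by apply: eq_map => j /=; rewrite -map_comp.
Qed.

Lemma vechmE (U : nmodType) (A : 'M[U]_d) l : vechm A l 0 = A (pairpm l).1 (pairpm l).2.
Proof.
rewrite mxE /pairpm (tnth_nth (pairpm l)) /=.
rewrite -(nth_map _ 0 (fun p => A p.1 p.2)) ?(eqP size_pairsm)//.
rewrite /pairsm map_flatten -map_comp; congr (nth _ (flatten _) _).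
by apply: eq_map => j /=; rewrite -map_comp.
Qed.

Lemma pairs_uniq : uniq pairs.
Proof.
rewrite /pairs; have := enum_uniq 'I_d; elim: (enum 'I_d) => //= j s ih /andP[js us].
rewrite cat_uniq ih// andbT; apply/andP; split.
  rewrite map_inj_uniq; last by move=> k k' [].
  exact/filter_uniq/enum_uniq.
apply/hasPn => -[j' k] /flatten_mapP[i si /mapP[k' _ [-> _]]].
by apply/negP => /mapP[k'' _ [ij _]]; rewrite -ij si in js.
Qed.

(** The number of entries in the rows above row [k], that is the 0-based position of the diagonal
    entry opening row [k]; [avec] is one more. *)
Definition diag_pos (k : nat) : nat := (\sum_(0 <= j < k) (d - j))%N.

Lemma avecE (k : 'I_d) : avec d 0 k = (diag_pos k).+1.
Proof.
rewrite mxE add1n big_add1/=; congr _.+1; apply: eq_big_nat => j _.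
by rewrite addn1 subSS.
Qed.

Lemma diag_posE (k : 'I_d) : flatten_index (shape [seq row_pairs j | j <- enum 'I_d]) k 0 = diag_pos k.
Proof.
rewrite /flatten_index addn0 shape_pairs -map_take take_iota sumnE big_map.
by rewrite /diag_pos /index_iota subn0 (minn_idPl (ltnW (ltn_ord k))).
Qed.

Lemma nth_shape_pairs (k : 'I_d) : (0 < nth 0 (shape [seq row_pairs j | j <- enum 'I_d]) k)%N.
Proof.
by rewrite shape_pairs (nth_map 0%N) ?size_iota// nth_iota// subn_gt0 add0n.
Qed.

Lemma diag_pos_lt (k : 'I_d) : (diag_pos k < dimp d)%N.
Proof.
rewrite -diag_posE -(eqP size_pairs) size_flatten; apply: flatten_indexP.
exact: nth_shape_pairs.
Qed.

Lemma nth_diag_pos x0 (k : 'I_d) : nth x0 pairs (diag_pos k) = (k, k).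
Proof.
rewrite -diag_posE nth_flatten flatten_indexKl ?nth_shape_pairs//.
rewrite flatten_indexKr ?nth_shape_pairs//.
rewrite (nth_map k) ?size_enum_ord// nth_ord_enum /row_pairs.
have := val_filter_leq (ltnW (ltn_ord k)).
have : (0 < d - k)%N by rewrite subn_gt0.
case: (d - k)%N => // m _ /=; case: [seq _ <- _ | _] => // k' s [kk' _].
by congr (_, _); exact/val_inj.
Qed.

Lemma pairp_diag_pos (k : 'I_d) : pairp (Ordinal (diag_pos_lt k)) = (k, k).
Proof. by rewrite /pairp (tnth_nth (k, k)) nth_diag_pos. Qed.

Lemma filter_offdiag_pairs : [seq p <- pairs | p.1 != p.2] = pairsm.
Proof.
rewrite /pairs filter_flatten -map_comp; congr flatten; apply: eq_map => j /=.
rewrite /row_pairs filter_map -filter_predI; congr map; apply: eq_filter => k /=.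
by rewrite ltn_neqAle.
Qed.

Lemma mem_avec x0 k : (k < dimp d)%N ->
  (k.+1 \in [seq avec d 0 j | j : 'I_d]) = ((nth x0 pairs k).1 == (nth x0 pairs k).2).
Proof.
move=> kd; apply/mapP/eqP => [[j _]|].
  by rewrite avecE => -[->]; rewrite nth_diag_pos.
case E : (nth x0 pairs k) => [i j] /= ij; rewrite -ij in E *; exists i; rewrite ?mem_enum//.
rewrite avecE; congr _.+1; apply/eqP.
rewrite -(nth_uniq x0 _ _ pairs_uniq) ?(eqP size_pairs) ?diag_pos_lt//.
by rewrite nth_diag_pos E.
Qed.

(** Deleting the diagonal positions from the enumeration of the upper triangle leaves the strict
    upper triangle in the same order, so the [l]-th remaining position holds the [l]-th strictly
    upper pair. The successor converts to 1-based positions. *)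
Lemma bvec_posP (l : 'I_(dimpu d)) :
  exists2 s : 'I_(dimp d), bvec d l 0 = s.+1 & pairp s = pairpm l.
Proof.
set x0 := pairpm l; rewrite mxE.
set b := [seq k <- _ | _].
have bE : [seq nth x0 pairs k.-1 | k <- b] = pairsm.
  rewrite -filter_offdiag_pairs -[in RHS](mkseq_nth x0 pairs) /mkseq filter_map (eqP size_pairs).
  have i1 : iota 1 (dimp d) = [seq k.+1 | k <- iota 0 (dimp d)] by rewrite -[1%N]/(1 + 0)%N iotaDl.
  rewrite /b i1 filter_map -map_comp.
  rewrite (eq_in_filter (a2 := preim (nth x0 pairs) (fun p => p.1 != p.2))).
    by apply: eq_map => k.
  by move=> k; rewrite mem_iota add0n => /andP[_ kd] /=; rewrite (mem_avec x0).
have sb : size b = dimpu d by rewrite -(eqP size_pairsm) -bE size_map.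
have lb : (l < size b)%N by rewrite sb.
have := mem_nth 0%N lb; rewrite mem_filter mem_iota add1n ltnS => /andP[_ /andP[b0 bd]].
have E : nth x0 pairs (nth 0%N b l).-1 = pairpm l.
  by rewrite -(nth_map 0%N x0 (fun k => nth x0 pairs k.-1))// bE /pairpm (tnth_nth x0).
have bd' : ((nth 0%N b l).-1 < dimp d)%N by rewrite prednK.
exists (Ordinal bd'); rewrite /= ?prednK//.
by rewrite /pairp (tnth_nth x0)/= E.
Qed.

Context {R : realType}.

Lemma stdb_mul q (s : 'I_q) (x : 'cV[R]_q) : ((stdb q s.+1)^T *m x) 0 0 = x s 0.
Proof.
rewrite mxE (bigD1 s)//= !mxE eqxx mul1r big1 ?addr0// => j js.
by rewrite !mxE eqSS (_ : (_ == _) = false) ?mul0r//; apply/negbTE.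
Qed.

Lemma sum_stdb_mul (u : 'I_(dimpu d) -> 'cV[R]_(dimp d)) (x : 'cV[R]_(dimp d)) l :
  ((\sum_(l < dimpu d) stdb (dimpu d) l.+1 *m (u l)^T) *m x) l 0 = ((u l)^T *m x) 0 0.
Proof.
rewrite mulmx_suml summxE (bigD1 l)//= -mulmxA mxE big_ord1 mxE eqxx mul1r.
rewrite big1 ?addr0// => k kl; rewrite -mulmxA mxE big_ord1 mxE eqSS.
by rewrite (_ : (_ == _) = false) ?mul0r//; apply/negbTE; rewrite eq_sym.
Qed.

Lemma diag_invsqrt_vech (W X : 'M[R]_d) : diag_invsqrt (vech W) *m vech X =
  vech (\matrix_(j, k) ((Num.sqrt (W j k))^-1 * X j k)).
Proof.
apply/matrixP => l c; rewrite ord1 /diag_invsqrt mul_diag_mx mxE [X in X * _]mxE.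
by rewrite !vechE mxE.
Qed.

(** When [r] holds the correlations, the right side is the derivative at [V], in the direction [X],
    of [V j k / sqrt (V j j * V k k)]: this is where the matrix of the theorem meets the delta
    method. *)
Lemma Mmx_vech (V X : 'M[R]_d) (r : 'cV[R]_(dimpu d)) l :
  let j := (pairpm l).1 in let k := (pairpm l).2 in
  (Mmx V r *m vech X) l 0 = (Num.sqrt (V j j * V k k))^-1 * X j k -
    2^-1 * (r l 0 * ((Num.sqrt (V j j * V j j))^-1 * X j j +
                     (Num.sqrt (V k k * V k k))^-1 * X k k)).
Proof.
move=> j k; rewrite /Mmx -mulmxA diag_invsqrt_vech.
set Z := (\matrix_(_, _) _).
have ZE i i' : Z i i' = (Num.sqrt (V i i * V i' i'))^-1 * X i i'.
  by rewrite !mxE big_ord1 !mxE.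
rewrite mulmxBl -scalemxAl -mulmxA mxE [in X in _ + X]mxE [in X in _ + X]mxE.
rewrite (mul_diag_mx _ _) [in X in _ * X]mxE sum_stdb_mul sum_stdb_mul.
have [s -> sl] := bvec_posP l; rewrite stdb_mul vechE sl -ZE.
rewrite linearD/= mulmxDl mxE.
(* All rows of [Hmx] equal [avec], so its entry [(j, k)] is the position of the diagonal entry [k];
   the transpose in [h2] gives that of [j]. *)
have -> : h1 d l 0 = (Ordinal (diag_pos_lt k)).+1.
  by rewrite /h1 vechmE mxE big_ord1 mxE mul1r -avecE.
have -> : h2 d l 0 = (Ordinal (diag_pos_lt j)).+1.
  by rewrite /h2 vechmE !mxE big_ord1 mxE mul1r -avecE.
rewrite -ZE [r^T _ _]mxE [X in _ * (_ * X)]mxE !stdb_mul !vechE !pairp_diag_pos -!ZE.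
by rewrite [Z k k + _]addrC ZE.
Qed.

End half_vectorization_positions.

(** * Empirical covariances and correlations *)

Section covariance_matrix.
Context d (T : measurableType d) (R : realType) (P : probability T R) (q : nat).

Lemma cov_mxE (Y : T -> 'cV[R]_q) j k : (forall j, L2 P (fun w => Y w j 0)) ->
  cov_mx P Y j k = Ex P (fun w => (Y w j 0 - Ex P (fun w => Y w j 0)) *
                                  (Y w k 0 - Ex P (fun w => Y w k 0))).
Proof.
move=> Y2; have Y1 i := L2_Lint (Y2 i).
rewrite mxE covariance.unlock.
have L2c i : L2 P (fun w => Y w i 0 - Ex P (fun w => Y w i 0)).
  by apply: (L2D (Y2 i) (L2_bmeas P (bmeas_cst T (- _)))).
rewrite -[RHS]/(fine (_%:E)) -expectationE; last exact: (L2M (L2c j) (L2c k)).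
congr (fine ('E_P[_])); apply/funext => w.
by rewrite !expectationE.
Qed.

End covariance_matrix.

Section linearization.
Context dT (T : measurableType dT) (R : realType) (P : probability T R) (d a : nat).
Variables (mu : 'I_a -> 'cV[R]_d) (eps : 'I_a -> nat -> {RV P >-> borelV R d}).
Local Notation Y := (fun ik : 'I_a * nat => eps ik.1 ik.2).
Hypothesis eps_indep : mutually_independent Y.
Hypothesis eps_ident : forall i k, identically_distributed (eps i k) (eps i 0%N).
Hypothesis eps_mean0 : forall i j, ('E_P[(fun w => (eps i 0%N w : 'cV[R]_d) j 0)%R] = 0)%E.
Hypothesis eps_moment4 : forall i,
  ('E_P[(fun w => enorm (eps i 0%N w : 'cV[R]_d) ^+ 4)%R] < +oo)%E.

Definition epsV (i : 'I_a) : 'M[R]_d := cov_mx P (eps i 0%N : T -> 'cV[R]_d).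
Local Notation V := epsV.
Hypothesis V_diag_gt0 : forall i j, 0 < V i j j.

Lemma L2_eps i j : L2 P (fun w => (eps i 0%N w : 'cV[R]_d) j 0).
Proof. by have [] := L2_of_moment4 (eps_moment4 i). Qed.

Lemma L2_eps2 i j k : L2 P (fun w => (eps i 0%N w : 'cV[R]_d) j 0 * (eps i 0%N w : 'cV[R]_d) k 0).
Proof. by have [] := L2_of_moment4 (eps_moment4 i). Qed.

Lemma Ex_eps i j : Ex P (fun w => (eps i 0%N w : 'cV[R]_d) j 0) = 0.
Proof.
by apply: EFin_inj; rewrite -expectationE ?eps_mean0//; exact: L2_Lint (L2_eps i j).
Qed.

Lemma epsVE i j k :
  V i j k = Ex P (fun w => (eps i 0%N w : 'cV[R]_d) j 0 * (eps i 0%N w : 'cV[R]_d) k 0).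
Proof.
rewrite /V cov_mxE; last exact: L2_eps.
by congr Ex; apply/funext => w; rewrite !Ex_eps !subr0.
Qed.

Definition prodc j k (i : 'I_a) (x : borelV R d) : R :=
  (x : 'cV[R]_d) j 0 * (x : 'cV[R]_d) k 0 - V i j k.

Lemma measurable_prodc j k i : measurable_fun setT (prodc j k i).
Proof.
by apply: measurable_funB => //; apply: measurable_funM; exact: measurable_coord.
Qed.

Lemma L2_prodc j k i : L2 P (fun w => prodc j k i (eps i 0%N w)).
Proof. exact: (L2D (L2_eps2 i j k) (L2_bmeas P (bmeas_cst T (- _)))). Qed.

Lemma Ex_prodc j k i : Ex P (fun w => prodc j k i (eps i 0%N w)) = 0.
Proof.
rewrite (ExB (L2_Lint (L2_eps2 i j k)) (bmeas_Lint P (bmeas_cst T (V i j k)))).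
by rewrite -epsVE Ex_cst subrr.
Qed.

(** The common leading term of the expansions: [n ^ (- 1 / 2)] times the sum of [eps eps^T - V],
    built from the true residuals and hence a sum of independent terms. *)
Definition Smx i n w : 'M[R]_d := \matrix_(j, k) nsum Y (prodc j k) i n w.

Lemma OP_Smx i j k : OP P (fun n w => Smx i n w j k).
Proof.
rewrite (_ : (fun n w => _) = nsum Y (prodc j k) i); last first.
  by apply/funext => n; apply/funext => w; rewrite mxE.
apply: (OP_nsum eps_indep eps_ident (measurable_prodc j k) (L2_prodc j k) (Ex_prodc j k)
  (s2 := fun i => Ex P (fun w => prodc j k i (eps i 0%N w) ^+ 2))) => //.
Qed.

Lemma OP_eps_sum i j : OP P (fun n w =>
  (Num.sqrt n%:R)^-1 * \sum_(l < n) (eps i l w : 'cV[R]_d) j 0).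
Proof.
by apply: (OP_nsum eps_indep eps_ident (fun i => @measurable_coord R d j)
  (L2_eps ^~ j) (Ex_eps ^~ j)
  (s2 := fun i => Ex P (fun w => (eps i 0%N w : 'cV[R]_d) j 0 ^+ 2))).
Qed.

Definition Vhat i n w : 'M[R]_d := sample_cov (fun k => mu i + eps i k w) n.

Lemma measurable_Vhat i n j k : measurable_fun setT (fun w => Vhat i n w j k).
Proof.
case: n => [|n].
  rewrite (_ : (fun w => _) = cst 0); first exact: measurable_cst.
  by apply/funext => w; rewrite /Vhat/sample_cov big_ord0 scaler0 mxE.
rewrite (_ : (fun w => _) = (fun w => (n.+1%:R - 1)^-1 *
   (\sum_(l < n.+1) (eps i l w : 'cV[R]_d) j 0 * (eps i l w : 'cV[R]_d) k 0 -
    n.+1%:R^-1 * (\sum_(l < n.+1) (eps i l w : 'cV[R]_d) j 0) *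
    (\sum_(l < n.+1) (eps i l w : 'cV[R]_d) k 0)))); last first.
  by apply/funext => w; rewrite /Vhat sample_covE.
have me l i' : measurable_fun setT (fun w => (eps i l w : 'cV[R]_d) i' 0).
  exact: (measurableT_comp (measurable_coord i')).
apply: measurable_funM => //; apply: measurable_funB.
  by apply: measurable_sum => l; exact: measurable_funM.
by apply: measurable_funM; [apply: measurable_funM => //|]; apply: measurable_sum.
Qed.

Lemma lin_Vhat i j k : lin P (fun n w => Vhat i n w j k) (V i j k) (fun n w => Smx i n w j k).
Proof.
split; first exact: OP_Smx.
(* Stated for [n = 0] too, where the left side is [0^-1 = 0]: it bounds [(n - 1)^-1] from [n = 1]
   on. *)
have hb n : (n%:R)^-1 <= 2 / n.+1%:R :> R.
  case: n => [|n]; first by rewrite invr0 divr_ge0.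
  rewrite ler_pdivlMr ?ltr0n// mulrC ler_pdivrMr ?ltr0n// -natrM ler_nat.
  by rewrite mul2n -addnn addSnnS leq_addl.
have c1 : ((n%:R - 1)^-1 : R) @[n --> \oo] --> 0.
  apply: (cvg0_le_divn (C := 2)) => -[//|n _]; rewrite -natr1 addrK natr1.
  by rewrite ger0_norm ?invr_ge0.
have c2 : ((Num.sqrt n%:R / (n%:R - 1)) : R) @[n --> \oo] --> 0.
  apply: (cvg0_le_divsqrt (C := 2)) => -[//|n _]; set s := Num.sqrt _.
  have s0 : 0 < s by rewrite sqrtr_gt0 ltr0n.
  rewrite -natr1 addrK ger0_norm ?divr_ge0 ?(ltW s0)//.
  apply: le_trans (ler_wpM2l (ltW s0) (hb n)) _.
  have <- : s ^+ 2 = n.+1%:R by rewrite sqr_sqrtr.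
  by rewrite le_eqVlt; apply/orP; left; apply/eqP; field; rewrite gt_eqF.
(* With [S] the entry of [Smx] and [E_j] the normalised sum of the [j]-th residuals, the remainder
   is [S / (n - 1) + (V j k - E_j * E_k) * sqrt n / (n - 1)], an identity that requires [n >= 2]. *)
have H := oPD (oPM (OP_Smx i j k) (oP_cvg0 P c1))
  (oPM (OPD (OP_const P (V i j k)) (OPZ (-1) (OPM (OP_eps_sum i j) (OP_eps_sum i k)))) (oP_cvg0 P c2)).
apply: near_oP H; exists 2%N => // n /= n2 w.
have n0 : (0 < n)%N by exact: leq_trans n2.
rewrite /Vhat sample_covE// mxE /nsum /prodc sumrB sumr_const card_ord -[V i j k *+ n]mulr_natl.
set s := Num.sqrt n%:R; have s0 : s != 0 by rewrite gt_eqF// sqrtr_gt0 ltr0n.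
have ns : n%:R = s ^+ 2 by rewrite sqr_sqrtr.
have n1 : s ^+ 2 - 1 != 0.
  by rewrite -ns subr_eq0 pnatr_eq1; case: n n2 {n0 ns s0 s} => [|[]].
by rewrite ns; field; rewrite n1 s0.
Qed.

Lemma corr_mxE (W : 'M[R]_d) j k :
  corr_mx W j k = (Num.sqrt (W j j))^-1 * W j k * (Num.sqrt (W k k))^-1.
Proof. by rewrite /corr_mx /diag_invsqrt mul_diag_mx mul_mx_diag !mxE. Qed.

(** A correlation is a product of three factors, two of them inverse square roots of variances; the
    expansions of the factors multiply by [linM], and the resulting coefficients are those of
    [Mmx_vech]. *)
Lemma lin_corr_mx i l :
  let r := vechm (corr_mx (V i)) in
  lin P (fun n w => vechm (corr_mx (Vhat i n w)) l 0) (r l 0)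
        (fun n w => (Mmx (V i) r *m vech (Smx i n w)) l 0).
Proof.
move=> r; set j := (pairpm l).1; set k := (pairpm l).2.
have H := linM (linM (lin_comp (is_derive_invsqrt (V_diag_gt0 i j)) (lin_Vhat i j j))
  (lin_Vhat i j k)) (lin_comp (is_derive_invsqrt (V_diag_gt0 i k)) (lin_Vhat i k k)).
move: H; congr (lin P _ _ _).
- by apply/funext => n; apply/funext => w; rewrite vechmE corr_mxE.
- by rewrite vechmE corr_mxE.
- apply/funext => n; apply/funext => w; rewrite Mmx_vech -/j -/k /r vechmE corr_mxE -/j -/k.
  have a0 : Num.sqrt (V i j j) != 0 by rewrite gt_eqF// sqrtr_gt0.
  have b0 : Num.sqrt (V i k k) != 0 by rewrite gt_eqF// sqrtr_gt0.
  rewrite !sqrtrM ?ltW//.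
  (* The variances are written as squares of their roots, so that the identity becomes one between
     rational functions. *)
  rewrite -[in X in (2 * X * _)^-1](sqr_sqrtr (ltW (V_diag_gt0 i j))).
  rewrite -[in X in (2 * X * Num.sqrt (V i k k))^-1](sqr_sqrtr (ltW (V_diag_gt0 i k))).
  move: (Num.sqrt _) (Num.sqrt _) a0 b0 => A B a0 b0.
  by field; rewrite a0 b0.
Qed.

Lemma measurable_rhat i n l : measurable_fun setT (fun w => vechm (corr_mx (Vhat i n w)) l 0).
Proof.
under eq_fun do rewrite vechmE corr_mxE.
have ms j : measurable_fun setT (fun w => (Num.sqrt (Vhat i n w j j))^-1).
  by apply: (measurableT_comp measurable_invsqrt); exact: measurable_Vhat.
by apply: measurable_funM => //; apply: measurable_funM => //; exact: measurable_Vhat.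
Qed.

(** Both terms have the same leading part [M *m vech (Smx i n w)], which cancels in the
    difference. *)
Lemma is_oP1_linearization i :
  let r := vechm (corr_mx (V i)) in
  is_oP1 P (fun n w => Num.sqrt n%:R *: (vechm (corr_mx (Vhat i n w)) - r) -
    Mmx (V i) r *m (Num.sqrt n%:R *: (vech (Vhat i n w) - vech (V i)))).
Proof.
move=> r; have E n w l : (Num.sqrt n%:R *: (vechm (corr_mx (Vhat i n w)) - r) -
    Mmx (V i) r *m (Num.sqrt n%:R *: (vech (Vhat i n w) - vech (V i)))) l 0 =
  Num.sqrt n%:R * (vechm (corr_mx (Vhat i n w)) l 0 - r l 0) -
  \sum_s Mmx (V i) r l s * (Num.sqrt n%:R * (Vhat i n w (pairp s).1 (pairp s).2 -
                                              V i (pairp s).1 (pairp s).2)).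
  rewrite mxE [X in X + _]mxE [X in _ + X]mxE [X in _ - X]mxE [X in _ * X - _]mxE.
  rewrite [X in _ * (_ + X) - _]mxE; congr (_ - _).
  apply: eq_bigr => s _; congr (_ * _); rewrite mxE; congr (_ * _).
  by rewrite mxE [X in _ + X]mxE !vechE.
apply: oP_is_oP1 => [n j|l].
  under eq_fun do rewrite E; apply: measurable_funB.
    by apply: measurable_funM => //; apply: measurable_funB => //; exact: measurable_rhat.
  apply: measurable_sum => s; apply: measurable_funM => //; apply: measurable_funM => //.
  by apply: measurable_funB => //; exact: measurable_Vhat.
have [_ hr] := lin_corr_mx i l.
have hv s : oP P (fun n w => Mmx (V i) r l s * (Num.sqrt n%:R * (Vhat i n w (pairp s).1 (pairp s).2 -
    V i (pairp s).1 (pairp s).2) - Smx i n w (pairp s).1 (pairp s).2)).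
  by apply: oPZ; have [] := lin_Vhat i (pairp s).1 (pairp s).2.
apply: eq_oP (oPB hr (oP_sum (index_enum _) hv)) => n w; rewrite E -/r.
rewrite [in X in _ - X - _]mxE -addrA; congr (_ + _).
rewrite -opprD; congr (- _); rewrite -big_split/=; apply: eq_bigr => s _.
by rewrite vechE mulrBr addrC subrK.
Qed.

Definition epsSigma i : 'M[R]_(dimp d) :=
  cov_mx P (fun w => vech ((eps i 0%N w : 'cV[R]_d) *m (eps i 0%N w : 'cV[R]_d)^T)).

Definition prodp (s : 'I_(dimp d)) := prodc (pairp s).1 (pairp s).2.

Lemma epsSigmaE i s s' : epsSigma i s s' =
  Ex P (fun w => prodp s i (eps i 0%N w) * prodp s' i (eps i 0%N w)).
Proof.
have vE u w : vech ((eps i 0%N w : 'cV[R]_d) *m (eps i 0%N w : 'cV[R]_d)^T) u 0 =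
    (eps i 0%N w : 'cV[R]_d) (pairp u).1 0 * (eps i 0%N w : 'cV[R]_d) (pairp u).2 0.
  by rewrite vechE mxE big_ord1 mxE.
have L u : L2 P (fun w =>
    vech ((eps i 0%N w : 'cV[R]_d) *m (eps i 0%N w : 'cV[R]_d)^T) u 0).
  have -> : (fun w => vech ((eps i 0%N w : 'cV[R]_d) *m (eps i 0%N w : 'cV[R]_d)^T) u 0) =
      (fun w => (eps i 0%N w : 'cV[R]_d) (pairp u).1 0 * (eps i 0%N w : 'cV[R]_d) (pairp u).2 0).
    by apply/funext => w; exact: vE.
  exact: L2_eps2.
have E u : Ex P (fun w => vech ((eps i 0%N w : 'cV[R]_d) *m (eps i 0%N w : 'cV[R]_d)^T) u 0) =
    V i (pairp u).1 (pairp u).2.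
  by rewrite epsVE; congr Ex; apply/funext => w; exact: vE.
rewrite /epsSigma cov_mxE//; congr Ex; apply/funext => w.
by rewrite !E !vE.
Qed.

(** Yields both the positivity of the limit covariance and the variance of each projected
    summand. *)
Lemma form_epsSigma i (u : 'rV[R]_(dimp d)) :
  Ex P (fun w => (\sum_s u 0 s * prodp s i (eps i 0%N w)) ^+ 2) = (u *m epsSigma i *m u^T) 0 0.
Proof.
have L s : L2 P (fun w => u 0 s * prodp s i (eps i 0%N w)) by apply: L2Z; exact: L2_prodc.
have -> : (fun w => (\sum_s u 0 s * prodp s i (eps i 0%N w)) ^+ 2) = (fun w =>
    \sum_s \sum_s' (u 0 s * prodp s i (eps i 0%N w)) * (u 0 s' * prodp s' i (eps i 0%N w))).
  by apply/funext => w; rewrite expr2 big_distrlr.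
rewrite Ex_sum => [|s]; last by apply: Lint_sum => s'; exact: L2M.
rewrite mxE; under [RHS]eq_bigr do rewrite mxE mulr_suml.
rewrite exchange_big/=; apply: eq_bigr => s _.
rewrite Ex_sum => [|s']; last exact: L2M.
apply: eq_bigr => s' _; rewrite epsSigmaE mxE mulrAC -ExZ.
  by congr Ex; apply/funext => w; ring.
by apply: L2M; exact: L2_prodc.
Qed.

Lemma tr_epsSigma i : (epsSigma i)^T = epsSigma i.
Proof.
apply/matrixP => s s'; rewrite mxE !epsSigmaE; congr Ex; apply/funext => w.
by rewrite mulrC.
Qed.

(** * Limit law of linear combinations of the group sums *)

Section array_limit.
Variables (q : nat) (C : 'I_a -> 'M[R]_(q, dimp d)) (n : nat -> 'I_a -> nat).
Variable Z : nat -> T -> 'cV[R]_q.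
Hypothesis noo : forall b : nat, \forall m \near \oo, forall i, (b <= n m i)%N.
Hypothesis mZ : forall m j, measurable_fun setT (fun w => Z m w j 0).
Hypothesis ZS : forall j, oP P (fun m w =>
  Z m w j 0 - (\sum_i C i *m vech (Smx i (n m i) w)) j 0).

Let S : 'M[R]_q := \sum_i C i *m epsSigma i *m (C i)^T.

(** The scalar summand contributed by an observation of group [i] to the projection of [Z] on
    [t]. *)
Let g (t : 'cV[R]_q) i (x : borelV R d) : R := \sum_s (t^T *m C i) 0 s * prodp s i x.

Let form_S (t : 'cV[R]_q) :
  (t^T *m S *m t) 0 0 = \sum_i Ex P (fun w => g t i (eps i 0%N w) ^+ 2).
Proof.
rewrite mulmx_sumr mulmx_suml summxE; apply: eq_bigr => i _.
rewrite form_epsSigma trmx_mul trmxK; congr (fun_of_matrix _ 0 0).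
by rewrite !mulmxA.
Qed.

Let psd_S : psd S.
Proof.
split=> [|t]; last by rewrite form_S sumr_ge0// => i _; apply: Ex_ge0 => w; exact: sqr_ge0.
rewrite linear_sum/=; apply: eq_bigr => i _.
by rewrite !trmx_mul trmxK tr_epsSigma mulmxA.
Qed.

Let ninf i : n m i @[m --> \oo] --> \oo.
Proof.
move=> A [b _ bA]; apply: filterS (noo b) => m bm; apply: bA; exact: bm.
Qed.

Let dot_nsum (t : 'cV[R]_q) m w :
  (t^T *m (\sum_i C i *m vech (Smx i (n m i) w))) 0 0 = \sum_i nsum Y (g t) i (n m i) w.
Proof.
rewrite mulmx_sumr summxE; apply: eq_bigr => i _.
rewrite mulmxA mxE /nsum /g exchange_big/= mulr_sumr; apply: eq_bigr => s _.
by rewrite vechE [Smx _ _ _ _ _]mxE /nsum -mulr_sumr mulrCA.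
Qed.

Let oP_dot (t : 'cV[R]_q) :
  oP P (fun m w => (t^T *m Z m w) 0 0 - \sum_i nsum Y (g t) i (n m i) w).
Proof.
apply: eq_oP (oP_sum (index_enum _) (fun j => oPZ (t j 0) (ZS j))) => m w.
rewrite -dot_nsum !dotE -sumrB; apply: eq_bigr => j _; by rewrite mulrBr.
Qed.

Let OP_Z j : OP P (fun m w => Z m w j 0).
Proof.
have H : OP P (fun m w => (\sum_i C i *m vech (Smx i (n m i) w)) j 0).
  rewrite (_ : (fun m w => _) = (fun m w =>
     \sum_i \sum_s C i j s * Smx i (n m i) w (pairp s).1 (pairp s).2)).
    apply: OP_sum => i; apply: OP_sum => s; apply: OPZ.
    exact: (OP_comp (ninf i) (OP_Smx i (pairp s).1 (pairp s).2)).
  apply/funext => m; apply/funext => w; rewrite summxE; apply: eq_bigr => i _.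
  by rewrite mxE; apply: eq_bigr => s _; rewrite vechE.
rewrite (_ : (fun m w => _) = (fun m w => (Z m w j 0 -
   (\sum_i C i *m vech (Smx i (n m i) w)) j 0) + (\sum_i C i *m vech (Smx i (n m i) w)) j 0)).
  by apply: OPD => //; exact/oP_OP/ZS.
by apply/funext => m; apply/funext => w; rewrite subrK.
Qed.

Let mg (t : 'cV[R]_q) i : measurable_fun setT (g t i).
Proof.
by apply: measurable_sum => s; apply: measurable_funM => //; exact: measurable_prodc.
Qed.

Let L2g (t : 'cV[R]_q) i : L2 P (fun w => g t i (eps i 0%N w)).
Proof. by apply: L2_sum => s; apply: L2Z; exact: L2_prodc. Qed.

Let Ex_g (t : 'cV[R]_q) i : Ex P (fun w => g t i (eps i 0%N w)) = 0.
Proof.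
have Lp s : Lint P (fun w => prodp s i (eps i 0%N w)) by apply: L2_Lint; exact: L2_prodc.
rewrite Ex_sum => [|s]; last exact: LintZ.
by rewrite big1// => s _; rewrite ExZ// Ex_prodc mulr0.
Qed.

(** Each projection on [t] is a sum over the groups of normalised scalar sums up to [o_P(1)], so
    [array_clt] gives the limit of its cosines, which is the one computed under N(0, S) by
    [Ex_cos_normal_law]. *)
Theorem cvg_normal_of_nsum : exists2 nu : probability (borelV R q) R,
  is_mvnormal nu 0 S & cvg_in_distribution P Z nu.
Proof.
have [nu nuS] := exists_mvnormal psd_S; exists nu => //.
apply: cvg_in_distribution_of_cos => // t c.
have law B : measurable B ->
    nu ((fun x : borelV R q => (t^T *m (x : 'cV[R]_q)) 0 0) @^-1` B) =
    normal_law 0 ((t^T *m S *m t) 0 0) B.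
  move=> mB; have e := nuS t B mB.
  by have e0 : (t^T *m (0 : 'cV[R]_q)) 0 0 = 0 by [rewrite mulmx0 mxE]; rewrite e0 in e.
have := Ex_cos_normal_law c (measurable_dot t) (psd_S.2 t) law => ->.
have mdZ m : measurable_fun setT (fun w => (t^T *m Z m w) 0 0).
  under eq_fun do rewrite dotE.
  by apply: measurable_sum => j; apply: measurable_funM.
have H := array_clt eps_indep eps_ident (mg t) (L2g t) (Ex_g t) (fun i => erefl) (c := c) noo.
rewrite -form_S in H.
have b1 m : bmeas (fun w => cos ((t^T *m Z m w) 0 0 + c)).
  by apply: bmeas_cos; exact: measurable_funD.
have mns m : measurable_fun setT (fun w => \sum_i nsum Y (g t) i (n m i) w).
  apply: measurable_sum => i.
  by have [] := L2_nsum (Y := Y) eps_ident (mg t) (L2g t) i (n m i).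
have b2 m : bmeas (fun w => cos (c + \sum_i nsum Y (g t) i (n m i) w)).
  by apply: bmeas_cos; exact: measurable_funD.
have D : Ex P (fun w => cos ((t^T *m Z m w) 0 0 + c)) -
    Ex P (fun w => cos (c + \sum_i nsum Y (g t) i (n m i) w)) @[m --> \oo] --> 0.
  (* Cosines are bounded by [C = 1], so tolerance and exceptional mass [e / 3] give the error
     [e / 3 + 2 * (e / 3) = e]. *)
  apply/cvgr0Pnorm_le => e e0; have e30 : 0 < e / 3 by rewrite divr_gt0.
  apply: filterS (@oP_dot t _ _ e30 e30) => m [A [mA PA hA]].
  apply: le_trans (Ex_dist_le (C := 1) (b1 m) (b2 m) _ _ (ltW e30) mA PA _) _.
  - by move=> w; exact: cos_max.
  - by move=> w; exact: cos_max.
  - move=> w /hA; apply: le_trans; apply: le_trans (norm_cos_sub_le _ _) _.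
    by rewrite [c + _]addrC opprD addrACA subrr addr0.
  - lra.
rewrite -[X in _ --> X]add0r.
rewrite (_ : (fun m => _) = (fun m => (Ex P (fun w => cos ((t^T *m Z m w) 0 0 + c)) -
    Ex P (fun w => cos (c + \sum_i nsum Y (g t) i (n m i) w))) +
    Ex P (fun w => cos (c + \sum_i nsum Y (g t) i (n m i) w)))).
  exact: cvgD D H.
by apply/funext => m; rewrite subrK.
Qed.

End array_limit.

(** * The limit laws for one group and for the pooled vector *)

Local Notation r i := (vechm (corr_mx (V i))).
Local Notation rhat i n w := (vechm (corr_mx (Vhat i n w))).
Local Notation M i := (Mmx (V i) (r i)).
Local Notation Upsilon i := (M i *m epsSigma i *m (M i)^T).

Let scale_subE q (c : R) (x y : 'cV[R]_q) j : (c *: (x - y)) j 0 = c * (x j 0 - y j 0).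
Proof. by rewrite !mxE. Qed.

Theorem rhat_clt i : exists2 nu : probability (borelV R (dimpu d)) R,
  is_mvnormal nu 0 (Upsilon i) &
  cvg_in_distribution P (fun n w => Num.sqrt n%:R *: (rhat i n w - r i)) nu.
Proof.
(* The other groups enter with null coefficients, and all groups are given the common size [m]. *)
pose C k := if k == i then M i else 0.
have E : \sum_k C k *m epsSigma k *m (C k)^T = Upsilon i.
  rewrite (bigD1 i)//= /C eqxx big1 ?addr0// => k /negbTE ->.
  by rewrite !mul0mx.
rewrite -E; apply: (cvg_normal_of_nsum (n := fun m _ => m)) => [|m j|j].
- by move=> b; exists b.
- under eq_fun do rewrite scale_subE.
  by apply: measurable_funM => //; apply: measurable_funB => //; exact: measurable_rhat.
- have [_ hr] := lin_corr_mx i j; apply: eq_oP hr => n w.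
  rewrite scale_subE; congr (_ - _).
  rewrite summxE (bigD1 i)//= big1 ?addr0 => [|k /negbTE ki]; last by rewrite /C ki mul0mx mxE.
  by rewrite /C eqxx.
Qed.

Theorem pooled_rhat_clt (n : nat -> 'I_a -> nat) (kappa : 'I_a -> R) :
  (forall b : nat, \forall m \near \oo, forall i, (b <= n m i)%N) ->
  let N (m : nat) : nat := (\sum_(i < a) n m i)%N in
  (forall i, 0 < kappa i <= 1) ->
  (forall i, (n m i)%:R / (N m)%:R @[m --> \oo] --> kappa i) ->
  exists2 nu : probability (borelV R (\sum_(i < a) dimpu d)) R,
    is_mvnormal nu 0 (\mxdiag_(i < a) ((kappa i)^-1 *: Upsilon i)) &
    cvg_in_distribution P
      (fun m w => Num.sqrt (N m)%:R *:
         ((\mxcol_(i < a) rhat i (n m i) w) - (\mxcol_(i < a) r i))) nu.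
Proof.
move=> noo N k01 ncvg.
pose s i := (Num.sqrt (kappa i))^-1.
have k0 i : 0 < kappa i by have /andP[] := k01 i.
have s2 i : s i * s i = (kappa i)^-1 by rewrite -expr2 exprVn sqr_sqrtr// ltW.
(* Group [i] feeds only the [i]-th block, with the factor [kappa i ^ (- 1 / 2)]; hence the cross
   blocks of the limit covariance vanish and the diagonal ones carry [(kappa i)^-1]. *)
pose D i k : 'M[R]_(dimpu d, dimp d) := if k == i then s i *: M i else 0.
pose C i := \mxcol_(k < a) D i k.
have E : \sum_i C i *m epsSigma i *m (C i)^T = \mxdiag_(i < a) ((kappa i)^-1 *: Upsilon i).
  have CE i : C i *m epsSigma i *m (C i)^T =
      \mxblock_(k < a, l < a) (D i k *m epsSigma i *m (D i l)^T).
    by rewrite /C tr_mxcol mxcol_mul mul_mxcol_mxrow.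
  rewrite (eq_bigr _ (fun i _ => CE i)) -mxblock_sum /mxdiag; apply/eq_mxblockP => k l.
  rewrite (bigD1 k)//= big1 ?addr0 => [|i /negbTE ik].
    rewrite /D eqxx; have [_|_] := eqVneq k l; last by rewrite trmx0 mulmx0.
    by rewrite conform_mx_id linearZ/= -!scalemxAl -scalemxAr scalerA s2.
  by rewrite /D eq_sym ik !mul0mx.
rewrite -E; apply: (cvg_normal_of_nsum noo) => [m j|j].
  rewrite (_ : (fun w => _) = (fun w => Num.sqrt (N m)%:R *
      (rhat (tagnat.sig1 j) (n m (tagnat.sig1 j)) w (tagnat.sig2 j) 0 -
       r (tagnat.sig1 j) (tagnat.sig2 j) 0))); last first.
    by apply/funext => w; rewrite scale_subE mxE [X in _ - X]mxE.
  by apply: measurable_funM => //; apply: measurable_funB => //; exact: measurable_rhat.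
set i := tagnat.sig1 j; set l := tagnat.sig2 j.
have ninf : n m i @[m --> \oo] --> \oo.
  by move=> A [b _ bA]; apply: filterS (noo b) => m bm; apply: bA; exact: bm.
have [OA oA] := lin_corr_mx i l.
have c_cvg : (Num.sqrt ((n m i)%:R / (N m)%:R))^-1 @[m --> \oo] --> s i.
  apply: cvgV; first by rewrite gt_eqF// sqrtr_gt0.
  by apply: (cvg_comp _ _ (ncvg i)); exact: sqrt_continuous.
have c0 : (Num.sqrt ((n m i)%:R / (N m)%:R))^-1 - s i @[m --> \oo] --> 0.
  by rewrite -(subrr (s i)); apply: cvgB => //; exact: cvg_cst.
have oc := oP_cvg0 P c0.
have Oc := OPD (oP_OP oc) (OP_const P (s i)).
(* With [c = sqrt (N / n_i)] and [A] the leading term of group [i], the remainder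
   [c * sqrt n_i * (rhat - r) - s i * A] splits as [c * (sqrt n_i * (rhat - r) - A) + A * (c - s
   i)]. *)
apply: near_oP (oPD (oPM Oc (oP_comp ninf oA)) (oPM (OP_comp ninf OA) oc)).
apply: filterS (noo 1%N) => m n1 w; have ni : (0 < n m i)%N := n1 i.
have Nn : (0 < N m)%N by rewrite /N (bigD1 i)//= addn_gt0 ni.
have ZE : (Num.sqrt (N m)%:R *: ((\mxcol_(k < a) rhat k (n m k) w) - (\mxcol_(k < a) r k))) j 0 =
    Num.sqrt (N m)%:R * (rhat i (n m i) w l 0 - r i l 0).
  by rewrite scale_subE mxE [X in _ - X]mxE.
have CE k : (C k *m vech (Smx k (n m k) w)) j 0 = (D k i *m vech (Smx k (n m k) w)) l 0.
  by rewrite /C mxcol_mul mxE.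
have CS : (\sum_k C k *m vech (Smx k (n m k) w)) j 0 =
    s i * (M i *m vech (Smx i (n m i) w)) l 0.
  rewrite summxE (bigD1 i)//= CE big1 ?addr0 => [|k /negbTE ki].
    by rewrite /D eqxx -scalemxAl mxE.
  by rewrite CE /D eq_sym ki mul0mx mxE.
rewrite ZE CS subrK sqrtrM ?ler0n// sqrtrV ?ler0n// invfM invrK.
have sn : Num.sqrt (n m i)%:R != 0 :> R by rewrite gt_eqF// sqrtr_gt0 ltr0n.
move: (Num.sqrt (N m)%:R) (rhat i (n m i) w l 0) (r i l 0)
  ((M i *m vech (Smx i (n m i) w)) l 0) (s i) => x1 x2 x3 x4 x5.
by field.
Qed.

End linearization.

Theorem theorem3p1
    (R : realType) (dT : measure_display) (T : measurableType dT)
    (P : probability T R) (d a : nat) (hd : (2 <= d)%N) (ha : (1 <= a)%N)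
    (mu : 'I_a -> 'cV[R]_d)
    (eps : 'I_a -> nat -> {RV P >-> borelV R d})
    (eps_indep : mutually_independent
       (fun ik : 'I_a * nat => eps ik.1 ik.2))
    (eps_ident : forall i k, identically_distributed (eps i k) (eps i 0%N))
    (eps_mean0 : forall (i : 'I_a) (j : 'I_d),
       ('E_P[(fun w => (eps i 0%N w : 'cV[R]_d) j 0)%R] = 0)%E)
    (eps_moment4 : forall i : 'I_a,
       ('E_P[(fun w => enorm (eps i 0%N w : 'cV[R]_d) ^+ 4)%R] < +oo)%E)
    (V_diag_gt0 : forall (i : 'I_a) (j : 'I_d),
       0 < cov_mx P (eps i 0%N : T -> 'cV[R]_d) j j) :
  let X (i : 'I_a) (k : nat) (w : T) : 'cV[R]_d := mu i + eps i k w in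
  let V (i : 'I_a) : 'M[R]_d := cov_mx P (eps i 0%N : T -> 'cV[R]_d) in
  let Sigma (i : 'I_a) : 'M[R]_(dimp d) :=
    cov_mx P (fun w => vech ((eps i 0%N w : 'cV[R]_d) *m
                             (eps i 0%N w : 'cV[R]_d)^T)) in
  let v (i : 'I_a) : 'cV[R]_(dimp d) := vech (V i) in
  let r (i : 'I_a) : 'cV[R]_(dimpu d) := vechm (corr_mx (V i)) in
  let Vhat (i : 'I_a) (n : nat) (w : T) : 'M[R]_d :=
    sample_cov (fun k => X i k w) n in
  let vhat (i : 'I_a) (n : nat) (w : T) : 'cV[R]_(dimp d) :=
    vech (Vhat i n w) in
  let rhat (i : 'I_a) (n : nat) (w : T) : 'cV[R]_(dimpu d) :=
    vechm (corr_mx (Vhat i n w)) in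
  let M (i : 'I_a) : 'M[R]_(dimpu d, dimp d) := Mmx (V i) (r i) in
  let Upsilon (i : 'I_a) : 'M[R]_(dimpu d) := M i *m Sigma i *m (M i)^T in
  [/\ forall i : 'I_a,
        is_oP1 P (fun n w =>
          Num.sqrt n%:R *: (rhat i n w - r i)
          - M i *m (Num.sqrt n%:R *: (vhat i n w - v i))),
      forall i : 'I_a,
        exists2 nu : probability (borelV R (dimpu d)) R,
          is_mvnormal nu 0 (Upsilon i) &
          cvg_in_distribution P
            (fun n w => Num.sqrt n%:R *: (rhat i n w - r i)) nu
    & forall (n : nat -> 'I_a -> nat) (kappa : 'I_a -> R),
        (forall b : nat, \forall m \near \oo, forall i, (b <= n m i)%N) ->
        let N (m : nat) : nat := (\sum_(i < a) n m i)%N in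
        (forall i, 0 < kappa i <= 1) ->
        (forall i, (n m i)%:R / (N m)%:R @[m --> \oo] --> kappa i) ->
        exists2 nu : probability (borelV R (\sum_(i < a) dimpu d)) R,
          is_mvnormal nu 0 (\mxdiag_(i < a) ((kappa i)^-1 *: Upsilon i)) &
          cvg_in_distribution P
            (fun m w => Num.sqrt (N m)%:R *:
               ((\mxcol_(i < a) rhat i (n m i) w) - (\mxcol_(i < a) r i))) nu].
Proof.
move=> X V Sigma v r Vhat vhat rhat M Upsilon; split=> [i|i|].
- exact: (is_oP1_linearization mu eps_indep eps_ident eps_mean0 eps_moment4 V_diag_gt0).
- exact: (rhat_clt mu eps_indep eps_ident eps_mean0 eps_moment4 V_diag_gt0).
- exact: (pooled_rhat_clt mu eps_indep eps_ident eps_mean0 eps_moment4 V_diag_gt0).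
Qed.
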